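(* Let $d\le 3$. Let $\mathcal{H}$ be a separable Hilbert space, let $\Lambda\simeq\mathbb{Z}^d\subset\mathbb{R}^d$ be a lattice, and let $\{P(k)\}_{k\in\mathbb{R}^d}\subset\mathcal{B}(\mathcal{H})$ be a family of orthogonal projectors of finite rank $m\in\mathbb{N}$ satisfying: (P1) the map $\mathbb{R}^d\ni k\mapsto P(k)\in\mathcal{B}(\mathcal{H})$ is $C^\infty$-smooth (operator norm); (P2) there is a unitary representation $\tau:\Lambda\to\mathcal{U}(\mathcal{H})$, $\lambda\mapsto\tau_\lambda$, such that $P(k+\lambda)=\tau_\lambda P(k)\tau_\lambda^{-1}$ for all $k\in\mathbb{R}^d$, $\lambda\in\Lambda$; (P3) there is an antiunitary operator $\Theta$ on $\mathcal{H}$ with $P(-k)=\Theta P(k)\Theta^{-1}$ for all $k$ and $\Theta^2=\mathrm{Id}_{\mathcal{H}}$; (P4) $\Theta\tau_\lambda=\tau_\lambda^{-1}\Theta$ for all $\lambda\in\Lambda$. Then there exist maps $\phi_1,\dots,\phi_m:\mathbb{R}^d\to\mathcal{H}$ such that: for every $k\in\mathbb{R}^d$, $\{\phi_1(k),\dots,\phi_m(k)\}$ is an orthonormal basis of $\operatorname{Ran}P(k)$; each $\phi_a$ is $C^\infty$-smooth; $\phi_a(k+\lambda)=\tau_\lambda\phi_a(k)$ for all $k\in\mathbb{R}^d$, $\lambda\in\Lambda$, $a\in\{1,\dots,m\}$; and $\phi_a(-k)=\Theta\phi_a(k)$ for all $k\in\mathbb{R}^d$, $a\in\{1,\dots,m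\}$.
   Context: An antiunitary operator is a surjective antilinear map $C:\mathcal{H}\to\mathcal{H}$ with $\langle C\phi,C\psi\rangle=\langle\psi,\phi\rangle$. A unitary representation satisfies $\tau_0=\mathrm{Id}$ and $\tau_{\lambda_1+\lambda_2}=\tau_{\lambda_1}\tau_{\lambda_2}$. (In the paper's terminology the conclusion says there exists a global smooth symmetric Bloch frame, i.e. a smooth, $\tau$-equivariant and time-reversal invariant one.) *)

(* Defs.v *)
From mathcomp Require Import all_boot all_algebra.
From mathcomp Require Import reals.
From mathcomp.real_closed Require Export complex.
Set Implicit Arguments. Unset Strict Implicit. Unset Printing Implicit Defensive.
Import GRing.Theory Num.Theory.
Local Open Scope ring_scope.
Local Open Scope complex_scope.

Section HilbertDefs.
Variable R : realType.
Variable H : lmodType R[i].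
(* inner product: antilinear in the first slot, linear in the second *)
Variable ip : H -> H -> R[i].

Definition hnorm (v : H) : R := Num.sqrt (complex.Re (ip v v)).

Definition is_inner_product : Prop :=
  [/\ (forall (a : R[i]) (x y z : H), ip x (a *: y + z) = a * ip x y + ip x z),
      (forall x y : H, ip y x = conjc (ip x y)),
      (forall x : H, complex.Im (ip x x) = 0 /\ 0 <= complex.Re (ip x x))
    & (forall x : H, ip x x = 0 -> x = 0)].

Definition hcomplete : Prop :=
  forall u : nat -> H,
    (forall eps : R, 0 < eps -> exists N : nat, forall n p : nat,
        (N <= n)%N -> (N <= p)%N -> hnorm (u n - u p) < eps) ->
    exists l : H, forall eps : R, 0 < eps -> exists N : nat, forall n : nat,
        (N <= n)%N -> hnorm (u n - l) < eps.

Definition hseparable : Prop :=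
  exists e : nat -> H, forall (v : H) (eps : R), 0 < eps ->
    exists n : nat, hnorm (v - e n) < eps.

Definition separable_hilbert : Prop :=
  [/\ is_inner_product, hcomplete & hseparable].

Definition is_linear_op (A : H -> H) : Prop :=
  forall (a : R[i]) (x y : H), A (a *: x + y) = a *: A x + A y.

Definition is_antilinear_op (A : H -> H) : Prop :=
  forall (a : R[i]) (x y : H), A (a *: x + y) = conjc a *: A x + A y.

Definition bounded_op (A : H -> H) : Prop :=
  is_linear_op A /\ exists M : R, forall x : H, hnorm (A x) <= M * hnorm x.

Definition orth_projector (A : H -> H) : Prop :=
  [/\ bounded_op A, (forall x, A (A x) = A x) & (forall x y, ip (A x) y = ip x (A y))].

Definition in_ran (A : H -> H) (v : H) : Prop := exists w : H, v = A w.

Definition has_rank (A : H -> H) (m : nat) : Prop :=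
  exists b : 'I_m -> H,
    (forall c : 'I_m -> R[i], \sum_(i < m) c i *: b i = 0 -> forall i, c i = 0) /\
    (forall v : H, in_ran A v <-> exists c : 'I_m -> R[i], v = \sum_(i < m) c i *: b i).

Definition unitary (U : H -> H) : Prop :=
  [/\ is_linear_op U, (forall y, exists x, U x = y) & (forall x y, ip (U x) (U y) = ip x y)].

Definition antiunitary (T : H -> H) : Prop :=
  [/\ is_antilinear_op T, (forall y, exists x, T x = y) & (forall x y, ip (T x) (T y) = ip y x)].

Variable d : nat.

Definition e_dir (j : 'I_d) : 'rV[R]_d := delta_mx 0 j.

Definition near_pt (delta : R) (k k' : 'rV[R]_d) : Prop :=
  forall i : 'I_d, `|k' 0 i - k 0 i| < delta.

Definition op_pderiv (F : 'rV[R]_d -> H -> H) (j : 'I_d) (G : 'rV[R]_d -> H -> H) : Prop :=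
  forall (k : 'rV[R]_d) (eps : R), 0 < eps -> exists2 delta : R, 0 < delta &
    forall h : R, h != 0 -> `|h| < delta -> forall v : H,
      hnorm ((h^-1)%:C *: (F (k + h *: e_dir j) v - F k v) - G k v) <= eps * hnorm v.

Definition op_cont (F : 'rV[R]_d -> H -> H) : Prop :=
  forall (k : 'rV[R]_d) (eps : R), 0 < eps -> exists2 delta : R, 0 < delta &
    forall k', near_pt delta k k' -> forall v : H, hnorm (F k' v - F k v) <= eps * hnorm v.

(* C^oo in operator norm: all iterated partial derivatives exist (in B(H),
   in operator norm) and are continuous in operator norm; D s is the
   iterated partial derivative along the list of directions s. *)
Definition op_smooth (F : 'rV[R]_d -> H -> H) : Prop :=
  exists D : seq 'I_d -> 'rV[R]_d -> H -> H,
    [/\ D [::] = F,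
        (forall s k, bounded_op (D s k)),
        (forall s j, op_pderiv (D s) j (D (j :: s)))
      & (forall s, op_cont (D s))].

Definition vec_pderiv (f : 'rV[R]_d -> H) (j : 'I_d) (g : 'rV[R]_d -> H) : Prop :=
  forall (k : 'rV[R]_d) (eps : R), 0 < eps -> exists2 delta : R, 0 < delta &
    forall h : R, h != 0 -> `|h| < delta ->
      hnorm ((h^-1)%:C *: (f (k + h *: e_dir j) - f k) - g k) <= eps.

Definition vec_cont (f : 'rV[R]_d -> H) : Prop :=
  forall (k : 'rV[R]_d) (eps : R), 0 < eps -> exists2 delta : R, 0 < delta &
    forall k', near_pt delta k k' -> hnorm (f k' - f k) <= eps.

Definition vec_smooth (f : 'rV[R]_d -> H) : Prop :=
  exists D : seq 'I_d -> 'rV[R]_d -> H,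
    [/\ D [::] = f,
        (forall s j, vec_pderiv (D s) j (D (j :: s)))
      & (forall s, vec_cont (D s))].

(* Lambda = Z-span of the rows of an invertible matrix B *)
Definition in_lattice (B : 'M[R]_d) (l : 'rV[R]_d) : Prop :=
  exists z : 'rV[int]_d, l = map_mx (fun n : int => n%:~R) z *m B.

Definition unitary_rep (B : 'M[R]_d) (tau : 'rV[R]_d -> H -> H) : Prop :=
  [/\ (forall l, in_lattice B l -> unitary (tau l)),
      (forall v, tau 0 v = v)
    & (forall l1 l2, in_lattice B l1 -> in_lattice B l2 ->
         forall v, tau (l1 + l2) v = tau l1 (tau l2 v))].

Definition onb_of_ran (m : nat) (phi : 'I_m -> H) (A : H -> H) : Prop :=
  [/\ (forall a b : 'I_m, ip (phi a) (phi b) = (a == b)%:R),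
      (forall a, in_ran A (phi a))
    & (forall v, in_ran A v -> exists c : 'I_m -> R[i], v = \sum_(a < m) c a *: phi a)].

End HilbertDefs.

(* Main.v *)
Require Import Defs.
From HB Require Import structures.
From mathcomp Require Import all_boot all_order all_algebra.
From mathcomp Require Import boolp classical_sets functions reals interval_inference topology normedtype.
From mathcomp Require Import prodnormedzmodule sequences derive realfun exp trigo.
From mathcomp Require Import lra ring zify.
From mathcomp.real_closed Require Import complex.
Set Implicit Arguments. Unset Strict Implicit. Unset Printing Implicit Defensive.
Import Order.TTheory GRing.Theory Num.Theory.
Import numFieldNormedType.Exports.
Local Open Scope ring_scope.

(* Proceed by induction on the rank [m]: if [phi] is a smooth symmetric unit
   section of [P], then [P - |phi><phi|] satisfies the same hypotheses with rank
   [m - 1]. To find [phi], it suffices to find a Lipschitz symmetric section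
   which is bounded away from zero: averaging it against an equivariant smooth
   partition of unity, projecting by [P], symmetrising and normalising makes it
   smooth.

   If [m >= 2], start from the zero section. The fibres have real dimension at
   least [4 > d], so a small equivariant perturbation supported near a point [g]
   removes the zeros near [g]; finitely many perturbations suffice. When
   [2 g] is a lattice vector the perturbation must respect the real structure of
   the fibre at [g], and these points are treated first.

   If [m = 1], add the coordinates one at a time. Parallel transport along the
   new coordinate [y] gives a section for [|y| <= 1/2] whose values at
   [y = -1/2] and [y = 1/2] differ by a periodic phase; time reversal makes this
   phase even, hence it has a periodic logarithm, and a rotation depending on [y]
   repairs the mismatch. *)

(** * Lipschitz maps *)

(** Sections stay merely Lipschitz until the very end, so clamping, tent-shaped cut-offs and gluing
    along hyperplanes need no matching of derivatives. Lipschitz rather than continuous, because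
    every choice is quantitative: the number of transport steps, the size of angle increments, the
    mesh of a grid and the side of a pigeonhole cell are all read off from Lipschitz constants. In
    particular, averaging over a grid of mesh [1/N] displaces a section by a relative error of at
    most [L/N], which is harmless once it is below the lower bound of the section. The sign in
    [Theta^2 = Id] enters through fixed vectors. At a point [g] with [2 g] equal to a lattice
    vector, (P4) makes [tau \o Theta] an antiunitary involution of the fibre, and an antilinear
    involution has nonzero fixed vectors, whereas an antilinear map of square [-Id] has none. Such
    vectors are the only values that a symmetric section can take at [g]. They start the
    construction in rank one, at the origin, and make the first perturbations possible in higher
    rank. *)

Section Lipschitz.
Variable R : realType.

Definition Lip (U V : normedZmodType R) (f : U -> V) : Prop :=
  exists2 L : R, 0 <= L & forall x y, `|f x - f y| <= L * `|x - y|.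

Definition bdd (U : Type) (V : normedZmodType R) (f : U -> V) : Prop :=
  exists2 B : R, 0 <= B & forall x, `|f x| <= B.

Lemma Lip_cst (U V : normedZmodType R) (c : V) : Lip (fun _ : U => c).
Proof. by exists 0 => // x y; rewrite subrr normr0 mul0r. Qed.

Lemma LipD (U V : normedZmodType R) (f g : U -> V) :
  Lip f -> Lip g -> Lip (fun x => f x + g x).
Proof.
move=> [L L0 Hf] [M M0 Hg]; exists (L + M); first exact: addr_ge0.
move=> x y; rewrite opprD addrACA mulrDl.
by apply: le_trans (ler_normD _ _) _; apply: lerD.
Qed.

Lemma LipN (U V : normedZmodType R) (f : U -> V) : Lip f -> Lip (fun x => - f x).
Proof. by move=> [L L0 Hf]; exists L => // x y; rewrite -opprD normrN. Qed.

Lemma Lip_comp (U V W : normedZmodType R) (f : V -> W) (g : U -> V) :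
  Lip f -> Lip g -> Lip (fun x => f (g x)).
Proof.
move=> [L L0 Hf] [M M0 Hg]; exists (L * M); first exact: mulr_ge0.
move=> x y; apply: le_trans (Hf _ _) _; rewrite -mulrA; exact: ler_wpM2l.
Qed.

Lemma Lip_isom (U V W : normedZmodType R) (T : V -> W) (f : U -> V) :
  (forall u v, T (u - v) = T u - T v) -> (forall v, `|T v| <= `|v|) ->
  Lip f -> Lip (fun x => T (f x)).
Proof.
move=> TB Tn [L L0 Hf]; exists L => // x y.
by rewrite -TB; apply: le_trans (Tn _) _.
Qed.

Lemma Lip_bil (U V1 V2 W : normedZmodType R) (B : V1 -> V2 -> W) (C : R)
    (f : U -> V1) (g : U -> V2) :
  0 <= C ->
  (forall a a' b, B (a - a') b = B a b - B a' b) ->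
  (forall a b b', B a (b - b') = B a b - B a b') ->
  (forall a b, `|B a b| <= C * `|a| * `|b|) ->
  Lip f -> Lip g -> bdd f -> bdd g -> Lip (fun x => B (f x) (g x)).
Proof.
move=> C0 Bl Br Bn [L L0 Hf] [M M0 Hg] [bf bf0 Hbf] [bg bg0 Hbg].
exists (C * L * bg + C * bf * M).
  by rewrite addr_ge0 // mulr_ge0 // mulr_ge0.
move=> x y.
have -> : B (f x) (g x) - B (f y) (g y) = B (f x - f y) (g x) + B (f y) (g x - g y).
  by rewrite Bl Br addrA subrK.
apply: le_trans (ler_normD _ _) _; rewrite mulrDl; apply: lerD.
  apply: le_trans (Bn _ _) _.
  rewrite -!mulrA ler_wpM2l // mulrCA [leRHS]mulrC -mulrA mulrCA.
  rewrite mulrCA mulrA.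
  by apply: ler_pM => //; rewrite mulrC.
apply: le_trans (Bn _ _) _; rewrite -!mulrA ler_wpM2l //.
by apply: ler_pM.
Qed.

Lemma Lip_scale (U : normedZmodType R) (V : normedModType R) (f : U -> R) (g : U -> V) :
  Lip f -> Lip g -> bdd f -> bdd g -> Lip (fun x => f x *: g x).
Proof.
apply: (@Lip_bil _ _ _ _ (fun a v => a *: v) 1) => //.
- by move=> a a' b; rewrite scalerBl.
- by move=> a b b'; rewrite scalerBr.
- by move=> a b; rewrite mul1r normrZ.
Qed.

Lemma LipM (U : normedZmodType R) (f g : U -> R) :
  Lip f -> Lip g -> bdd f -> bdd g -> Lip (fun x => f x * g x).
Proof.
apply: (@Lip_bil _ _ _ _ (fun a v => a * v) 1) => //.
- by move=> a a' b; rewrite mulrBl.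
- by move=> a b b'; rewrite mulrBr.
- by move=> a b; rewrite mul1r normrM.
Qed.

(** Pairs at distance more than [r] are handled by boundedness: a change of at most [2 B] is at most
    [2 B / r] times the distance. This suits maps built by rounding to the lattice, which are
    controlled only between nearby points. *)
Lemma Lip_local (U V : normedZmodType R) (f : U -> V) (L r : R) :
  0 <= L -> 0 < r ->
  (forall x y, `|x - y| <= r -> `|f x - f y| <= L * `|x - y|) ->
  bdd f -> Lip f.
Proof.
move=> L0 r0 Hf [B B0 HB]; exists (L + 2 * B / r).
  by rewrite addr_ge0 // divr_ge0 ?mulr_ge0 // ltW.
move=> x y; have [xy|xy] := leP `|x - y| r.
  apply: le_trans (Hf _ _ xy) _; rewrite ler_wpM2r // lerDl.
  by rewrite divr_ge0 ?mulr_ge0 // ltW.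
apply: (@le_trans _ _ (2 * B)).
  apply: le_trans (ler_normB _ _) _; rewrite mulr_natl mulr2n; exact: lerD.
apply: (@le_trans _ _ (2 * B / r * `|x - y|)); last first.
  by rewrite ler_wpM2r // lerDr.
by rewrite -mulrA ler_peMr ?mulr_ge0 // mulrC ler_pdivlMr // mul1r ltW.
Qed.

Definition nrm (V : normedModType R) (v : V) : V := `|v|^-1 *: v.

Lemma norm_nrm (V : normedModType R) (v : V) : v != 0 -> `|nrm v| = 1.
Proof.
by move=> v0; rewrite normrZ normfV normr_id mulVf // normr_eq0.
Qed.

Lemma Lip_nrm (U : normedZmodType R) (V : normedModType R) (f : U -> V) (c : R) :
  0 < c -> (forall x, c <= `|f x|) -> Lip f -> Lip (fun x => nrm (f x)).
Proof.
move=> c0 Hc [L L0 Hf]; exists (2 * L / c).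
  by rewrite divr_ge0 ?mulr_ge0 // ltW.
move=> x y; have fx0 := lt_le_trans c0 (Hc x); have fy0 := lt_le_trans c0 (Hc y).
have -> : nrm (f x) - nrm (f y) =
    `|f x|^-1 *: (f x - f y) + (`|f x|^-1 * (`|f y| - `|f x|) / `|f y|) *: f y.
  rewrite /nrm scalerBr -addrA; congr (_ + _).
  rewrite -scaleNr -scalerDl -scaleNr; congr (_ *: _).
  by field; rewrite !gt_eqF.
apply: le_trans (ler_normD _ _) _; rewrite 2!normrZ.
have e1 : `| `|f x|^-1 | * `|f x - f y| <= L / c * `|x - y|.
  rewrite ger0_norm ?invr_ge0 // mulrAC [leRHS]mulrC; apply: ler_pM.
  - by rewrite invr_ge0.
  - by [].
  - by rewrite lef_pV2 ?posrE.
  - exact: Hf.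
suff e2 : `| `|f x|^-1 * (`|f y| - `|f x|) / `|f y| | * `|f y| <= L / c * `|x - y|.
  apply: le_trans (lerD e1 e2) _; rewrite -mulrDl; apply: ler_wpM2r => //.
  by rewrite -!mulrA -mulr2n mulr_natl.
apply: le_trans e1; rewrite !normrM normrV ?unitfE ?gt_eqF // [`| `|f y|^-1|]ger0_norm ?invr_ge0 //.
rewrite mulfVK ?gt_eqF //; apply: ler_wpM2l; first by rewrite invr_ge0.
by rewrite [X in _ <= X]distrC; exact: ler_dist_dist.
Qed.

End Lipschitz.

Lemma nat_above (R : realType) (x : R) : exists n : nat, x < n.+1%:R.
Proof.
exists (Num.bound `|x|); apply: le_lt_trans (ler_norm _) _.
by apply: lt_trans (archi_boundP (normr_ge0 x)) _; rewrite ltr_nat.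
Qed.

(** * Sup-norm coordinates and rounding to the integer lattice *)

Section Coordinates.
Variable R : realType.
Variable d : nat.
Implicit Types x y : 'rV[R]_d.
Implicit Types z : 'rV[int]_d.

Lemma coord_le x i : `|x 0 i| <= `|x|.
Proof. by rewrite [leRHS]/Num.norm /= mx_normrE; apply/bigmax_geP; right; exists (0, i). Qed.

Lemma norm_leP x (r : R) : 0 <= r -> reflect (forall i, `|x 0 i| <= r) (`|x| <= r).
Proof.
move=> r0; apply: (iffP idP) => [xr i|H].
  exact: le_trans (coord_le _ _) xr.
rewrite [leLHS]/Num.norm /= mx_normrE; apply/bigmax_leP; split=> // -[i j] _ /=.
by rewrite ord1.
Qed.

Lemma norm_ltP x (r : R) : 0 < r -> reflect (forall i, `|x 0 i| < r) (`|x| < r).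
Proof.
move=> r0; apply: (iffP idP) => [xr i|H].
  exact: le_lt_trans (coord_le _ _) xr.
rewrite [ltLHS]/Num.norm /= mx_normrE; apply/bigmax_ltP; split=> // -[i j] _ /=.
by rewrite ord1.
Qed.

Definition zr z : 'rV[R]_d := map_mx intr z.

Lemma zr0 : zr 0 = 0. Proof. by apply/rowP => i; rewrite !mxE. Qed.
Lemma zrD z z' : zr (z + z') = zr z + zr z'.
Proof. by apply/rowP => i; rewrite !mxE rmorphD. Qed.
Lemma zrN z : zr (- z) = - zr z.
Proof. by apply/rowP => i; rewrite !mxE rmorphN. Qed.

Lemma zr_norm_lt1 z : `|zr z| < 1 -> z = 0.
Proof.
move=> /(norm_ltP _ ltr01) H; apply/rowP => i; have := H i.
rewrite !mxE -intr_norm -[1]/(1%:~R) ltr_int.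
by move: (z 0 i) => k kl; lia.
Qed.

(** Nearest integer, ties going up. It commutes with integer translations but, because of the ties,
    not with negation; so maps defined through [rd] or [rdv] are first shown to be independent of
    the choice between equally near lattice points, and symmetry under [x |-> - x] follows from
    that. *)
Definition rd (t : R) : int := Num.floor (t + 1 / 2).
Definition rdv x : 'rV[int]_d := \row_i rd (x 0 i).

Lemma rd_le t : `|t - (rd t)%:~R| <= 1 / 2.
Proof.
have tn : t + 1/2 \is Num.real by exact: num_real.
have := floor_itv (t + 1/2); rewrite -/(rd t) => /andP[].
rewrite intrD /= => h1 h2; rewrite ler_norml; apply/andP; split; lra.
Qed.

Lemma rdv_le x : `|x - zr (rdv x)| <= 1 / 2.
Proof. by apply/norm_leP => [|i]; rewrite ?mxE; [lra | exact: rd_le]. Qed.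

Lemma rdD t (k : int) : rd (t + k%:~R) = rd t + k.
Proof. by rewrite /rd addrAC floorDrz ?intrKfloor // intr_int. Qed.

Lemma rdvD x z : rdv (x + zr z) = rdv x + z.
Proof. by apply/rowP => i; rewrite !mxE rdD. Qed.

Lemma rdv_small x z : `|x - zr z| < 1 / 2 -> rdv x = z.
Proof.
move=> h; apply/subr0_eq/zr_norm_lt1; rewrite zrD zrN.
have -> : zr (rdv x) - zr z = (x - zr z) - (x - zr (rdv x)).
  by rewrite opprB [RHS]addrC addrA subrK.
have h2 := rdv_le x; apply: le_lt_trans (ler_normB _ _) _.
lra.
Qed.

End Coordinates.

(** * Lipschitz bounds and uniqueness of small angles *)

Section Trig.
Variable R : realType.

Lemma MVT_Lip (f df : R -> R) (a b K : R) :
  (forall x, a <= x <= b -> is_derive x 1 f (df x)) ->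
  (forall x, a <= x <= b -> `|df x| <= K) ->
  forall x y, a <= x <= b -> a <= y <= b -> `|f x - f y| <= K * `|x - y|.
Proof.
move=> Hf HK x y; wlog xy : x y / x <= y => [hw|] xab yab.
  case: (leP x y) => [|/ltW] xy; first exact: hw.
  by rewrite distrC [X in _ <= _ * X]distrC; exact: hw.
have sub t : t \in `[x, y] -> a <= t <= b.
  rewrite in_itv /= => /andP[tx ty]; case/andP: xab => ax _; case/andP: yab => _ yb.
  by rewrite (le_trans ax tx) (le_trans ty yb).
have [||c cxy E] := @MVT_segment _ f df x y xy.
- by move=> t txy; apply/Hf/sub; exact: subset_itv_oo_cc.
- apply: derivable_within_continuous => t txy; have := Hf t (sub t txy).
  by case.
by rewrite distrC E normrM [X in _ <= _ * X]distrC ler_wpM2r // HK // sub.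
Qed.

Lemma cos_Lip : Lip (@cos R).
Proof.
exists 1 => // x y; pose m := Num.min x y; pose M := Num.max x y.
have xy t : t = x \/ t = y -> m <= t <= M.
  by case=> ->; rewrite ge_min le_max lexx ?orbT.
apply: (@MVT_Lip _ (fun x => - sin x) m M); try by apply: xy; tauto.
by move=> t _; rewrite normrN ler_norml sin_geN1 sin_le1.
Qed.

Lemma sin_Lip : Lip (@sin R).
Proof.
exists 1 => // x y; pose m := Num.min x y; pose M := Num.max x y.
have xy t : t = x \/ t = y -> m <= t <= M.
  by case=> ->; rewrite ge_min le_max lexx ?orbT.
apply: (@MVT_Lip _ cos m M); try by apply: xy; tauto.
by move=> t _; rewrite ler_norml cos_geN1 cos_le1.
Qed.

Lemma cos_bdd : bdd (@cos R).
Proof. by exists 1 => // x; rewrite ler_norml cos_geN1 cos_le1. Qed.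
Lemma sin_bdd : bdd (@sin R).
Proof. by exists 1 => // x; rewrite ler_norml sin_geN1 sin_le1. Qed.

Lemma asin_Lip (s t : R) :
  `|s| <= 1 / 2 -> `|t| <= 1 / 2 -> `|asin s - asin t| <= 2 * `|s - t|.
Proof.
move=> hs ht.
apply: (@MVT_Lip _ (fun x => (Num.sqrt (1 - x ^+ 2))^-1) (- (1/2)) (1/2)); rewrite -?ler_norml //.
  move=> x hx; apply: is_derive1_asin; lra.
move=> x /andP[x1 x2]; have h : (1/2) ^+ 2 <= 1 - x ^+ 2 by nra.
have h2 : 1 / 2 <= Num.sqrt (1 - x ^+ 2).
  by rewrite -[leLHS]ger0_norm; [rewrite -sqrtr_sqr ler_wsqrtr | lra].
rewrite ger0_norm ?invr_ge0 ?sqrtr_ge0 //.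
rewrite -[2]invrK lef_pV2 ?posrE //; lra.
Qed.

(** This is where discreteness of the winding number enters: two logarithms of the same phase that
    differ by at most 1 are equal. *)
Lemma cos_eq1_small (t : R) : `|t| <= 1 -> cos t = 1 -> t = 0.
Proof.
move=> t1; rewrite -cos_norm -[RHS]cos0 => /cos_inj h; apply/normr0_eq0/h.
  rewrite in_itv /= normr_ge0 /=; have := pi_ge2 R; lra.
by rewrite in_itv /= lexx pi_ge0.
Qed.

Lemma angle_exists (a b : R) : a ^+ 2 + b ^+ 2 = 1 ->
  exists t, cos t = a /\ sin t = b.
Proof.
move=> h; have a1 : -1 <= a <= 1 by apply/andP; split; nra.
have ai : a \in `[-1, 1] by rewrite in_itv.
have sb : Num.sqrt (1 - a ^+ 2) = `|b|.
  by rewrite -sqrtr_sqr; congr Num.sqrt; lra.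
case: (leP 0 b) => b0.
  by exists (acos a); rewrite acosK // sin_acos // sb ger0_norm.
exists (- acos a); rewrite cosN sinN acosK // sin_acos // sb ltr0_norm //.
by rewrite opprK.
Qed.

End Trig.

Lemma norm_convex (R : realType) (V : normedModType R) (u v : V) (t : R) :
  0 <= t <= 1 -> `|u| <= 1 -> `|v| <= 1 -> `|(1 - t) *: u + t *: v| <= 1.
Proof.
move=> /andP[t0 t1] u1 v1; apply: le_trans (ler_normD _ _) _; rewrite !normrZ.
have t1' : 0 <= 1 - t by lra.
rewrite (ger0_norm t0) (ger0_norm t1').
have := ler_wpM2l t0 v1; have := ler_wpM2l t1' u1; lra.
Qed.

(** * Lifting even periodic circle-valued maps *)

Section Lift.
Variables (R : realType) (d : nat) (a b : 'rV[R]_d -> R).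
Hypothesis La : Lip a.
Hypothesis Lb : Lip b.
Hypothesis ab1 : forall x, a x ^+ 2 + b x ^+ 2 = 1.
Hypothesis aP : forall x z, a (x + zr R z) = a x.
Hypothesis bP : forall x z, b (x + zr R z) = b x.
Hypothesis aE : forall x, a (- x) = a x.
Hypothesis bE : forall x, b (- x) = b x.

Let a_bd x : `|a x| <= 1.
Proof. by have := ab1 x; rewrite ler_norml => h; apply/andP; split; nra. Qed.
Let b_bd x : `|b x| <= 1.
Proof. by have := ab1 x; rewrite ler_norml => h; apply/andP; split; nra. Qed.

(** The sine of the angle from the value of [(a, b)] at [c x] to its value at [c' x]. *)
Let step (c c' : R) (x : 'rV[R]_d) := a (c *: x) * b (c' *: x) - b (c *: x) * a (c' *: x).

Let Lip_scl (f : 'rV[R]_d -> R) (c : R) : Lip f -> Lip (fun x => f (c *: x)).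
Proof.
move=> Lf; apply: (Lip_comp Lf); exists `|c| => // x y.
by rewrite -scalerBr normrZ.
Qed.

Let step_Lip c c' : Lip (step c c').
Proof.
apply: LipD; last apply: LipN.
  apply: LipM; try exact: Lip_scl.
    by exists 1.
  by exists 1.
apply: LipM; try exact: Lip_scl.
  by exists 1.
by exists 1.
Qed.

(** The initial angle [t] plus the first [n] angle increments along the segment from 0 to [x], cut
    into [M] pieces. *)
Let S (M : nat) (t : R) (n : nat) (x : 'rV[R]_d) :=
  t + \sum_(i < n) asin (step (i%:R / M%:R) (i.+1%:R / M%:R) x).

(* The lift is built along rays from the origin. It is periodic because an even
   periodic map to the circle has winding number zero along every period. *)
Lemma lift_even : exists beta : 'rV[R]_d -> R,
  [/\ Lip beta, bdd beta, forall x z, beta (x + zr R z) = beta x,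
      forall x, beta (- x) = beta x
    & forall x, cos (beta x) = a x /\ sin (beta x) = b x].
Proof.
have [t0 [ct0 st0]] := angle_exists (ab1 0).
case: (La) => L1 L10 H1; case: (Lb) => L2 L20 H2.
(* With this [M], consecutive values of [a] and of [b] on a ray in the unit ball differ by at most
   1/4. Each angle increment then has sine at most 1/2 in absolute value and nonnegative cosine, so
   [asin] recovers it. *)
have [M' hM] := nat_above (4 * (L1 + L2)); set M := M'.+1 in hM.
have M0 : 0 < M%:R :> R by rewrite ltr0n.
have near i (x : 'rV[R]_d) : `|x| <= 1 ->
    `|(i%:R / M%:R) *: x - (i.+1%:R / M%:R) *: x| <= M%:R^-1.
  move=> x1; rewrite -scalerBl normrZ -mulrBl -[i.+1]addn1 natrD opprD addrA subrr sub0r.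
  have i0 : 0 <= M%:R^-1 :> R by rewrite invr_ge0 ltW.
  by rewrite mulN1r normrN ger0_norm // ler_piMr.
have small (L : R) : 0 <= L -> L <= L1 + L2 -> L / M%:R <= 1 / 4.
  move=> L0 hL; rewrite ler_pdivrMr //; lra.
have nra1 i x : `|x| <= 1 -> `|a ((i%:R / M%:R) *: x) - a ((i.+1%:R / M%:R) *: x)| <= 1/4.
  move=> x1; apply: le_trans (H1 _ _) _; apply: le_trans (small L1 L10 _); last lra.
  by rewrite ler_wpM2l // near.
have nrb1 i x : `|x| <= 1 -> `|b ((i%:R / M%:R) *: x) - b ((i.+1%:R / M%:R) *: x)| <= 1/4.
  move=> x1; apply: le_trans (H2 _ _) _; apply: le_trans (small L2 L20 _); last lra.
  by rewrite ler_wpM2l // near.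
have stepb i x : `|x| <= 1 -> `|step (i%:R / M%:R) (i.+1%:R / M%:R) x| <= 1/2 /\
    0 <= a ((i%:R / M%:R) *: x) * a ((i.+1%:R / M%:R) *: x)
       + b ((i%:R / M%:R) *: x) * b ((i.+1%:R / M%:R) *: x).
  move=> x1; have := nra1 i x x1; have := nrb1 i x x1; rewrite /step.
  have := a_bd ((i%:R / M%:R) *: x); have := b_bd ((i%:R / M%:R) *: x).
  have := ab1 ((i%:R / M%:R) *: x).
  move: (a (_ *: x)) (b (_ *: x)) (a (i.+1%:R / _ *: x)) (b (i.+1%:R / _ *: x)).
  move=> u v u' v' e; rewrite !ler_norml => /andP[v1 v2] /andP[u1 u2] /andP[w1 w2] /andP[w3 w4].
  have e1 : `|u * (v' - v)| <= 1/4.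
    rewrite normrM -[leRHS]mul1r; apply: ler_pM => //; rewrite ler_norml; lra.
  have e2 : `|v * (u' - u)| <= 1/4.
    rewrite normrM -[leRHS]mul1r; apply: ler_pM => //; rewrite ler_norml; lra.
  have e3 : `|u * (u' - u)| <= 1/4.
    rewrite normrM -[leRHS]mul1r; apply: ler_pM => //; rewrite ler_norml; lra.
  have e4 : `|v * (v' - v)| <= 1/4.
    rewrite normrM -[leRHS]mul1r; apply: ler_pM => //; rewrite ler_norml; lra.
  move: e1 e2 e3 e4; rewrite !ler_norml => e1 e2 e3 e4; split; lra.
have Strig n x : `|x| <= 1 -> cos (S M t0 n x) = a ((n%:R / M%:R) *: x) /\
    sin (S M t0 n x) = b ((n%:R / M%:R) *: x).
  move=> x1; elim: n => [|n [IHc IHs]].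
    by rewrite /S big_ord0 addr0 mul0r scale0r.
  have -> : S M t0 n.+1 x = S M t0 n x + asin (step (n%:R / M%:R) (n.+1%:R / M%:R) x).
    by rewrite /S big_ord_recr /= addrA.
  have [h1 h2] := stepb n x x1.
  have h3 : -1 <= step (n%:R / M%:R) (n.+1%:R / M%:R) x <= 1.
    by move: h1; rewrite ler_norml; lra.
  have e1 := ab1 ((n%:R / M%:R) *: x); have e2 := ab1 ((n.+1%:R / M%:R) *: x).
  rewrite cosD sinD IHc IHs cos_asin // asinK ?in_itv //=.
  rewrite /step in h1 h3 *.
  move: (a (_ *: x)) (b (_ *: x)) (a (n.+1%:R / _ *: x)) (b (n.+1%:R / _ *: x)) h1 h2 h3 e1 e2.
  move=> u v u' v' h1 h2 h3 e1 e2.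
  have -> : Num.sqrt (1 - (u * v' - v * u') ^+ 2) = u * u' + v * v'.
    rewrite -[RHS]ger0_norm // -sqrtr_sqr; congr Num.sqrt.
    have : (u ^+ 2 + v ^+ 2) * (u' ^+ 2 + v' ^+ 2) = 1 by rewrite e1 e2 mulr1.
    by move=> <-; ring.
  by split; rewrite -[RHS]mul1r -e1; ring.
have SKn n : exists2 K : R, 0 <= K & forall x y : 'rV[R]_d, `|x| <= 1 -> `|y| <= 1 ->
    `|S M t0 n x - S M t0 n y| <= K * `|x - y|.
  elim: n => [|n [K K0 IH]].
    by exists 0 => // x y _ _; rewrite /S !big_ord0 subrr normr0 mul0r.
  have [L L0 HL] := step_Lip (n%:R / M%:R) (n.+1%:R / M%:R).
  exists (K + 2 * L); first by rewrite addr_ge0 // mulr_ge0.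
  move=> x y x1 y1; rewrite /S !big_ord_recr /= !addrA.
  rewrite -/(S M t0 n x) -/(S M t0 n y) opprD addrACA mulrDl.
  apply: le_trans (ler_normD _ _) _; apply: lerD; first exact: IH.
  have [h1 _] := stepb n x x1; have [h2 _] := stepb n y y1.
  apply: le_trans (asin_Lip h1 h2) _; rewrite -mulrA ler_wpM2l //.
have [K K0 SK] := SKn M; pose B := S M t0 M.
have Bcs x : `|x| <= 1 -> cos (B x) = a x /\ sin (B x) = b x.
  by move=> /(Strig M); rewrite divff ?gt_eqF // scale1r.
have BE x : B (- x) = B x.
  by rewrite /B /S; congr (_ + _); apply: eq_bigr => i _; rewrite /step !scalerN !aE !bE.
have BP (y : 'rV[R]_d) z : `|y| <= 1 -> `|y + zr R z| <= 1 -> B (y + zr R z) = B y.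
  move=> y1 yz1; have z2 : `|(1/2) *: zr R z| <= 1.
    rewrite normrZ ger0_norm; last lra.
    have -> : zr R z = (y + zr R z) - y by rewrite addrC addKr.
    by have := ler_normB (y + zr R z) y; lra.
  (* The path runs from [- z/2] to [y], and its translate by [z] starts at [z/2], where evenness
     gives the same value of [B]. Along the path the difference [B (p + z) - B p] has cosine 1; if
     it vanishes at one subdivision point it is at most 1 at the next, hence vanishes there too.
     Convexity keeps both paths in the unit ball, the only place where [B] is controlled. *)
  pose p (t : R) := (1 - t) *: (- ((1/2) *: zr R z)) + t *: y.
  have pz t : p t + zr R z = (1 - t) *: ((1/2) *: zr R z) + t *: (y + zr R z).
    rewrite /p; apply/rowP => i; rewrite !mxE; lra.
  have p1 t : 0 <= t <= 1 -> `|p t| <= 1 /\ `|p t + zr R z| <= 1.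
    by move=> ht; rewrite pz; split; apply: norm_convex; rewrite ?normrN.
  have [n hn] := nat_above (4 * K).
  have n0 : 0 < n.+1%:R :> R by rewrite ltr0n.
  suff H k : (k <= n.+1)%N -> B (p (k%:R / n.+1%:R) + zr R z) - B (p (k%:R / n.+1%:R)) = 0.
    have := H n.+1 (leqnn _); rewrite divff ?gt_eqF // /p subrr scale0r add0r scale1r.
    by move/subr0_eq.
  elim: k => [|k IH] hk.
    rewrite mul0r pz /p subr0 !scale1r !scale0r !addr0 BE subrr //.
  have h1 : 0 <= (k.+1%:R / n.+1%:R : R) <= 1.
    by rewrite divr_ge0 //= ler_pdivrMr // mul1r ler_nat.
  have h2 : 0 <= (k%:R / n.+1%:R : R) <= 1.
    by rewrite divr_ge0 //= ler_pdivrMr // mul1r ler_nat ltnW.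
  have [p11 p12] := p1 _ h1; have [p21 p22] := p1 _ h2.
  apply: cos_eq1_small; last first.
    have [c1 s1] := Bcs _ p11; have [c2 s2] := Bcs _ p12.
    by rewrite cosB c1 c2 s1 s2 aP bP -!expr2 ab1.
  have dp : `|p (k.+1%:R / n.+1%:R) - p (k%:R / n.+1%:R)| <= 2 / n.+1%:R.
    have -> : p (k.+1%:R / n.+1%:R) - p (k%:R / n.+1%:R) =
        n.+1%:R^-1 *: (y + (1/2) *: zr R z).
      rewrite /p; apply/rowP => i; rewrite !mxE -[k.+1]addn1 natrD; field.
      by rewrite addrC natr1 gt_eqF.
    rewrite normrZ ger0_norm ?invr_ge0; last exact: ltW.
    rewrite mulrC ler_pM2r ?invr_gt0 //.
    by have := ler_normD y ((1/2) *: zr R z); lra.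
  have q1 := SK _ _ p12 p22; have q2 := SK _ _ p11 p21.
  have eB (u v w : 'rV[R]_d) : u + w - (v + w) = u - v by rewrite opprD addrACA subrr addr0.
  rewrite eB in q1.
  have q3 : K * (2 / n.+1%:R) <= 1 / 2.
    by rewrite mulrA ler_pdivrMr //; lra.
  have q4 := le_trans (ler_wpM2l K0 dp) q3.
  have := le_trans q1 q4; have := le_trans q2 q4; have := IH (ltnW hk).
  rewrite -/B !ler_norml; lra.
(* The cell has radius 1/2 but [B] is periodic on the ball of radius 1. This margin allows any
   lattice point within distance 1 to replace the nearest one ([betaE]), so that nothing jumps
   across the walls of the cells. *)
pose beta x := B (x - zr R (rdv x)).
have small1 (x : 'rV[R]_d) : `|x - zr R (rdv x)| <= 1 by have := rdv_le x; lra.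
have betaE x z : `|x - zr R z| <= 1 -> beta x = B (x - zr R z).
  move=> h; rewrite /beta.
  have e : x - zr R z = x - zr R (rdv x) + zr R (rdv x - z).
    by rewrite zrD zrN addrA subrK.
  by rewrite e BP -?e.
have beta_bdd : bdd beta.
  exists (`|B 0| + K); first by rewrite addr_ge0.
  move=> x; rewrite -[beta x](subrK (B 0)) addrC.
  apply: le_trans (ler_normD _ _) _; rewrite lerD2l.
  apply: le_trans (SK _ _ _ _) _ => //; first by rewrite normr0.
  by rewrite subr0 ler_piMr.
exists beta; split.
- apply: (@Lip_local _ _ _ _ K (1/2)) => //.
  + move=> x y xy; rewrite (@betaE y (rdv x)); last first.
      have -> : y - zr R (rdv x) = (x - zr R (rdv x)) - (x - y).
        by rewrite opprB [RHS]addrC addrA subrK.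
      by have := rdv_le x; have := ler_normB (x - zr R (rdv x)) (x - y); lra.
    apply: le_trans (SK _ _ _ _) _ => //.
      have -> : y - zr R (rdv x) = (x - zr R (rdv x)) - (x - y).
        by rewrite opprB [RHS]addrC addrA subrK.
      by have := rdv_le x; have := ler_normB (x - zr R (rdv x)) (x - y); lra.
    by rewrite opprB addrA subrK.
- exact: beta_bdd.
- by move=> x z; rewrite /beta rdvD zrD opprD addrACA subrr addr0.
- move=> x; rewrite (@betaE (- x) (- rdv x)).
    by rewrite zrN -opprD BE.
  by rewrite zrN -opprD normrN.
- move=> x; have [-> ->] := Bcs _ (small1 x).
  by rewrite -zrN aP bP.
Qed.

End Lift.

(** * Sections of line bundles *)

(* A complex Hilbert space seen over [R]: [rip] is the real part of the inner
   product and [J] is multiplication by [i]. *)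
Record cplx (R : realType) (V : normedModType R) (rip : V -> V -> R) (J : V -> V) : Prop :=
  Cplx {
    ripDl : forall u v w, rip (u + v) w = rip u w + rip v w;
    ripZl : forall (a : R) u w, rip (a *: u) w = a * rip u w;
    ripC : forall u v, rip u v = rip v u;
    rip_norm : forall v, rip v v = `|v| ^+ 2;
    JD : forall u v, J (u + v) = J u + J v;
    JZ : forall (a : R) u, J (a *: u) = a *: J u;
    JJ : forall v, J (J v) = - v;
    ripJ : forall u v, rip (J u) v = - rip u (J v) }.

(** Linearity over the reals, in order to treat the unitary [tau], which commutes with [J], and the
    antiunitary [Theta], which anticommutes with it, by the same lemmas. *)
Definition rlin (R : realType) (V : normedModType R) (T : V -> V) : Prop :=
  (forall u v, T (u + v) = T u + T v) /\ (forall (a : R) u, T (a *: u) = a *: T u).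

Definition isom (R : realType) (V : normedModType R) (T : V -> V) : Prop :=
  rlin T /\ (forall v, `|T v| = `|v|).

Definition OpLip (R : realType) (U : normedZmodType R) (V : normedModType R)
    (F : U -> V -> V) : Prop :=
  exists2 L : R, 0 <= L & forall p q v, `|F p v - F q v| <= L * `|p - q| * `|v|.

Section Rlin.
Variables (R : realType) (V : normedModType R).
Implicit Types T : V -> V.

Lemma rlinD T : rlin T -> forall u v, T (u + v) = T u + T v. Proof. by case. Qed.
Lemma rlinZ T : rlin T -> forall (a : R) u, T (a *: u) = a *: T u. Proof. by case. Qed.
Lemma rlinN T : rlin T -> forall u, T (- u) = - T u.
Proof. by move=> H u; rewrite -scaleN1r rlinZ // scaleN1r. Qed.
Lemma rlinB T : rlin T -> forall u v, T (u - v) = T u - T v.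
Proof. by move=> H u v; rewrite rlinD // rlinN. Qed.
Lemma rlin0 T : rlin T -> T 0 = 0.
Proof. by move=> H; rewrite -(scale0r 0) rlinZ // !scale0r. Qed.
Lemma isomL T : isom T -> rlin T. Proof. by case. Qed.
Lemma isomN T : isom T -> forall v, `|T v| = `|v|. Proof. by case. Qed.

Lemma Lip_app (U : normedZmodType R) (F : U -> V -> V) (f : U -> V) :
  OpLip F -> (forall p, rlin (F p)) -> (forall p v, `|F p v| <= `|v|) ->
  Lip f -> bdd f -> Lip (fun p => F p (f p)).
Proof.
move=> [L L0 HF] Fl Fn [M M0 Hf] [B B0 HB]; exists (L * B + M).
  by rewrite addr_ge0 // mulr_ge0.
move=> p q.
have -> : F p (f p) - F q (f q) = (F p (f p) - F q (f p)) + F q (f p - f q).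
  by rewrite rlinB // addrA subrK.
apply: le_trans (ler_normD _ _) _; rewrite mulrDl; apply: lerD.
  apply: le_trans (HF _ _ _) _; rewrite mulrAC ler_wpM2r //.
  by rewrite ler_wpM2l.
by apply: le_trans (Fn _ _) _.
Qed.

Lemma OpLip_comp (U U' : normedZmodType R) (F : U -> V -> V) (g : U' -> U) :
  OpLip F -> Lip g -> OpLip (fun p => F (g p)).
Proof.
move=> [L L0 HF] [M M0 Hg]; exists (L * M); first exact: mulr_ge0.
move=> p q v; apply: le_trans (HF _ _ _) _; rewrite ler_wpM2r // -mulrA ler_wpM2l //.
Qed.

End Rlin.

Section CplxTheory.
Variables (R : realType) (V : normedModType R) (rip : V -> V -> R) (J : V -> V).
Hypothesis C : cplx rip J.

Lemma ripDr u v w : rip w (u + v) = rip w u + rip w v.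
Proof. by rewrite !(ripC C w) (ripDl C). Qed.
Lemma ripZr (a : R) u w : rip w (a *: u) = a * rip w u.
Proof. by rewrite !(ripC C w) (ripZl C). Qed.
Lemma ripNl u w : rip (- u) w = - rip u w.
Proof. by rewrite -scaleN1r (ripZl C) mulN1r. Qed.
Lemma ripNr u w : rip w (- u) = - rip w u.
Proof. by rewrite !(ripC C w) ripNl. Qed.
Lemma ripBl u v w : rip (u - v) w = rip u w - rip v w.
Proof. by rewrite (ripDl C) ripNl. Qed.
Lemma ripBr u v w : rip w (u - v) = rip w u - rip w v.
Proof. by rewrite ripDr ripNr. Qed.

Lemma rlinJ : rlin J. Proof. by split; [exact: JD C | exact: JZ C]. Qed.

Lemma ripJJ u v : rip (J u) (J v) = rip u v.
Proof. by rewrite (ripJ C) (JJ C) ripNr opprK. Qed.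

Lemma rip_Jid u : rip u (J u) = 0.
Proof. by have := ripJ C u u; rewrite (ripC C (J u)); lra. Qed.

Lemma norm_J v : `|J v| = `|v|.
Proof.
apply/eqP; rewrite -(eqrXn2 (n:=2)) // -!(rip_norm C) ripJJ //.
Qed.

Lemma rip_polar u v : rip u v = (`|u + v| ^+ 2 - `|u| ^+ 2 - `|v| ^+ 2) / 2.
Proof. by rewrite -!(rip_norm C) !(ripDl C, ripDr) (ripC C v u); field. Qed.

Lemma isom_rip T : isom T -> forall u v, rip (T u) (T v) = rip u v.
Proof. by move=> [[TD TZ] Tn] u v; rewrite !rip_polar -TD !Tn. Qed.

Lemma rip_le u v : `|rip u v| <= `|u| * `|v|.
Proof.
have [->|u0] := eqVneq u 0; first by rewrite -(scale0r 0) (ripZl C) mul0r normr0 scale0r normr0 mul0r.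
have [->|v0] := eqVneq v 0; first by rewrite -(scale0r 0) ripZr mul0r normr0 scale0r normr0 mulr0.
have p : 0 < `|u| * `|v| by rewrite mulr_gt0 ?normr_gt0.
have key (s : R) : s ^+ 2 = 1 -> s * rip u v <= `|u| * `|v|.
  move=> s2; have : 0 <= `| `|v| *: u - (s * `|u|) *: v | ^+ 2 by rewrite exprn_ge0.
  rewrite -(rip_norm C) !(ripBl, ripBr) !(ripZl C) !ripZr !(rip_norm C) (ripC C v u).
  have -> : `|v| * (`|v| * `|u| ^+ 2) - `|v| * (s * `|u| * rip u v) -
   (s * `|u| * (`|v| * rip u v) - s * `|u| * (s * `|u| * `|v| ^+ 2)) =
   (`|u| * `|v|) * ((1 + s ^+ 2) * (`|u| * `|v|) - 2 * (s * rip u v)) by ring.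
  rewrite pmulr_rge0 // s2; lra.
rewrite ler_norml; have := key 1; have := key (-1); rewrite sqrrN !expr1n mul1r mulN1r.
by move=> /(_ erefl) h1 /(_ erefl) h2; apply/andP; split; lra.
Qed.

(** Multiplication by [e^{it}]; an antilinear map therefore reverses the sign of the angle. *)
Definition rot (t : R) (v : V) : V := cos t *: v + sin t *: J v.

Lemma rot_rot s t v : rot s (rot t v) = rot (s + t) v.
Proof.
rewrite /rot (JD C) !(JZ C) (JJ C) cosD sinD !scalerDr !scalerA scalerN.
by rewrite scalerBl scalerDl -!addrA; congr (_ + _);
  rewrite addrA addrC !addrA addrAC [in RHS]addrAC -addrA [in RHS]addrC addrCA addrA addrC.
Qed.

Lemma norm_rot t v : `|rot t v| = `|v|.
Proof.
apply/eqP; rewrite -(eqrXn2 (n:=2)) // -!(rip_norm C); apply/eqP.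
rewrite /rot !(ripDl C, ripDr) !(ripZl C) !ripZr ripJJ (ripC C (J v)) rip_Jid.
rewrite -[RHS]mul1r -(cos2Dsin2 t); ring.
Qed.

Lemma rot_lin T t v : rlin T -> (forall v, T (J v) = J (T v)) -> T (rot t v) = rot t (T v).
Proof. by move=> Tl TJ; rewrite /rot (rlinD Tl) !(rlinZ Tl) TJ. Qed.

Lemma rot_anti T t v : rlin T -> (forall v, T (J v) = - J (T v)) -> T (rot t v) = rot (- t) (T v).
Proof. by move=> Tl TJ; rewrite /rot cosN sinN (rlinD Tl) !(rlinZ Tl) TJ scalerN scaleNr. Qed.

Lemma Lip_rip (U : normedZmodType R) (f g : U -> V) :
  Lip f -> Lip g -> bdd f -> bdd g -> Lip (fun x => rip (f x) (g x)).
Proof.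
apply: (@Lip_bil _ _ _ _ _ rip 1) => //.
- by move=> *; rewrite ripBl.
- by move=> *; rewrite ripBr.
- by move=> *; rewrite mul1r rip_le.
Qed.

Lemma Lip_J (U : normedZmodType R) (f : U -> V) : Lip f -> Lip (fun x => J (f x)).
Proof.
apply: Lip_isom; first exact: (rlinB rlinJ).
by move=> v; rewrite norm_J.
Qed.

Lemma Lip_rot (U : normedZmodType R) (t : U -> R) (f : U -> V) :
  Lip t -> Lip f -> bdd f -> Lip (fun x => rot (t x) (f x)).
Proof.
move=> Lt Lf bf; apply: LipD; apply: Lip_scale => //.
- exact: Lip_comp (cos_Lip R) Lt.
- by have [B B0 HB] := cos_bdd R; exists B.
- exact: Lip_comp (sin_Lip R) Lt.
- exact: Lip_J.
- by have [B B0 HB] := sin_bdd R; exists B.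
- by have [B B0 HB] := bf; exists B => // x; rewrite norm_J.
Qed.

Lemma rip_decomp phi v : `|phi| = 1 -> `|v| = 1 ->
  v = rip phi v *: phi + rip (J phi) v *: J phi -> rip phi v ^+ 2 + rip (J phi) v ^+ 2 = 1.
Proof.
move=> p1 v1 E; have : rip v v = 1 by rewrite (rip_norm C) v1 expr1n.
rewrite {1}E (ripDl C) !(ripZl C) => <-; ring.
Qed.

End CplxTheory.

(** * Extending a unit section of a line bundle by one coordinate *)

Section Suspension.
Variables (R : realType) (V : normedModType R) (rip : V -> V -> R) (J : V -> V).
Hypothesis C : cplx rip J.
Variable d : nat.
Local Notation U := ('rV[R]_d * R)%type.
Variables (F : U -> V -> V) (sg : 'rV[int]_d -> V -> V) (T : int -> V -> V) (Th : V -> V).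
Hypothesis Fl : forall p, rlin (F p).
Hypothesis FJ : forall p v, F p (J v) = J (F p v).
Hypothesis Fn : forall p v, `|F p v| <= `|v|.
Hypothesis FF : forall p v, F p (F p v) = F p v.
Hypothesis FL : OpLip F.
Hypothesis sgi : forall z, isom (sg z).
Hypothesis sgJ : forall z v, sg z (J v) = J (sg z v).
Hypothesis Ti : forall n, isom (T n).
Hypothesis TJ : forall n v, T n (J v) = J (T n v).
Hypothesis T0 : forall v, T 0 v = v.
Hypothesis TD : forall m n v, T (m + n) v = T m (T n v).
Hypothesis sgT : forall z n v, sg z (T n v) = T n (sg z v).
Hypothesis Thi : isom Th.
Hypothesis ThJ : forall v, Th (J v) = - J (Th v).
Hypothesis ThT : forall n v, Th (T n v) = T (- n) (Th v).
Hypothesis Fsg : forall x y z v, F (x + zr R z, y) (sg z v) = sg z (F (x, y) v).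
Hypothesis FT : forall x y (n : int) v, F (x, y + n%:~R) (T n v) = T n (F (x, y) v).
Hypothesis FTh : forall x y v, F (- x, - y) (Th v) = Th (F (x, y) v).
Hypothesis rank1 : forall p phi v, `|phi| = 1 -> F p phi = phi -> F p v = v ->
  v = rip phi v *: phi + rip (J phi) v *: J phi.
Variable u0 : 'rV[R]_d -> V.
Hypothesis u0L : Lip u0.
Hypothesis u01 : forall x, `|u0 x| = 1.
Hypothesis u0F : forall x, F (x, 0) (u0 x) = u0 x.
Hypothesis u0sg : forall x z, u0 (x + zr R z) = sg z (u0 x).
Hypothesis u0Th : forall x, u0 (- x) = Th (u0 x).

(** Clamping freezes the transport outside [|y| <= 1/2], which gives globally defined Lipschitz maps
    without restricting the domain. It is odd, as compatibility with time reversal requires. *)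
Let cl (y : R) : R := Num.max (- (1 / 2)) (Num.min y (1 / 2)).

Let cl_small y : `|y| <= 1 / 2 -> cl y = y.
Proof. by rewrite ler_norml => /andP[h1 h2]; rewrite /cl min_l // max_r. Qed.

Let cl_le y : `|cl y| <= 1 / 2.
Proof.
rewrite /cl ler_norml; case: (leP y (1/2)) => h.
  by case: (leP (- (1/2)) y) => h'; rewrite ?max_r ?max_l; lra.
by rewrite max_r; lra.
Qed.

Let clN y : cl (- y) = - cl y.
Proof.
rewrite /cl; case: (leP y (1/2)) => h1; case: (leP (- y) (1/2)) => h2;
 case: (leP (- (1/2)) y) => h3; case: (leP (- (1/2)) (- y)) => h4;
 rewrite ?max_r ?max_l //; lra.
Qed.

Let cl_Lip : Lip cl.
Proof.
exists 1 => // x y; rewrite mul1r /cl.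
case: (leP x (1/2)) => h1; case: (leP y (1/2)) => h2;
case: (leP (- (1/2)) x) => h3; case: (leP (- (1/2)) y) => h4;
 rewrite ?max_r ?max_l ?ler_norml //; try lra;
 case: (leP 0 (x - y)) => h5; rewrite ?(ger0_norm h5) ?(ltr0_norm h5); try (apply/andP; split); lra.
Qed.

Let fst_Lip : Lip (fun p : U => p.1).
Proof.
by exists 1 => // x y; rewrite mul1r prod_normE le_max lexx.
Qed.
Let snd_Lip : Lip (fun p : U => p.2).
Proof.
by exists 1 => // x y; rewrite mul1r prod_normE le_max lexx orbT.
Qed.

Let pair_Lip (f : U -> 'rV[R]_d) (g : U -> R) : Lip f -> Lip g -> Lip (fun p => (f p, g p)).
Proof.
move=> [L L0 Hf] [M M0 Hg]; exists (L + M); first exact: addr_ge0.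
move=> p q; rewrite prod_normE /= ge_max mulrDl; apply/andP; split.
  by apply: le_trans (Hf _ _) _; rewrite lerDl mulr_ge0.
by apply: le_trans (Hg _ _) _; rewrite lerDr mulr_ge0.
Qed.

(* Parallel transport of [u0] from [y = 0] to [|y| <= 1/2] by normalised
   products of projectors at nearby points. *)
Let transport : exists psi : U -> V,
  [/\ Lip psi, forall p, `|psi p| = 1, forall p, F (p.1, cl p.2) (psi p) = psi p,
     forall x y z, psi (x + zr R z, y) = sg z (psi (x, y))
   & forall x y, psi (- x, - y) = Th (psi (x, y))].
Proof.
(* One of the [M] steps moves the base point by at most [1 / (2 M)], hence the projector by at most
   1/2 in norm; the projected unit vector keeps norm at least 1/2 and can be normalised. *)
have [L L0 HL] := FL; have [M' hM] := nat_above L; set M := M'.+1 in hM.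
have M0 : 0 < M%:R :> R by rewrite ltr0n.
suff H i : exists psi : U -> V,
  [/\ Lip psi, forall p, `|psi p| = 1,
     forall p, F (p.1, i%:R / M%:R * cl p.2) (psi p) = psi p,
     forall x y z, psi (x + zr R z, y) = sg z (psi (x, y))
   & forall x y, psi (- x, - y) = Th (psi (x, y))].
  have [psi [h1 h2 h3 h4 h5]] := H M; exists psi; split=> // p.
  by have := h3 p; rewrite divff ?gt_eqF // mul1r.
elim: i => [|i [psi [h1 h2 h3 h4 h5]]].
  exists (fun p => u0 p.1); split=> //=.
  - exact: Lip_comp u0L fst_Lip.
  - by move=> p; rewrite !mul0r.
pose G (p : U) := F (p.1, i.+1%:R / M%:R * cl p.2).
have GL : OpLip G.
  apply: (OpLip_comp FL); apply: pair_Lip => //; apply: LipM.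
  - exact: Lip_cst.
  - exact: Lip_comp cl_Lip snd_Lip.
  - by exists `|i.+1%:R / M%:R : R|.
  - by exists (1/2) => // p; rewrite ?cl_le //; lra.
have Glow p : 1 / 2 <= `|G p (psi p)|.
  have : `|F (p.1, i%:R / M%:R * cl p.2) (psi p) - G p (psi p)| <= 1 / 2.
    apply: le_trans (HL _ _ _) _; rewrite h2 mulr1.
    have -> : (p.1, i%:R / M%:R * cl p.2) - (p.1, i.+1%:R / M%:R * cl p.2) =
       (0, - (cl p.2 / M%:R)) :> U.
      by congr (_, _) => /=; rewrite ?subrr // -[i.+1]addn1 natrD; field; rewrite gt_eqF.
    rewrite prod_normE /= normr0 normrN max_r // normrM normfV (ger0_norm (ltW M0)).
    rewrite mulrA ler_pdivrMr //.
    have := ler_pM L0 (normr_ge0 _) (ltW hM) (cl_le p.2); lra.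
  rewrite h3 => h; have := ler_normD (psi p - G p (psi p)) (G p (psi p)).
  rewrite subrK h2; lra.
have bpsi : bdd psi by exists 1 => // p; rewrite h2.
exists (fun p => nrm (G p (psi p))); split.
- apply: (@Lip_nrm _ _ _ _ (1/2)) => //.
  by apply: Lip_app => //; move=> p *; [exact: Fl | exact: Fn].
- move=> p; apply: norm_nrm; rewrite -normr_gt0; apply: lt_le_trans (Glow p); lra.
- by move=> p; rewrite /nrm (rlinZ (Fl _)) /G FF.
- move=> x y z; rewrite /G h4 /= Fsg /nrm (isomN (sgi z)) (rlinZ (isomL (sgi z))) //.
- move=> x y; rewrite /G h5 /= clN mulrN FTh /nrm (isomN Thi) (rlinZ (isomL Thi)) //.
Qed.

(* The values transported to [y = 1/2] and [y = -1/2] differ by a phase which is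
   even and periodic in [x]; [lift_even] allows to spread it over the period. *)
Lemma suspension : exists u : U -> V,
  [/\ Lip u, forall p, `|u p| = 1, forall p, F p (u p) = u p,
     forall x y z n, u (x + zr R z, y + n%:~R) = sg z (T n (u (x, y)))
   & forall x y, u (- x, - y) = Th (u (x, y))].
Proof.
have [psi [pL p1 pF psg pTh]] := transport.
(* [T 1] carries the value at [y = -1/2] into the fibre over [y = 1/2], where both ends can be
   compared. *)
pose pp x := psi (x, 1 / 2); pose pm x := T 1 (psi (x, - (1 / 2))).
have h12 : `|1 / 2 : R| <= 1 / 2 by rewrite ger0_norm //; lra.
have hm12 : `|- (1 / 2) : R| <= 1 / 2 by rewrite normrN.
have sec_Lip (c : R) : Lip (fun x => psi (x, c)).
  have [L L0 HL] := pL; exists L => // x y; apply: le_trans (HL _ _) _.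
  by rewrite prod_normE /= subrr normr0 max_l.
have ppL : Lip pp by exact: sec_Lip.
have pmL : Lip pm.
  apply: Lip_isom (sec_Lip _); first exact: (rlinB (isomL (Ti 1))).
  by move=> v; rewrite (isomN (Ti 1)).
have pp1 x : `|pp x| = 1 by exact: p1.
have pm1 x : `|pm x| = 1 by rewrite /pm (isomN (Ti 1)) p1.
have ppF x : F (x, 1 / 2) (pp x) = pp x.
  by have := pF (x, 1 / 2) => /=; rewrite cl_small.
have pmF x : F (x, 1 / 2) (pm x) = pm x.
  have := pF (x, - (1 / 2)) => /=; rewrite cl_small // => e.
  have -> : 1 / 2 = - (1 / 2) + 1%:~R :> R by lra.
  by rewrite /pm FT e.
have bpp : bdd pp by exists 1 => // x; rewrite pp1.
have bpm : bdd pm by exists 1 => // x; rewrite pm1.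
pose a x := rip (pp x) (pm x); pose b x := rip (J (pp x)) (pm x).
have pmE x : pm x = a x *: pp x + b x *: J (pp x).
  exact: (rank1 (p := (x, 1 / 2))).
have ppz x z : pp (x + zr R z) = sg z (pp x) by rewrite /pp psg.
have pmz x z : pm (x + zr R z) = sg z (pm x) by rewrite /pm psg sgT.
have ppN x : pp (- x) = T 1 (Th (pm x)).
  rewrite /pp /pm ThT -TD subrr T0 -pTh opprK //.
have pmN x : pm (- x) = T 1 (Th (pp x)) by rewrite /pm pTh.
(* Passing from [x] to [- x] exchanges [pp] and [pm] and applies the antilinear [A]. Each of these
   two operations conjugates the phase [a + i b], so together they leave it unchanged: the phase is
   even. *)
pose A v := T 1 (Th v).
have Ai : isom A.
  split; last by move=> v; rewrite (isomN (Ti 1)) (isomN Thi).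
  have TL := isomL (Ti 1); have ThL := isomL Thi.
  by split=> *; rewrite /A ?(rlinD ThL) ?(rlinZ ThL) ?(rlinD TL) ?(rlinZ TL).
have AJ v : A (J v) = - J (A v) by rewrite /A ThJ (rlinN (isomL (Ti 1))) TJ.
have [beta [bL bB bP bE bcs]] : exists beta : 'rV[R]_d -> R,
  [/\ Lip beta, bdd beta, forall x z, beta (x + zr R z) = beta x,
      forall x, beta (- x) = beta x
    & forall x, cos (beta x) = a x /\ sin (beta x) = b x].
  apply: lift_even.
  - exact: (Lip_rip C).
  - apply: (Lip_rip C) => //; first exact: (Lip_J C).
    by exists 1 => // x; rewrite (norm_J C) pp1.
  - by move=> x; apply: (rip_decomp C); rewrite ?pp1 ?pm1 // -pmE.
  - by move=> x z; rewrite /a ppz pmz (isom_rip C (sgi z)).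
  - by move=> x z; rewrite /b ppz pmz -sgJ (isom_rip C (sgi z)).
  - by move=> x; rewrite /a ppN pmN -!/(A _) (isom_rip C Ai) (ripC C).
  - move=> x; rewrite /b ppN pmN -!/(A _) -[J (A _)]opprK -AJ (ripNl C) (isom_rip C Ai).
    by rewrite (ripJ C) opprK (ripC C).
(* The rotation angle varies from [- beta/2] to [beta/2] over a period, and the total variation
   [beta] is exactly the mismatch between [pp] and [pm]. The angle is even in [x] and odd in [y],
   hence odd under time reversal, as [rot_anti] demands. *)
pose ut (p : U) := rot J (beta p.1 * cl p.2) (psi p).
have utL : Lip ut.
  apply: (Lip_rot C) => //; last by exists 1 => // p; rewrite p1.
  apply: LipM.
  - exact: Lip_comp bL fst_Lip.
  - exact: Lip_comp cl_Lip snd_Lip.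
  - by have [B B0 HB] := bB; exists B.
  - by exists (1/2) => // p; rewrite ?cl_le //; lra.
have match1 x : T 1 (ut (x, - (1/2))) = ut (x, 1/2).
  rewrite /ut /= !cl_small // (rot_lin _ _ (isomL (Ti 1)) (TJ 1)) -/(pm x) -/(pp x).
  have -> : pm x = rot J (beta x) (pp x).
    by rewrite /rot; have [-> ->] := bcs x; rewrite -pmE.
  by rewrite (rot_rot C); congr rot; lra.
pose u (p : U) := T (rd p.2) (ut (p.1, p.2 - (rd p.2)%:~R)).
(* At a half-integer [y] two integers are equally near; [match1] says that both give the same
   value. *)
have uE x y (n : int) : `|y - n%:~R| <= 1 / 2 -> u (x, y) = T n (ut (x, y - n%:~R)).
  move=> hn; rewrite /u /=; have hr := rd_le y.
  have [e|ne] := eqVneq n (rd y); first by rewrite e.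
  have : `|(n - rd y)%:~R| <= 1 :> R.
    rewrite intrB; have -> : n%:~R - (rd y)%:~R = (y - (rd y)%:~R) - (y - n%:~R) :> R by lra.
    by have := ler_normB (y - (rd y)%:~R) (y - n%:~R); lra.
  rewrite -intr_norm -[1]/(1%:~R) ler_int => hd.
  have [e|e] : n = rd y + 1 \/ rd y = n + 1 by lia.
    move: hr hn; rewrite !ler_norml e intrD => /andP[_ h1] /andP[h2 _].
    have -> : y - (rd y)%:~R = 1 / 2 :> R by lra.
    have -> : y - ((rd y)%:~R + 1%:~R) = - (1 / 2) :> R by lra.
    by rewrite -match1 TD.
  move: hr hn; rewrite !ler_norml e intrD => /andP[h2 _] /andP[_ h1].
  have -> : y - n%:~R = 1 / 2 :> R by lra.
  have -> : y - (n%:~R + 1%:~R) = - (1 / 2) :> R by lra.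
  by rewrite -match1 TD.
have u1 p : `|u p| = 1 by rewrite /u (isomN (Ti _)) /ut (norm_rot C) p1.
exists u; split=> //.
- have [L L0 HL] := utL.
  have same x x' y y' n : `|y - n%:~R| <= 1 / 2 -> `|y' - n%:~R| <= 1 / 2 ->
      `|u (x, y) - u (x', y')| <= L * Num.max `|x - x'| `|y - y'|.
    move=> h h'; rewrite (uE x _ n) // (uE x' _ n) // -(rlinB (isomL (Ti n))) (isomN (Ti n)).
    apply: le_trans (HL _ _) _; rewrite prod_normE /=.
    by have -> : y - n%:~R - (y' - n%:~R) = y - y' by lra.
  apply: (@Lip_local _ _ _ _ (2 * L) (1/2)); first by rewrite mulr_ge0.
  + lra.
  + suff W x x' y y' : y <= y' -> y' - y <= 1 / 2 ->
        `|u (x, y) - u (x', y')| <= 2 * L * Num.max `|x - x'| `|y - y'|.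
      move=> [x y] [x' y']; rewrite prod_normE /= ge_max => /andP[_ hy].
      case: (leP y y') => yy; [apply: W => // | rewrite distrC [`|x - _|]distrC [`|y - _|]distrC; apply: W].
      * by move: hy; rewrite ler_norml; lra.
      * exact: ltW.
      * by move: hy; rewrite ler_norml; lra.
    move=> yy yd; have := rd_le y; set n := rd y; rewrite ler_norml => /andP[hn1 hn2].
    have m0 : 0 <= Num.max `|x - x'| `|y - y'| by rewrite le_max normr_ge0.
    have [h|h] := leP (y' - n%:~R) (1/2).
      apply: le_trans (same _ _ _ _ n _ _) _; try (rewrite ler_norml; lra).
      by rewrite ler_wpM2r // ler_peMl //; lra.
    (* Exactly one wall, [n + 1/2], separates [y] from [y']. Its point above [x] belongs to both
       cells, and passing through it costs the factor 2 in the Lipschitz constant. *)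
    have -> : u (x, y) - u (x', y') =
       (u (x, y) - u (x, n%:~R + 1/2)) + (u (x, n%:~R + 1/2) - u (x', y')).
      by rewrite addrA subrK.
    have e2 (t : R) : 2 * t = t + t by ring.
    apply: le_trans (ler_normD _ _) _; rewrite -mulrA e2; apply: lerD.
      apply: le_trans (same _ _ _ _ n _ _) _; try (rewrite ler_norml; lra).
      rewrite ler_wpM2l // subrr normr0 max_r // le_max; apply/orP; right.
      rewrite ler0_norm ?ler0_norm; lra.
    apply: le_trans (same _ _ _ _ (n + 1) _ _) _; try (rewrite intrD ler_norml; lra).
    rewrite ler_wpM2l // ge_max le_max lexx /= le_max; apply/orP; right.
    rewrite ler0_norm ?ler0_norm; lra.
  + by exists 1 => // p; rewrite u1.
- move=> [x y]; rewrite (uE x y (rd y)) ?rd_le //.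
  rewrite -{1}(subrK (rd y)%:~R y) FT; congr T.
  rewrite /ut /= (rot_lin _ _ (Fl _) (FJ _)); congr (rot J _ _).
  by have := pF (x, y - (rd y)%:~R); rewrite /= cl_small ?rd_le.
- move=> x y z n; rewrite (uE _ (y + _) (rd y + n)); last first.
    by rewrite intrD opprD addrACA subrr addr0 rd_le.
  rewrite intrD opprD addrACA subrr addr0 (uE x y (rd y)) ?rd_le //.
  rewrite -TD sgT [n + _]addrC; congr (T _ _).
  by rewrite /ut /= bP psg (rot_lin _ _ (isomL (sgi z)) (sgJ z)).
- move=> x y; rewrite (uE _ (- y) (- rd y)); last first.
    by rewrite intrN -opprD normrN rd_le.
  rewrite intrN -opprD (uE x y (rd y)) ?rd_le // ThT; congr T.
  by rewrite /ut /= bE clN pTh (rot_anti _ _ (isomL Thi) ThJ) mulrN.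
Qed.

End Suspension.

(* Hypotheses (P2)-(P4) in the coordinates [x = k B^-1], in which the lattice
   is [Z^d] and [tau] is indexed by [Z^d]. *)
Record bsys (R : realType) (V : normedModType R) (J : V -> V) (d : nat)
    (P : 'rV[R]_d -> V -> V) (tau : 'rV[int]_d -> V -> V) (Th : V -> V) : Prop := Bsys {
  Plin : forall x, rlin (P x);
  PJ : forall x v, P x (J v) = J (P x v);
  Pnorm : forall x v, `|P x v| <= `|v|;
  PP : forall x v, P x (P x v) = P x v;
  PLip : OpLip P;
  taui : forall z, isom (tau z);
  tauJ : forall z v, tau z (J v) = J (tau z v);
  tau0 : forall v, tau 0 v = v;
  tauD : forall z z' v, tau (z + z') v = tau z (tau z' v);
  Thi : isom Th;
  ThJ : forall v, Th (J v) = - J (Th v);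
  ThTh : forall v, Th (Th v) = v;
  Thtau : forall z v, Th (tau z v) = tau (- z) (Th v);
  Ptau : forall x z v, P (x + zr R z) (tau z v) = tau z (P x v);
  PTh : forall x v, P (- x) (Th v) = Th (P x v) }.

Record bsection (R : realType) (V : normedModType R) (d : nat)
    (P : 'rV[R]_d -> V -> V) (tau : 'rV[int]_d -> V -> V) (Th : V -> V)
    (u : 'rV[R]_d -> V) : Prop := Bsection {
  secL : Lip u;
  secP : forall x, P x (u x) = u x;
  sectau : forall x z, u (x + zr R z) = tau z (u x);
  secTh : forall x, u (- x) = Th (u x) }.

(* [v + A v] is fixed by the conjugation [A]; if it vanishes, then [J v] is. *)
Lemma fixed_unit_vector (R : realType) (V : normedModType R) (rip : V -> V -> R) (J : V -> V)
    (Q A : V -> V) (v : V) :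
  cplx rip J -> rlin Q -> (forall v, Q (J v) = J (Q v)) -> isom A ->
  (forall v, A (J v) = - J (A v)) -> (forall v, A (A v) = v) ->
  (forall v, Q (A v) = A (Q v)) -> v != 0 -> Q v = v ->
  exists w, [/\ `|w| = 1, Q w = w & A w = w].
Proof.
move=> C Ql QJ Ai AJ AA QA v0 Qv; have Al := isomL Ai.
suff [w [w0 Qw Aw]] : exists w, [/\ w != 0, Q w = w & A w = w].
  exists (nrm w); rewrite norm_nrm //; split=> //.
    by rewrite /nrm (rlinZ Ql) Qw.
  by rewrite /nrm (rlinZ Al) Aw.
have [e|ne] := eqVneq (v + A v) 0; last first.
  exists (v + A v); split=> //; first by rewrite (rlinD Ql) QA Qv.
  by rewrite (rlinD Al) AA addrC.
exists (J v); split.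
- by rewrite -normr_eq0 (norm_J C) normr_eq0.
- by rewrite QJ Qv.
- by rewrite AJ; move/eqP: e; rewrite addrC addr_eq0 => /eqP ->; rewrite (rlinN (rlinJ C)) opprK.
Qed.

Section Line.
Variables (R : realType) (V : normedModType R) (rip : V -> V -> R) (J : V -> V).
Hypothesis C : cplx rip J.
Variables (d : nat) (P : 'rV[R]_d -> V -> V) (tau : 'rV[int]_d -> V -> V) (Th : V -> V).
Hypothesis S : bsys J P tau Th.
Hypothesis rank1 : forall x phi v, `|phi| = 1 -> P x phi = phi -> P x v = v ->
  v = rip phi v *: phi + rip (J phi) v *: J phi.
Hypothesis rank1_nz : exists2 v, v != 0 & P 0 v = v.

(** Setting the coordinates from [j] on to zero keeps the ambient space [R^d] fixed during the
    induction: stage [j] is a section of the bundle pulled back along [tr j]. *)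
Let tr (A : zmodType) (j : nat) (x : 'rV[A]_d) : 'rV[A]_d :=
  \row_i (if (i < j)%N then x 0 i else 0).

Let trD (A : zmodType) j (x y : 'rV[A]_d) : tr j (x + y) = tr j x + tr j y.
Proof. by apply/rowP => i; rewrite !mxE; case: ifP => // _; rewrite addr0. Qed.
Let trN (A : zmodType) j (x : 'rV[A]_d) : tr j (- x) = - tr j x.
Proof. by apply/rowP => i; rewrite !mxE; case: ifP => // _; rewrite oppr0. Qed.
Let zr_tr j z : zr R (tr j z) = tr j (zr R z).
Proof. by apply/rowP => i; rewrite !mxE; case: ifP. Qed.
Let tr_all (A : zmodType) (x : 'rV[A]_d) : tr d x = x.
Proof. by apply/rowP => i; rewrite !mxE ltn_ord. Qed.
Let tr_none (A : zmodType) (x : 'rV[A]_d) : tr 0 x = 0.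
Proof. by apply/rowP => i; rewrite !mxE. Qed.
Let trS (A : pzRingType) j (jd : (j < d)%N) (x : 'rV[A]_d) :
  tr j.+1 x = tr j x + x 0 (Ordinal jd) *: delta_mx 0 (Ordinal jd).
Proof.
apply/rowP => i; rewrite !mxE eqxx /= ltnS.
case: (ltngtP i j) => ij.
- by rewrite -val_eqE /= ltn_eqF // mulr0 addr0.
- by rewrite -val_eqE /= gtn_eqF // mulr0 addr0.
- have -> : i = Ordinal jd by apply/val_inj.
  by rewrite eqxx mulr1 add0r.
Qed.
Let tr_le j (x : 'rV[R]_d) : `|tr j x| <= `|x|.
Proof.
by apply/norm_leP => // i; rewrite mxE; case: ifP => _; rewrite ?coord_le // normr0.
Qed.

Lemma line_section : exists2 u, bsection P tau Th u & forall x, `|u x| = 1.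
Proof.
suff H j : (j <= d)%N -> exists u, [/\ Lip u, forall x, `|u x| = 1,
    forall x, P (tr j x) (u x) = u x,
    forall x z, u (x + zr R z) = tau (tr j z) (u x) & forall x, u (- x) = Th (u x)].
  have [u [h1 h2 h3 h4 h5]] := H d (leqnn d); exists u => //; split=> //.
    by move=> x; have := h3 x; rewrite tr_all.
  by move=> x z; have := h4 x z; rewrite tr_all.
elim: j => [|j IH] jd.
  (* At stage 0 every fibre is the fibre over the origin, and a constant unit vector fixed by [Th]
     is a section. *)
  have [v v0 Pv] := rank1_nz.
  have [|w [w1 Pw Aw]] := fixed_unit_vector C (Plin S 0) (PJ S 0) (Thi S) (ThJ S) (ThTh S) _ v0 Pv.
    by move=> w; rewrite -[in LHS]oppr0 (PTh S).
  exists (fun _ => w); split=> // *; rewrite ?tr_none ?(tau0 S) //.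
  exact: Lip_cst.
have [u0 [u0L u01 u0P u0t u0T]] := IH (ltnW jd).
pose e (A : pzRingType) : 'rV[A]_d := delta_mx 0 (Ordinal jd).
pose pt (p : 'rV[R]_d * R) := tr j p.1 + p.2 *: e R.
have e1 : `|e R| <= 1.
  by apply/norm_leP => // i; rewrite mxE; case: (_ && _); rewrite ?normr1 ?normr0.
have zre n : zr R (n *: e int) = n%:~R *: e R.
  by apply/rowP => i; rewrite !mxE intrM; case: (_ && _).
have ptL : Lip pt.
  exists 2 => // p q.
  have -> : pt p - pt q = tr j (p.1 - q.1) + (p.2 - q.2) *: e R.
    by rewrite /pt trD trN opprD addrACA scalerBl.
  apply: le_trans (ler_normD _ _) _; rewrite prod_normE /= normrZ.
  have m1 : `|p.1 - q.1| <= Num.max `|p.1 - q.1| `|p.2 - q.2| by rewrite le_max lexx.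
  have m2 : `|p.2 - q.2| <= Num.max `|p.1 - q.1| `|p.2 - q.2| by rewrite le_max lexx orbT.
  have := le_trans (tr_le j _) m1.
  have := le_trans (ler_piMr (normr_ge0 _) e1) m2.
  by move=> h1 h2; have := lerD h2 h1; lra.
have [||||||||||||||||||||||||u [uL u1 uP ut uT]] :=
  @suspension R V rip J C d (fun p => P (pt p)) (fun z => tau (tr j z))
    (fun n => tau (n *: e int)) Th _ _ _ _ _ _ _ _ _ _ _ _ _ _ _ _ _ _ _ u0.
- by move=> p; exact: Plin S _.
- by move=> p v; exact: PJ S _ _.
- by move=> p v; exact: Pnorm S _ _.
- by move=> p v; exact: PP S _ _.
- exact: OpLip_comp (PLip S) ptL.
- by move=> z; exact: taui S _.
- by move=> z v; exact: tauJ S _ _.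
- by move=> z; exact: taui S _.
- by move=> z v; exact: tauJ S _ _.
- by move=> v; rewrite scale0r (tau0 S).
- by move=> m n v; rewrite scalerDl (tauD S).
- by move=> z n v; rewrite -!(tauD S) addrC.
- exact: Thi S.
- exact: ThJ S.
- by move=> n v; rewrite (Thtau S) scaleNr.
- by move=> x y z v; rewrite /pt /= trD -zr_tr addrAC (Ptau S).
- by move=> x y n v; rewrite /pt /= scalerDl -zre addrA (Ptau S).
- by move=> x y v; rewrite /pt /= trN scaleNr -opprD (PTh S).
- by move=> p phi v; exact: rank1.
- by [].
- by [].
- by move=> x; rewrite /pt /= scale0r addr0.
- by [].
- by [].
exists (fun x : 'rV[R]_d => u (x, x 0 (Ordinal jd))); split=> //.
- apply: (Lip_comp uL); exists 1 => // x y; rewrite mul1r prod_normE /= ge_max lexx /=.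
  by have := coord_le (x - y) (Ordinal jd); rewrite !mxE.
- by move=> x; rewrite (trS jd) -/(pt (x, x 0 (Ordinal jd))) uP.
- by move=> x z; rewrite !mxE ut (trS jd) (tauD S).
- by move=> x; rewrite mxE uT.
Qed.

End Line.

(** * Nonvanishing sections in rank at least two *)

Section Sections.
Variables (R : realType) (V : normedModType R) (J : V -> V).
Variables (d : nat) (P : 'rV[R]_d -> V -> V) (tau : 'rV[int]_d -> V -> V) (Th : V -> V).
Hypothesis S : bsys J P tau Th.
Implicit Types (x y : 'rV[R]_d) (v w : V) (z n : 'rV[int]_d).

Lemma bsection0 : bsection P tau Th (fun _ => 0).
Proof.
split=> *; rewrite ?(rlin0 (Plin S _)) ?(rlin0 (isomL (taui S _))) ?(rlin0 (isomL (Thi S))) //.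
exact: Lip_cst.
Qed.

Lemma bsectionD (u v : 'rV[R]_d -> V) : bsection P tau Th u -> bsection P tau Th v ->
  bsection P tau Th (fun x => u x + v x).
Proof.
move=> [u1 u2 u3 u4] [v1 v2 v3 v4]; split=> *; first exact: LipD.
- by rewrite (rlinD (Plin S _)) u2 v2.
- by rewrite u3 v3 (rlinD (isomL (taui S _))).
- by rewrite u4 v4 (rlinD (isomL (Thi S))).
Qed.

Lemma norm_sec_zr u x z : bsection P tau Th u -> `|u (x + zr R z)| = `|u x|.
Proof. by move=> [_ _ h _]; rewrite h (isomN (taui S _)). Qed.

Definition kappa (r : R) (y : 'rV[R]_d) : R := Num.max 0 (Num.min 1 (2 - `|y| / r)).

Lemma kappa_ge0 r y : 0 <= kappa r y. Proof. by rewrite le_max lexx. Qed.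
Lemma kappa_le1 r y : kappa r y <= 1. Proof. by rewrite ge_max ler01 ge_min lexx. Qed.
Lemma kappa1 r y : 0 < r -> `|y| <= r -> kappa r y = 1.
Proof.
move=> r0 yr; have h : `|y| / r <= 1 by rewrite ler_pdivrMr // mul1r.
by rewrite /kappa min_l ?max_r //; lra.
Qed.
Lemma kappa0 r y : 0 < r -> 2 * r <= `|y| -> kappa r y = 0.
Proof.
move=> r0 yr; have h : 2 <= `|y| / r by rewrite ler_pdivlMr.
by rewrite /kappa max_l // ge_min; apply/orP; right; lra.
Qed.
Lemma kappa_Lip r x y : 0 < r -> `|kappa r x - kappa r y| <= r^-1 * `|x - y|.
Proof.
move=> r0; have i0 : 0 <= r^-1 by rewrite invr_ge0 ltW.
have h : `| `|x| / r - `|y| / r | <= r^-1 * `|x - y|.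
  rewrite -mulrBl normrM mulrC normfV (gtr0_norm r0) ler_wpM2l //.
  exact: ler_dist_dist.
apply: le_trans h; rewrite /kappa; move: (`|x| / r) (`|y| / r) => a b.
case: (leP 0 (a - b)) => h5; rewrite ?(ger0_norm h5) ?(ltr0_norm h5);
case: (leP 1 (2 - a)) => h1; case: (leP 1 (2 - b)) => h2;
case: (leP 0 (2 - a)) => h3; case: (leP 0 (2 - b)) => h4;
 rewrite ?max_r ?max_l ?ler_norml //; try (apply/andP; split); lra.
Qed.

(* The [tau]-equivariant cut-off of the constant vector [v] near [g + Z^d]. *)
Definition wv (r : R) (g : 'rV[R]_d) (v : V) (x : 'rV[R]_d) : V :=
  kappa r (x - g - zr R (rdv (x - g))) *: tau (rdv (x - g)) v.

Variables (r : R) (g : 'rV[R]_d).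
Hypothesis r0 : 0 < r.
Hypothesis r8 : r <= 1 / 8.

Lemma wv_tau v x z : wv r g v (x + zr R z) = tau z (wv r g v x).
Proof.
rewrite /wv (_ : x + zr R z - g = (x - g) + zr R z); last by rewrite addrAC.
rewrite rdvD zrD opprD addrACA subrr addr0.
by rewrite [rdv _ + z]addrC (tauD S) (rlinZ (isomL (taui S _))).
Qed.

Lemma wvE v x z : `|x - g - zr R z| < 1 / 2 ->
  wv r g v x = kappa r (x - g - zr R z) *: tau z v.
Proof. by move=> h; rewrite /wv (rdv_small h). Qed.

Lemma wv_le v x : `|wv r g v x| <= `|v|.
Proof.
rewrite normrZ (isomN (taui S _)) ger0_norm ?kappa_ge0 //.
by rewrite ler_piMl // kappa_le1.
Qed.

Lemma wv_Lip v : Lip (wv r g v).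
Proof.
have h8 := r8; have i0 : 0 <= r^-1 by rewrite invr_ge0 ltW.
apply: (@Lip_local _ _ _ _ (r^-1 * `|v|) (1/4)); first by rewrite mulr_ge0.
- lra.
- move=> x y xy.
  have [e|ne] := eqVneq (rdv (x - g)) (rdv (y - g)).
    rewrite /wv e -scalerBl normrZ (isomN (taui S _)).
    apply: le_trans (ler_wpM2r (normr_ge0 v) (kappa_Lip _ _ r0)) _.
    have -> : x - g - zr R (rdv (y - g)) - (y - g - zr R (rdv (y - g))) = x - y.
      by rewrite opprB addrA subrK opprB addrA subrK.
    by rewrite mulrAC.
  (* The cut-off lives within [2 r <= 1/4] of the centre. A point of its support and a point at
     distance at most 1/4 from it thus have the same nearest lattice point, so where the roundings
     differ both cut-offs vanish. *)
  have far (a b : 'rV[R]_d) : `|a - b| <= 1 / 4 -> rdv (a - g) != rdv (b - g) ->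
      kappa r (a - g - zr R (rdv (a - g))) = 0.
    move=> ab nab; apply: kappa0 => //; rewrite leNgt; apply/negP => lt.
    move/eqP: nab; apply; apply/esym/rdv_small.
    have -> : b - g - zr R (rdv (a - g)) = (a - g - zr R (rdv (a - g))) - (a - b).
      by apply/rowP => i; rewrite !mxE; ring.
    apply: le_lt_trans (ler_normB _ _) _; apply: lt_le_trans (ltr_leD lt ab) _; lra.
  rewrite /wv (far x y) // (far y x); last 2 first.
  + by rewrite distrC.
  + by rewrite eq_sym.
  by rewrite !scale0r subrr normr0 !mulr_ge0.
- by exists `|v| => // x; exact: wv_le.
Qed.

(** The building block of all perturbations: symmetrising under time reversal and projecting turn
    the local constant vector [v] into a global section with all symmetries. *)
Definition sigma (v : V) (x : 'rV[R]_d) : V := P x (wv r g v x + Th (wv r g v (- x))).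

Lemma sigma_le v x : `|sigma v x| <= 2 * `|v|.
Proof.
apply: le_trans (Pnorm S _ _) _; apply: le_trans (ler_normD _ _) _.
rewrite (isomN (Thi S)); have := wv_le v x; have := wv_le v (- x); lra.
Qed.

Lemma bsection_sigma v : bsection P tau Th (sigma v).
Proof.
have sumL : Lip (fun x => wv r g v x + Th (wv r g v (- x))).
  apply: LipD; first exact: wv_Lip.
  apply: (@Lip_isom _ _ _ _ Th); first exact: (rlinB (isomL (Thi S))).
    by move=> w; rewrite (isomN (Thi S)).
  have [L L0 HL] := wv_Lip v; exists L => // x y.
  by apply: le_trans (HL _ _) _; rewrite -opprD normrN.
split.
- apply: (Lip_app (PLip S) (Plin S) (Pnorm S)) => //.
  exists (2 * `|v|); first by rewrite mulr_ge0.
  move=> x; apply: le_trans (ler_normD _ _) _.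
  rewrite (isomN (Thi S)); have := wv_le v x; have := wv_le v (- x); lra.
- by move=> x; rewrite /sigma (PP S).
- move=> x z; rewrite /sigma opprD -zrN !wv_tau (Thtau S) opprK.
  by rewrite -(rlinD (isomL (taui S _))) (Ptau S).
- move=> x; rewrite /sigma opprK -(PTh S) (rlinD (isomL (Thi S))) (ThTh S).
  by congr (P _ _); rewrite addrC.
Qed.

(* The hypothesis keeps [g] away from [- g + Z^d], so that time reversal does
   not constrain the values of sections near [g]. *)
Lemma sigma_free v x : (forall z, 3 * r <= `|2 *: g + zr R z|) -> `|x - g| <= r ->
  sigma v x = P x v.
Proof.
move=> fr xg; have h8 := r8; have h0 := r0; rewrite /sigma (@wvE v x 0); last first.
  by rewrite zr0 subr0; apply: le_lt_trans xg _; lra.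
rewrite zr0 subr0 kappa1 // scale1r (tau0 S); congr (P x _).
(* A point [x] within [r] of [g] whose reflection met the cut-off, of radius [2 r], would bring
   [2 g] closer than [3 r] to the lattice. *)
suff -> : wv r g v (- x) = 0 by rewrite (rlin0 (isomL (Thi S))) addr0.
rewrite /wv kappa0 ?scale0r //; set z := rdv _.
have := fr z; have -> : 2 *: g + zr R z = - (x - g) - (- x - g - zr R z).
  by apply/rowP => i; rewrite !mxE; ring.
have := ler_normB (- (x - g)) (- x - g - zr R z); rewrite normrN; lra.
Qed.

(** Here the cut-off around [g] meets its own reflection; for a vector fixed by the conjugation of
    the fibre the two contributions agree and add up instead of cancelling. *)
Lemma sigma_trim v n : 2 *: g = zr R n -> P g v = v -> tau n (Th v) = v ->
  sigma v g = 2 *: v.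
Proof.
move=> gn Pv tv; rewrite /sigma (@wvE v g 0); last by rewrite zr0 subr0 subrr normr0; lra.
have e : - g - g - zr R (- n) = 0.
  by rewrite zrN -gn opprK; apply/rowP => i; rewrite !mxE; ring.
rewrite (@wvE v (- g) (- n)) ?e; last by rewrite normr0; lra.
have k0 : kappa r 0 = 1 by rewrite kappa1 // normr0 ltW.
rewrite zr0 subr0 subrr k0 !scale1r (tau0 S) (Thtau S) opprK tv (rlinD (Plin S _)) Pv.
by rewrite scaler_nat mulr2n.
Qed.

End Sections.

(** * A small vector that cancels a given section nowhere on a patch *)

Section Pigeonhole.
Variables (R : realType) (V : normedModType R) (rip : V -> V -> R) (J : V -> V).
Hypothesis C : cplx rip J.
Variables (e1 e2 : V).
Hypothesis n1 : `|e1| = 1.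
Hypothesis n2 : `|e2| = 1.
Hypothesis o12 : rip e1 e2 = 0.
Hypothesis oJ12 : rip (J e1) e2 = 0.

Definition comb4 (a b c d : R) : V := a *: e1 + b *: J e1 + (c *: e2 + d *: J e2).

Lemma comb4B a b c d a' b' c' d' :
  comb4 a b c d - comb4 a' b' c' d' = comb4 (a - a') (b - b') (c - c') (d - d').
Proof. by rewrite /comb4 !scalerBl !opprD addrACA [_ + (- _ + _)]addrACA [c *: e2 + _ + _]addrACA. Qed.

Lemma norm_comb4 a b c d : `|comb4 a b c d| ^+ 2 = a ^+ 2 + b ^+ 2 + c ^+ 2 + d ^+ 2.
Proof.
have q1 : rip e1 e1 = 1 by rewrite (rip_norm C) n1 expr1n.
have q2 : rip e2 e2 = 1 by rewrite (rip_norm C) n2 expr1n.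
have q3 : rip e1 (J e1) = 0 by exact: rip_Jid C _.
have q4 : rip e2 (J e2) = 0 by exact: rip_Jid C _.
have q5 : rip e1 (J e2) = 0 by apply/oppr_inj; rewrite -(ripJ C) oJ12 oppr0.
rewrite -(rip_norm C) /comb4 !(ripDl C) !(ripDr C) !(ripZl C) !(ripZr C) !(ripJJ C).
rewrite (ripC C (J e1) e1) (ripC C (J e2) e1) (ripC C e2 e1) (ripC C e2 (J e1)).
by rewrite (ripC C (J e2) e2) q1 q2 q3 q4 q5 o12 oJ12; ring.
Qed.

Lemma comb4_le (m : R) a b c d : 0 <= m -> `|a| <= m -> `|b| <= m -> `|c| <= m -> `|d| <= m ->
  `|comb4 a b c d| <= 4 * m.
Proof.
move=> m0 ha hb hc hd; have le (x : R) (w : V) : `|x| <= m -> `|w| = 1 -> `|x *: w| <= m.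
  by move=> hx hw; rewrite normrZ hw mulr1.
have h1 := le _ _ ha n1; have h3 := le _ _ hc n2.
have h2 : `|b *: J e1| <= m by apply: le; rewrite ?(norm_J C).
have h4 : `|d *: J e2| <= m by apply: le; rewrite ?(norm_J C).
apply: le_trans (ler_normD _ _) _.
have := lerD (le_trans (ler_normD _ _) (lerD h1 h2)) (le_trans (ler_normD _ _) (lerD h3 h4)).
by move=> h; apply: le_trans h _; lra.
Qed.

Variables (d : nat) (P : 'rV[R]_d -> V -> V) (s : 'rV[R]_d -> V) (g : 'rV[R]_d).
Variables (Lp L r eps : R).
Hypothesis d3 : (d <= 3)%N.
Hypothesis Plin : forall x, rlin (P x).
Hypothesis PJ : forall x v, P x (J v) = J (P x v).
Hypothesis Lp0 : 0 <= Lp.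
Hypothesis PLip : forall x y v, `|P x v - P y v| <= Lp * `|x - y| * `|v|.
Hypothesis L0 : 0 <= L.
Hypothesis sLip : forall x y, `|s x - s y| <= L * `|x - y|.
Hypothesis r0 : 0 < r.
Hypothesis eps0 : 0 < eps.
Hypothesis Pe1 : P g e1 = e1.
Hypothesis Pe2 : P g e2 = e2.
Hypothesis small : Lp * r <= 1 / 2.

(* [K^4] candidate vectors of mutual distance at least [eps/(16 K)], against
   [(n+1)^d] cells of side [2r/n] with [n ~ K]: as [d <= 3 < 4], not every
   candidate can be nearly cancelled somewhere on the patch. *)
Lemma avoid : exists w, `|w| <= eps / 4 /\
  exists2 k : R, 0 < k & forall x, `|x - g| <= r -> k <= `|s x + P x w|.
Proof.
(* The number [c] makes the variation of section and projector across one cell at most [del / 8],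
   whatever [K] is, because the cells shrink like [1/K] just as [del] does. Only then is [K] chosen,
   so large that [(n+1)^3 <= 8 (c+1)^3 K^3 < K^4]. *)
have [c hc] := nat_above (256 * r * (L + Lp * eps) / eps).
have [K [Kp Kc]] : exists K : nat, (0 < K)%N /\ (8 * c.+1 ^ 3 < K)%N.
  by exists (8 * c.+1 ^ 3).+1; split.
have [n nE] : exists n : nat, n = (c.+1 * K)%N by exists (c.+1 * K)%N.
have K0 : 0 < K%:R :> R by rewrite ltr0n.
have n0 : 0 < n%:R :> R by rewrite ltr0n nE muln_gt0.
(* Spacing of the candidates: four coefficients below [K del] give a norm below
   [4 K del = eps / 4]. *)
pose del := eps / (16 * K%:R).
have del0 : 0 < del by rewrite divr_gt0 // mulr_gt0.
have del1 : 0 <= del by exact: ltW.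
have r1 : 0 <= r by exact: ltW.
have n1' : 0 <= n%:R :> R by exact: ltW.
have h0 := r0; have he := eps0.
have rn1 : 0 <= 2 * r / n%:R by rewrite divr_ge0 // mulr_ge0.
pose T := ('I_K * 'I_K * ('I_K * 'I_K))%type.
pose w (f : T) := comb4 (f.1.1%:R * del) (f.1.2%:R * del) (f.2.1%:R * del) (f.2.2%:R * del).
have wle f : `|w f| <= eps / 4.
  have b1 (i : 'I_K) : `|i%:R * del| <= K%:R * del :> R.
    have i0 : 0 <= i%:R * del by rewrite mulr_ge0.
    by rewrite (ger0_norm i0); apply: ler_wpM2r => //; rewrite ler_nat ltnW.
  have := comb4_le _ (b1 f.1.1) (b1 f.1.2) (b1 f.2.1) (b1 f.2.2).
  rewrite mulr_ge0 // => /(_ isT) h; apply: le_trans h _.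
  by rewrite /del le_eqVlt; apply/orP; left; apply/eqP; field; rewrite gt_eqF.
suff [f [k k0 Hk]] : exists f, exists2 k, 0 < k & forall x, `|x - g| <= r -> k <= `|s x + P x (w f)|.
  by exists (w f); split=> //; exists k.
apply: contrapT => Hno.
have ex f : exists x, `|x - g| <= r /\ `|s x + P x (w f)| < del / 16.
  apply: contrapT => H; apply: Hno; exists f; exists (del / 16); first lra.
  by move=> x xg; rewrite leNgt; apply/negP => lt; apply: H; exists x.
have [X HX] := choice ex.
pose cellc (x : 'rV[R]_d) (i : 'I_d) : R := (x 0 i - g 0 i + r) / (2 * r) * n%:R.
(* There are [n + 1] values per coordinate, as a point on the far face of the patch gets the index
   [n]. *)
pose cell (f : T) : {ffun 'I_d -> 'I_n.+1} := [ffun i => inord (Num.truncn (cellc (X f) i))].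
have cellb f i : 0 <= cellc (X f) i <= n%:R.
  have [xg _] := HX f; have := le_trans (coord_le _ i) xg; rewrite !mxE ler_norml => /andP[h1 h2].
  have h3 : 0 <= (X f 0 i - g 0 i + r) / (2 * r) <= 1.
    by apply/andP; split; [rewrite divr_ge0 | rewrite ler_pdivrMr]; lra.
  case/andP: h3 => h3 h4; rewrite /cellc mulr_ge0 //=.
  by rewrite ler_piMl.
have cellE f f' : cell f = cell f' -> `|X f - X f'| <= 2 * r / n%:R.
  move=> ff; apply/norm_leP => [|i]; first by [].
  have := congr1 (fun h : {ffun 'I_d -> 'I_n.+1} => val (h i)) ff; rewrite !ffunE /=.
  have tr f0 : (Num.truncn (cellc (X f0) i) < n.+1)%N.
    have /andP[c0 c1] := cellb f0 i; rewrite ltnS -(ler_nat R).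
    by apply: le_trans c1; rewrite truncn_le.
  rewrite !inordK // => e.
  have /andP[c0 c1] := cellb f i; have /andP[c0' c1'] := cellb f' i.
  have /andP[t1 t2] := truncn_itv c0; have /andP[t1' t2'] := truncn_itv c0'.
  rewrite e in t1 t2; rewrite !mxE.
  have -> : X f 0 i - X f' 0 i = 2 * r / n%:R * (cellc (X f) i - cellc (X f') i).
    by rewrite /cellc; field; rewrite !gt_eqF.
  rewrite normrM ger0_norm // ler_piMr // ler_norml.
  move: t1 t2 t1' t2'; rewrite -[in _.+1%:R]natr1; lra.
(* Suppose two distinct candidates are nearly cancelled in the same cell. Their difference has norm
   at least [del] and keeps at least half of it under the projector, by [small]; but the two near
   cancellations and the variation across the cell bound the projected difference by
   [del/16 + del/16 + del/8 = del/4]. *)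
have inj : injective cell.
  move=> f f' /cellE dX; apply: contrapT => ff.
  have [xg xs] := HX f; have [xg' xs'] := HX f'.
  have wB : del <= `|w f - w f'|.
    rewrite -(ler_sqr (x := del)) ?nnegrE // comb4B norm_comb4.
    move: del del0 del1 {w wle Hno ex X HX cell cellb cellE dX xg xs xg' xs'} => del del0 del1.
    rewrite -!mulrBl !exprMn -!mulrDl ler_peMl ?exprn_ge0 //.
    have sq (i j : 'I_K) : 0 <= (i%:R - j%:R) ^+ 2 :> R by rewrite sqr_ge0.
    have sq1 (i j : 'I_K) : i <> j -> 1 <= (i%:R - j%:R) ^+ 2 :> R.
      move=> ij; have -> : (i%:R - j%:R) ^+ 2 = ((i%:Z - j%:Z) ^+ 2)%:~R :> R.
        by rewrite rmorphXn rmorphB /=.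
      rewrite -[1]/(1%:~R) ler_int.
      have : i%:Z - j%:Z != 0 by rewrite subr_eq0; apply/eqP => -[] /val_inj.
      by move: (i%:Z - j%:Z) => t t0; rewrite -gtz0_ge1 exprn_even_gt0.
    case: f f' ff => [[a b] [c' d']] [[a' b'] [c'' d'']] /= ff.
    have := sq a a'; have := sq b b'; have := sq c' c''; have := sq d' d''.
    have [ea|/eqP/sq1 h] := eqVneq a a'; last by lra.
    have [eb|/eqP/sq1 h] := eqVneq b b'; last by lra.
    have [ec|/eqP/sq1 h] := eqVneq c' c''; last by lra.
    have [ed|/eqP/sq1 h] := eqVneq d' d''; last by lra.
    by case: ff; rewrite ea eb ec ed.
  have Pw : P g (w f - w f') = w f - w f'.
    rewrite comb4B /comb4 !(rlinD (Plin g)) !(rlinZ (Plin g)) !PJ Pe1 Pe2 //.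
  have lowP : `|w f - w f'| / 2 <= `|P (X f') (w f - w f')|.
    have h1 := PLip g (X f') (w f - w f'); rewrite Pw in h1.
    have h2 : Lp * `|g - X f'| * `|w f - w f'| <= 1 / 2 * `|w f - w f'|.
      rewrite ler_wpM2r // distrC; apply: le_trans small; exact: ler_wpM2l.
    have h3 := ler_normD (w f - w f' - P (X f') (w f - w f')) (P (X f') (w f - w f')).
    rewrite subrK in h3; have := le_trans h1 h2; lra.
  have up : `|P (X f') (w f - w f')| <= del / 16 + del / 16 + (L + Lp * (eps / 4)) * (2 * r / n%:R).
    have -> : P (X f') (w f - w f') = (s (X f) + P (X f) (w f)) - (s (X f') + P (X f') (w f'))
       - (s (X f) - s (X f')) - (P (X f) (w f) - P (X f') (w f)).
      rewrite (rlinB (Plin _)); set A := s (X f); set B := P (X f) (w f).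
      set A' := s (X f'); set B' := P (X f') (w f'); set D := P (X f') (w f).
      move: A B A' B' D => A B A' B' D.
      by rewrite opprD addrACA [A - A' + _]addrC addrK opprB [RHS]addrC addrA subrK.
    apply: le_trans (ler_normB _ _) _; rewrite mulrDl addrA; apply: lerD.
      apply: le_trans (ler_normB _ _) _; apply: lerD.
        by apply: le_trans (ler_normB _ _) _; apply: lerD; exact: ltW.
      by apply: le_trans (sLip _ _) _; apply: ler_wpM2l.
    apply: le_trans (PLip _ _ _) _; rewrite [leRHS]mulrAC; apply: ler_pM => //.
      by rewrite mulr_ge0.
    by apply: ler_wpM2l.
  have : (L + Lp * (eps / 4)) * (2 * r / n%:R) <= del / 8.
    have h1 : (L + Lp * (eps / 4)) * (2 * r / n%:R) <= (L + Lp * eps) * (2 * r / n%:R).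
      rewrite ler_wpM2r // lerD2l ler_wpM2l //; lra.
    apply: le_trans h1 _.
    have -> : (L + Lp * eps) * (2 * r / n%:R) =
       (256 * r * (L + Lp * eps) / eps) * (eps / (128 * n%:R)).
      by field; rewrite !gt_eqF.
    have -> : del / 8 = c.+1%:R * (eps / (128 * n%:R)).
      by rewrite /del nE natrM; field; rewrite !gt_eqF // ltr0n.
    have h2 : 0 < eps / (128 * n%:R) by rewrite divr_gt0 // mulr_gt0.
    by rewrite ler_pM2r // ltW.
  lra.
have := leq_card cell inj.
rewrite card_ffun !card_prod !card_ord leqNgt => /negP; apply.
have h : (n.+1 ^ d <= n.+1 ^ 3)%N by rewrite leq_pexp2l.
apply: leq_ltn_trans h _.
have hn : (n.+1 <= 2 * (c.+1 * K))%N by rewrite nE mul2n -addnn -addn1 leq_add2l muln_gt0.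
have h2 : (n.+1 ^ 3 <= (2 * (c.+1 * K)) ^ 3)%N by rewrite leq_exp2r.
apply: leq_ltn_trans h2 _.
have -> : ((2 * (c.+1 * K)) ^ 3 = (8 * c.+1 ^ 3) * (K * K * K))%N.
  by rewrite !expnMn -mulnA -[(2 ^ 3)%N]/8%N; congr (_ * (_ * _))%N; rewrite !expnS expn0 muln1 mulnA.
have -> : (K * K * (K * K) = K * (K * K * K))%N by rewrite !mulnA.
by rewrite ltn_mul2r Kc !muln_gt0 Kp.
Qed.

End Pigeonhole.

Lemma abs_int_box (k : int) (M : nat) :
  `|k| <= M%:Z -> - M%:Z <= k < - M%:Z + (2 * M + 1)%N%:Z.
Proof. lia. Qed.

Lemma modz2_box (k : int) : 0 <= (k %% 2)%Z < 0 + 2%N%:Z.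
Proof. lia. Qed.

(** * Covering a period by patches on which zeros have been removed *)

Section GenericSection.
Variables (R : realType) (V : normedModType R) (rip : V -> V -> R) (J : V -> V).
Hypothesis C : cplx rip J.
Variables (d : nat) (P : 'rV[R]_d -> V -> V) (tau : 'rV[int]_d -> V -> V) (Th : V -> V).
Hypothesis d3 : (d <= 3)%N.
Hypothesis S : bsys J P tau Th.
Hypothesis rank2 : forall x, exists e1 e2, [/\ `|e1| = 1, `|e2| = 1, P x e1 = e1, P x e2 = e2 &
  rip e1 e2 = 0 /\ rip (J e1) e2 = 0].
Implicit Types (x g t : 'rV[R]_d) (z n : 'rV[int]_d).

(** The uniform lower bound [e] is what makes the covering argument work: a perturbation of size at
    most [e/2] enlarges the set and still leaves the bound [e/2] on the old one. *)
Definition good (A : 'rV[R]_d -> Prop) : Prop :=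
  exists2 s, bsection P tau Th s & exists2 e : R, 0 < e & forall x, A x -> e <= `|s x|.

Lemma good_sub (A B : 'rV[R]_d -> Prop) : (forall x, B x -> A x) -> good A -> good B.
Proof. by move=> BA [s ss [e e0 he]]; exists s => //; exists e => // x /BA/he. Qed.

(* As [t = - t] modulo the lattice, [tau n \o Th] is a conjugation of the fibre
   at [t]; its fixed vectors are the admissible values of a section at [t]. *)
Lemma good_trim A t n : 2 *: t = zr R n -> good A ->
  exists2 rho : R, 0 < rho & good (fun x => A x \/ `|x - t| <= rho).
Proof.
move=> tn [s0 s0s [e0 e00 He0]].
have [s ss [[e epos He] st]] : exists2 s, bsection P tau Th s &
    (exists2 e : R, 0 < e & forall x, A x -> e <= `|s x|) /\ s t != 0.
  have [s0t|s0t] := eqVneq (s0 t) 0; last first.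
    by exists s0 => //; split=> //; exists e0.
  have [e1 [_ [e11 _ Pe1 _ _]]] := rank2 t.
  pose A' v := tau n (Th v).
  have tN : - t + zr R n = t by rewrite -tn; apply/rowP => i; rewrite !mxE; ring.
  have A'i : isom A'.
    split; last by move=> v; rewrite /A' (isomN (taui S _)) (isomN (Thi S)).
    have TL := isomL (taui S n); have ThL := isomL (Thi S).
    by split=> *; rewrite /A' ?(rlinD ThL) ?(rlinZ ThL) ?(rlinD TL) ?(rlinZ TL).
  have [||||v [v1 Pv Av]] := fixed_unit_vector (v := e1) C (Plin S t) (PJ S t) A'i _ _ _ _ Pe1.
  - by move=> v; rewrite /A' (ThJ S) (rlinN (isomL (taui S _))) (tauJ S).
  - by move=> v; rewrite /A' (Thtau S) -(tauD S) subrr (tau0 S) (ThTh S).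
  - by move=> v; rewrite /A' -{1}tN (Ptau S) (PTh S).
  - by rewrite -normr_eq0 e11 oner_eq0.
  have r8 : 0 < 1 / 8 :> R by lra.
  (* By [sigma_le] the perturbation is at most [2 c = e0 / 2]. *)
  pose c := e0 / 4.
  exists (fun x => s0 x + sigma P tau Th (1/8) t (c *: v) x).
    by apply: (bsectionD S) => //; apply: (bsection_sigma S).
  have nc : `|c *: v| = e0 / 4 by rewrite normrZ v1 mulr1 ger0_norm // divr_ge0 // ltW.
  split.
    exists (e0 / 2); first lra.
    move=> x /He0 h; have := sigma_le S (1/8) t (c *: v) x; rewrite nc => h2.
    have := ler_normB (s0 x + sigma P tau Th (1 / 8) t (c *: v) x) (sigma P tau Th (1/8) t (c *: v) x).
    by rewrite addrK; lra.
  rewrite s0t add0r (sigma_trim S r8 tn) ?(rlinZ (Plin S _)) ?Pv //; last 1 first.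
    by rewrite (rlinZ (isomL (Thi S))) (rlinZ (isomL (taui S _))) [tau _ _]Av.
  by rewrite -normr_eq0 normrZ nc normr_nat gt_eqF //; lra.
have [L L0 HL] := secL ss.
have st0 : 0 < `|s t| by rewrite normr_gt0.
have L1 : 0 < 2 * (L + 1) by lra.
exists (`|s t| / (2 * (L + 1))); first by rewrite divr_gt0.
exists s => //; exists (Num.min e (`|s t| / 2)).
  by rewrite lt_min epos divr_gt0.
move=> x [/He h|h]; first by rewrite ge_min h.
rewrite ge_min; apply/orP; right.
have h1 : L * `|x - t| <= `|s t| / 2.
  apply: le_trans (ler_wpM2l L0 h) _.
  have -> : L * (`|s t| / (2 * (L + 1))) = `|s t| / 2 * (L / (L + 1)).
    by field; rewrite gt_eqF //; lra.
  by rewrite ler_piMr ?divr_ge0 // ler_pdivrMr; lra.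
have h2 := le_trans (HL x t) h1; rewrite distrC in h2.
by have := ler_normD (s t - s x) (s x); rewrite subrK; lra.
Qed.

(** On the patch [sigma w] is just [P x w], so [avoid] provides a lower bound there. Its [w] has
    norm at most [e/4], so the perturbation is at most [e/2] everywhere and half of the old bound
    survives on [A]. *)
Lemma good_patch A (Lp r : R) g : 0 <= Lp ->
  (forall x y v, `|P x v - P y v| <= Lp * `|x - y| * `|v|) ->
  0 < r -> r <= 1 / 8 -> Lp * r <= 1 / 2 -> (forall z, 3 * r <= `|2 *: g + zr R z|) ->
  good A -> good (fun x => A x \/ `|x - g| <= r).
Proof.
move=> Lp0 HLp r0 r8 Lpr fr [s ss [e e0 He]].
have [e1 [e2 [n1 n2 Pe1 Pe2 [o1 o2]]]] := rank2 g; have [L L0 HL] := secL ss.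
have [w [wle [k k0 Hk]]] := avoid C n1 n2 o1 o2 d3 (Plin S) (PJ S) Lp0 HLp L0 HL r0 e0 Pe1 Pe2 Lpr.
exists (fun x => s x + sigma P tau Th r g w x).
  by apply: (bsectionD S) => //; apply: (bsection_sigma S).
exists (Num.min (e / 2) k); first by rewrite lt_min k0 divr_gt0.
move=> x [/He h|h]; rewrite ge_min; apply/orP; [left|right].
  have h2 := sigma_le S r g w x.
  have := ler_normB (s x + sigma P tau Th r g w x) (sigma P tau Th r g w x).
  by rewrite addrK; lra.
by rewrite (sigma_free S r0 r8 _ fr h) Hk.
Qed.

Let boxes (k : nat) (c : int) : seq 'rV[int]_d :=
  [seq \row_i ((f i)%:Z + c) | f : {ffun 'I_d -> 'I_k}].

Let mem_boxes k (c : int) n : (forall i, c <= n 0 i < c + k%:Z) -> n \in boxes k c.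
Proof.
move=> h; have hk (i : 'I_d) : (absz (n 0 i - c)%R < k)%N by have := h i; lia.
apply/mapP; exists [ffun i => Ordinal (hk i)]; first by rewrite mem_enum.
by apply/rowP => i; rewrite mxE ffunE /=; have := h i; lia.
Qed.

(** Modulo the lattice, the points equal to their reflection are the [n/2] with [n] in [{0,1}^d];
    balls of radius [rho] around them come first. A grid of mesh [r] covers the cell, and a grid
    point that violates the separation required by [good_patch] is so close to a half-lattice point
    that its patch is already covered up to translation. *)
Lemma generic_section : exists2 u, bsection P tau Th u &
  exists2 c : R, 0 < c & forall x, c <= `|u x|.
Proof.
have [rho rho0 [s0 s0s [e0 e00 He0]]] : exists2 rho : R, 0 < rho &
    good (fun x => exists2 n, n \in boxes 2 0 & `|x - (1/2) *: zr R n| <= rho).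
  elim: (boxes 2 0) => [|n l [rho rho0 IH]].
    by exists 1 => //; exists (fun _ => 0); [exact: bsection0 S | exists 1 => // x []].
  have tn : 2 *: ((1 / 2) *: zr R n) = zr R n.
    by apply/rowP => i; rewrite !mxE; field.
  have [rho' rho'0 IH'] := good_trim tn IH.
  exists (Num.min rho rho'); first by rewrite lt_min rho0.
  apply: good_sub IH' => x [m]; rewrite inE => /orP[/eqP->|ml]; rewrite le_min => /andP[h1 h2].
    by right.
  by left; exists m.
have [Lp Lp0 HLp] := PLip S.
(* The three terms ensure [r <= 1/8], [Lp r <= 1/2] and [3 r <= rho]. *)
have [M hM] := nat_above (8 + 2 * Lp + 3 / rho).
have M0 : 0 < M.+1%:R :> R by rewrite ltr0n.
pose r : R := M.+1%:R^-1.
have r0 : 0 < r by rewrite invr_gt0.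
have rM : r * M.+1%:R = 1 by rewrite mulVf // gt_eqF.
have rho3 : 0 < 3 / rho by rewrite divr_gt0.
have r8 : r <= 1 / 8 by nra.
have Lpr : Lp * r <= 1 / 2 by nra.
have r3 : 3 * r <= rho.
  have h : 3 / rho * r <= 1 by nra.
  by move: h; rewrite mulrAC ler_pdivrMr // mul1r.
have [s ss [e epos He]] : good (fun x =>
   (exists2 n, n \in boxes 2 0 & `|x - (1/2) *: zr R n| <= rho) \/
   exists n, [/\ n \in boxes (2 * M.+1 + 1) (- M.+1%:Z),
       (forall z, 3 * r <= `|2 *: (r *: zr R n) + zr R z|) & `|x - r *: zr R n| <= r]).
  elim: (boxes (2 * M.+1 + 1) _) => [|n l IH].
    exists s0 => //; exists e0 => // x [/He0 //|[n []]]; by rewrite in_nil.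
  have [fr|nfr] := pselect (forall z, 3 * r <= `|2 *: (r *: zr R n) + zr R z|).
    apply: good_sub (good_patch Lp0 HLp r0 r8 Lpr fr IH) => x [h|[m [ml mf h]]].
      by left; left.
    move: ml; rewrite inE => /orP[/eqP e|ml]; first by right; rewrite -e.
    by left; right; exists m.
  apply: good_sub IH => x [h|[m [ml mf h]]]; first by left.
  move: ml; rewrite inE => /orP[/eqP e|ml]; first by case: nfr; rewrite -e.
  by right; exists m.
exists s => //; exists e => // x0.
have -> : `|s x0| = `|s (x0 - zr R (rdv x0))| by rewrite -zrN (norm_sec_zr S).
move: (x0 - zr R (rdv x0)) (rdv_le x0) => x xh.
have [n hn] : exists n, `|M.+1%:R *: x - zr R n| <= 1 / 2.
  by exists (rdv (M.+1%:R *: x)); exact: rdv_le.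
have xn : `|x - r *: zr R n| <= r.
  have -> : x - r *: zr R n = r *: (M.+1%:R *: x - zr R n) by rewrite scalerBr scalerA rM scale1r.
  rewrite normrZ ger0_norm ?(ltW r0) // ler_piMr // ?(ltW r0) //.
  by apply: le_trans hn _; lra.
have [fr|nfr] := pselect (forall z, 3 * r <= `|2 *: (r *: zr R n) + zr R z|).
  apply: He; right; exists n; split=> //; apply: mem_boxes => i.
  have h1 := le_trans (coord_le _ i) hn.
  have h2 := le_trans (coord_le _ i) xh.
  move: h1; rewrite !mxE => h1.
  have h3 : `|(n 0 i)%:~R| <= M.+1%:R :> R.
    have := ler_normB (M.+1%:R * x 0 i) (M.+1%:R * x 0 i - (n 0 i)%:~R).
    rewrite opprB addrCA subrr addr0 normrM (ger0_norm (ltW M0)).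
    have : M.+1%:R * `|x 0 i| <= M.+1%:R * (1 / 2) by rewrite ler_pM2l.
    have : 1 <= M.+1%:R :> R by rewrite ler1n.
    lra.
  move: h3; rewrite -intr_norm -[M.+1%:R]/((M.+1%:Z)%:~R) ler_int.
  exact: abs_int_box.
have [z hz] : exists z, `|2 *: (r *: zr R n) + zr R z| < 3 * r.
  apply: contrapT => H; apply: nfr => z; rewrite leNgt; apply/negP => lt.
  by apply: H; exists z.
(* Dividing [- z] by 2 splits the half-lattice point [- z/2] into a representative [m/2] and a
   lattice translation [q]. After translation [x] is within [r + 3 r / 2] of [m/2], hence within
   [rho]. *)
pose m : 'rV[int]_d := \row_i (modz (- z 0 i) 2).
pose q : 'rV[int]_d := \row_i (divz (- z 0 i) 2).
have zE : - zr R z = zr R m + 2 *: zr R q.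
  apply/rowP => i; rewrite !mxE -rmorphN {1}(divz_eq (- z 0 i) 2).
  by rewrite rmorphD rmorphM /= addrC mulrC.
have -> : `|s x| = `|s (x - zr R q)| by rewrite -zrN (norm_sec_zr S).
apply: He; left; exists m.
  by apply: mem_boxes => i; rewrite mxE; exact: modz2_box.
have -> : x - zr R q - (1 / 2) *: zr R m =
    (x - r *: zr R n) + (1 / 2) *: (2 *: (r *: zr R n) + zr R z).
  have -> : zr R z = - (zr R m + 2 *: zr R q) by rewrite -zE opprK.
  by apply/rowP => i; rewrite !mxE; field.
apply: le_trans (ler_normD _ _) _; rewrite [`|(1 / 2) *: _|]normrZ ger0_norm; last lra.
by have := ltW hz; lra.
Qed.

End GenericSection.

(** * Smooth maps and smoothing of sections *)

Local Open Scope classical_set_scope.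

Lemma cvg_eq (T : Type) (U : nbhsType) (A : set_system T) (F G : T -> U) (l : U) :
  (forall t, F t = G t) -> G @ A --> l -> F @ A --> l.
Proof. by move=> /funext ->. Qed.

Section Smooth.
Variables (R : realType) (E : normedModType R) (d : nat) (dir : 'I_d -> E).
Implicit Types (j : 'I_d) (k : E).

Definition pd (V : normedModType R) (f : E -> V) j (g : E -> V) : Prop :=
  forall k, (h^-1 *: (f (k + h *: dir j) - f k)) @[h --> (0 : R)^'] --> g k.

Definition smooth (V : normedModType R) (f : E -> V) : Prop :=
  exists D : seq 'I_d -> E -> V,
    [/\ D [::] = f, forall s j, pd (D s) j (D (j :: s)) & forall s, continuous (D s)].

Lemma pdP (V : normedModType R) (f : E -> V) j g :
  pd f j g <-> forall k (eps : R), 0 < eps -> exists2 delta : R, 0 < delta &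
    forall h : R, h != 0 -> `|h| < delta ->
      `|h^-1 *: (f (k + h *: dir j) - f k) - g k| <= eps.
Proof.
split=> H k.
  move=> eps e0; have /cvgrPdist_le/(_ _ e0) := H k.
  rewrite /prop_near1 /= /dnbhs /within /= => /nbhs_ballP[de de0 Hd].
  exists de => // h h0 hd; rewrite distrC; apply: Hd => //.
  by rewrite /ball /= sub0r normrN.
apply/cvgrPdist_le => eps e0; have [de de0 Hd] := H k eps e0.
apply/nbhs_ballP; exists de => // h; rewrite /ball /= sub0r normrN => hd h0.
by rewrite distrC; apply: Hd.
Qed.

(** Replaces Leibniz and chain rules for iterated derivatives: a class of continuous maps in which
    every member has its partial derivatives consists of smooth maps. Later proofs only have to
    exhibit a class closed under one differentiation. *)
Lemma smooth_class (V : normedModType R) (S : (E -> V) -> Prop) f :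
  S f -> (forall g, S g -> continuous g) ->
  (forall g j, S g -> exists2 g', S g' & pd g j g') -> smooth f.
Proof.
move=> Sf Sc Sd.
have ex (gj : (E -> V) * 'I_d) : exists g', S gj.1 -> S g' /\ pd gj.1 gj.2 g'.
  have [Sg|nSg] := pselect (S gj.1); last by exists gj.1.
  by have [g' h1 h2] := Sd _ gj.2 Sg; exists g'.
have [nxt Hn] := choice ex.
pose D := fix D (s : seq 'I_d) := if s is j :: s' then nxt (D s', j) else f.
have SD s : S (D s) by elim: s => //= j s IH; exact: (Hn (D s, j) IH).1.
exists D; split=> // s; last exact/Sc/SD.
by move=> j; exact: (Hn (D s, j) (SD s)).2.
Qed.

Lemma smooth_cont (V : normedModType R) (f : E -> V) : smooth f -> continuous f.
Proof. by move=> [D [<- _ h]]; exact: h. Qed.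

Lemma smooth_pd (V : normedModType R) (f : E -> V) j :
  smooth f -> exists2 g, smooth g & pd f j g.
Proof.
move=> [D [<- h1 h2]]; exists (D [:: j]) => //.
by exists (fun s => D (s ++ [:: j])); split=> //= s; exact: h2.
Qed.

Lemma pdD (V : normedModType R) (f g f' g' : E -> V) j :
  pd f j f' -> pd g j g' -> pd (fun k => f k + g k) j (fun k => f' k + g' k).
Proof.
move=> Hf Hg k; 
have H : (fun h : R => h^-1 *: (f (k + h *: dir j) - f k) + h^-1 *: (g (k + h *: dir j) - g k))
    @ (0 : R)^' --> f' k + g' k by exact: cvgD.
apply: cvg_eq H => h; rewrite -scalerDr; congr (_ *: _).
by rewrite opprD addrACA.
Qed.

Lemma line_cont (V : normedModType R) (f : E -> V) j k :
  continuous f -> f (k + h *: dir j) @[h --> (0 : R)^'] --> f k.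
Proof.
move=> fc; apply: cvg_within_filter.
have -> : f k = f (k + (0 : R) *: dir j) by rewrite scale0r addr0.
apply: continuous_comp; last exact: fc.
apply: cvgD; first exact: cvg_cst.
exact: scalel_continuous.
Qed.

Section Bilinear.
Variables (V1 V2 W : normedModType R) (B : V1 -> V2 -> W) (C : R).
Hypothesis C0 : 0 <= C.
Hypothesis BDl : forall a a' b, B (a + a') b = B a b + B a' b.
Hypothesis BDr : forall a b b', B a (b + b') = B a b + B a b'.
Hypothesis BZl : forall (c : R) a b, B (c *: a) b = c *: B a b.
Hypothesis BZr : forall (c : R) a b, B a (c *: b) = c *: B a b.
Hypothesis Bn : forall a b, `|B a b| <= C * `|a| * `|b|.

Let BBl a a' b : B (a - a') b = B a b - B a' b.
Proof. by rewrite BDl -[- a']scaleN1r BZl scaleN1r. Qed.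
Let BBr a b b' : B a (b - b') = B a b - B a b'.
Proof. by rewrite BDr -[- b']scaleN1r BZr scaleN1r. Qed.

Lemma cvg_bil (T : Type) (F : set_system T) {FF : Filter F} (f : T -> V1) (g : T -> V2) a b :
  f @ F --> a -> g @ F --> b -> (fun t => B (f t) (g t)) @ F --> B a b.
Proof.
move=> fa gb; apply/cvgrPdist_le => e e0.
have Ca : 0 < C * (`|a| + 1) + 1 by rewrite addrC ltr_pwDl // mulr_ge0 // addr_ge0.
have Cb : 0 < C * (`|b| + 1) + 1 by rewrite addrC ltr_pwDl // mulr_ge0 // addr_ge0.
have e1 : 0 < e / 2 / (C * (`|a| + 1) + 1) by rewrite !divr_gt0.
have e2 : 0 < e / 2 / (C * (`|b| + 1) + 1) by rewrite !divr_gt0.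
move/cvgrPdist_le: fa => /(_ _ e2) fa.
have gb1 := (cvgrPdist_le _ _).1 gb _ e1.
have gb2 := (cvgrPdist_le _ _).1 gb _ ltr01.
have {}gb1 : \forall t \near F, `|b - g t| <= e / 2 / (C * (`|a| + 1) + 1) by exact: gb1.
have {}gb2 : \forall t \near F, `|b - g t| <= 1 by exact: gb2.
near=> t.
have f1 : `|a - f t| <= e / 2 / (C * (`|b| + 1) + 1) by near: t.
have g1 : `|b - g t| <= e / 2 / (C * (`|a| + 1) + 1) by near: t.
have g2 : `|b - g t| <= 1 by near: t.
have -> : B a b - B (f t) (g t) = B (a - f t) (g t) + B a (b - g t).
  by rewrite BBl BBr [RHS]addrC addrA subrK.
have gt1 : `|g t| <= `|b| + 1.
  have -> : g t = b - (b - g t) by rewrite opprB addrC subrK.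
  by apply: le_trans (ler_normB _ _) _; rewrite lerD2l.
apply: le_trans (ler_normD _ _) _.
have h1 : `|B (a - f t) (g t)| <= e / 2.
  apply: le_trans (Bn _ _) _.
  apply: (@le_trans _ _ ((C * (`|b| + 1) + 1) * `|a - f t|)).
    rewrite mulrAC ler_wpM2r // (@le_trans _ _ (C * (`|b| + 1))) ?ler_wpM2l //.
    by rewrite lerDl.
  by rewrite mulrC -ler_pdivlMr.
have h2 : `|B a (b - g t)| <= e / 2.
  apply: le_trans (Bn _ _) _.
  apply: (@le_trans _ _ ((C * (`|a| + 1) + 1) * `|b - g t|)).
    rewrite ler_wpM2r // (@le_trans _ _ (C * (`|a| + 1))) ?ler_wpM2l // lerDl //.
  by rewrite mulrC -ler_pdivlMr.
by have := lerD h1 h2; lra.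
Unshelve. all: by end_near. Qed.

Lemma cont_bil (f : E -> V1) (g : E -> V2) :
  continuous f -> continuous g -> continuous (fun k => B (f k) (g k)).
Proof. by move=> fc gc k; exact: (cvg_bil (fc k) (gc k)). Qed.

Lemma pd_bil (f f' : E -> V1) (g g' : E -> V2) j : continuous g ->
  pd f j f' -> pd g j g' ->
  pd (fun k => B (f k) (g k)) j (fun k => B (f' k) (g k) + B (f k) (g' k)).
Proof.
move=> gc Hf Hg k.
have H1 : (fun h : R => B (h^-1 *: (f (k + h *: dir j) - f k)) (g (k + h *: dir j)))
    @ (0 : R)^' --> B (f' k) (g k).
  by apply: cvg_bil; [exact: Hf | exact: line_cont].
have H2 : (fun h : R => B (f k) (h^-1 *: (g (k + h *: dir j) - g k)))
    @ (0 : R)^' --> B (f k) (g' k).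
  by apply: cvg_bil; [exact: cvg_cst | exact: Hg].
have H : (fun h : R => B (h^-1 *: (f (k + h *: dir j) - f k)) (g (k + h *: dir j)) +
    B (f k) (h^-1 *: (g (k + h *: dir j) - g k))) @ (0 : R)^' --> B (f' k) (g k) + B (f k) (g' k).
  exact: cvgD.
apply: cvg_eq H => h.
by rewrite BZl BZr -scalerDr BBl BBr addrA subrK.
Qed.

(** A single product is not stable under derivation, but finite sums of products are, by the Leibniz
    rule. *)
Inductive bilS : (E -> W) -> Prop :=
| bil_prod f g : smooth f -> smooth g -> bilS (fun k => B (f k) (g k))
| bil_add h h' : bilS h -> bilS h' -> bilS (fun k => h k + h' k).

Lemma smooth_bil (f : E -> V1) (g : E -> V2) :
  smooth f -> smooth g -> smooth (fun k => B (f k) (g k)).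
Proof.
move=> sf sg; apply: (@smooth_class _ bilS); first exact: bil_prod.
  move=> h; elim=> [f0 g0 s1 s2|h1 h2 _ c1 _ c2 k].
    by apply: cont_bil; exact: smooth_cont.
  exact: (cvgD (c1 k) (c2 k)).
move=> h j; elim=> [f0 g0 s1 s2|h1 h2 _ [h1' S1 p1] _ [h2' S2 p2]]; last first.
  by exists (fun k => h1' k + h2' k); [exact: bil_add | exact: pdD].
have [f1 sf1 pf1] := smooth_pd j s1; have [g1 sg1 pg1] := smooth_pd j s2.
exists (fun k => B (f1 k) (g0 k) + B (f0 k) (g1 k)).
  by apply: bil_add; exact: bil_prod.
by apply: pd_bil => //; exact: smooth_cont.
Qed.

End Bilinear.

Lemma smoothD (V : normedModType R) (f g : E -> V) :
  smooth f -> smooth g -> smooth (fun k => f k + g k).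
Proof.
move=> sf sg.
apply: (@smooth_class _ (fun h => exists f g, [/\ smooth f, smooth g & h = (fun k => f k + g k)])).
- by exists f, g.
- move=> _ [f0 [g0 [s1 s2 ->]]] k; exact: (cvgD (smooth_cont s1 (x := k)) (smooth_cont s2 (x := k))).
move=> _ j [f0 [g0 [s1 s2 ->]]].
have [f1 sf1 pf1] := smooth_pd j s1; have [g1 sg1 pg1] := smooth_pd j s2.
by exists (fun k => f1 k + g1 k); [exists f1, g1 | exact: pdD].
Qed.

Lemma smooth_cst (V : normedModType R) (c : V) : smooth (fun=> c).
Proof.
apply: (@smooth_class _ (fun h => exists c, h = (fun=> c))).
- by exists c.
- by move=> _ [c0 ->] k; exact: cvg_cst.
move=> _ j [c0 ->]; exists (fun=> 0); first by exists 0.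
move=> k; under eq_fun do rewrite subrr scaler0; exact: cvg_cst.
Qed.

Lemma smooth_scale (V : normedModType R) (a : E -> R) (f : E -> V) :
  smooth a -> smooth f -> smooth (fun k => a k *: f k).
Proof.
apply: (@smooth_bil R V V (fun a v => a *: v) 1) => //.
- by move=> *; rewrite scalerDl.
- by move=> *; rewrite scalerDr.
- by move=> *; rewrite scalerA.
- by move=> *; rewrite !scalerA mulrC.
- by move=> *; rewrite normrZ mul1r.
Qed.

Lemma smoothM (a b : E -> R) : smooth a -> smooth b -> smooth (fun k => a k * b k).
Proof. exact: smooth_scale. Qed.

Lemma smooth_sum (V : normedModType R) (I : Type) (s : seq I) (f : I -> E -> V) :
  (forall i, smooth (f i)) -> smooth (fun k => \sum_(i <- s) f i k).
Proof.
move=> sf; elim: s => [|i s IH].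
  by under eq_fun do rewrite big_nil; exact: smooth_cst.
by under eq_fun do rewrite big_cons; exact: smoothD.
Qed.

Lemma smooth_prod (I : Type) (s : seq I) (f : I -> E -> R) :
  (forall i, smooth (f i)) -> smooth (fun k => \prod_(i <- s) f i k).
Proof.
move=> sf; elim: s => [|i s IH].
  by under eq_fun do rewrite big_nil; exact: smooth_cst.
by under eq_fun do rewrite big_cons; exact: smoothM.
Qed.

(** Meant for expressions containing [rdv], which are smooth because near each point the rounding
    can be frozen. *)
Lemma smooth_local (V : normedModType R) (f : E -> V) :
  (forall k0, exists2 f0, smooth f0 & \forall k \near k0, f k = f0 k) -> smooth f.
Proof.
pose S (h : E -> V) := forall k0, exists2 f0, smooth f0 & \forall k \near k0, h k = f0 k.
have near_cvg (g g' : E -> V) j k (l : V) : (\forall k' \near k, g k' = g' k') ->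
    (h^-1 *: (g (k + h *: dir j) - g k)) @[h --> (0 : R)^'] --> l ->
    (h^-1 *: (g' (k + h *: dir j) - g' k)) @[h --> (0 : R)^'] --> l.
  move=> gg'; apply: cvg_trans; apply: near_eq_cvg.
  have gk := nbhs_singleton gg'.
  have : \forall h \near (0 : R), g (k + h *: dir j) = g' (k + h *: dir j).
    have : (k + h *: dir j) @[h --> (0 : R)] --> k.
      rewrite -[X in _ --> X]addr0 -[X in _ + X](scale0r (dir j)).
      by apply: cvgD; [exact: cvg_cst | exact: scalel_continuous].
    by move/(_ _ gg').
  move=> H; apply: cvg_within; near=> h.
  have -> // : g (k + h *: dir j) = g' (k + h *: dir j) by near: h.
  by rewrite gk.
move=> Sf; apply: (@smooth_class _ S) => //.
  move=> h Sh k; have [f0 sf0 nf0] := Sh k.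
  rewrite /continuous_at (nbhs_singleton nf0).
  apply: cvg_trans (smooth_cont sf0 (x := k)); apply: near_eq_cvg.
  by apply: filterS nf0 => x ->.
move=> h j Sh.
have ex k0 : exists g, [/\ smooth g.1, smooth g.2, pd g.1 j g.2 & \forall k \near k0, h k = g.1 k].
  have [f0 sf0 nf0] := Sh k0; have [f1 sf1 pf1] := smooth_pd j sf0.
  by exists (f0, f1).
have [G HG] := choice ex.
(* The derivative at [k] is read off from the local model chosen at [k]. Near [k0] it agrees with
   the derivative of the model at [k0], since both models coincide with [h] there and limits are
   unique. *)
exists (fun k => (G k).2 k); last first.
  move=> k; have [s1 s2 p n] := HG k; apply: near_cvg (p k).
  by apply: filterS n => x ->.
move=> k0; have [s1 s2 p n] := HG k0; exists (G k0).2 => //.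
have nn := near_join n; near=> k.
have [s1' s2' p' n'] := HG k.
have nk : \forall k' \near k, h k' = (G k0).1 k' by near: k.
have eqn : \forall k' \near k, (G k).1 k' = (G k0).1 k'.
  by near=> k'; transitivity (h k'); [apply/esym; near: k' | near: k'].
have q1 := near_cvg _ _ _ _ _ eqn (p' k).
exact: (cvg_unique _ q1 (p k)).
Unshelve. all: by end_near. Qed.

Section InverseSqrt.
Variable f : E -> R.
Hypothesis sf : smooth f.
Hypothesis fpos : forall k, 0 < f k.

Let g k : R := (Num.sqrt (f k))^-1.

Let gc : continuous g.
Proof.
move=> k; apply: cvgV; first by apply: lt0r_neq0; rewrite sqrtr_gt0.
by apply: continuous_comp; [exact: smooth_cont | exact: sqrt_continuous].
Qed.

Let pd_g j f' : pd f j f' -> pd g j (fun k => - (1 / 2) * (g k * g k * g k) * f' k).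
Proof.
move=> pf k.
have s0 k' : 0 < Num.sqrt (f k') by rewrite sqrtr_gt0.
have gl : g (k + h *: dir j) @[h --> (0 : R)^'] --> g k by exact: line_cont.
have sl : Num.sqrt (f (k + h *: dir j)) @[h --> (0 : R)^'] --> Num.sqrt (f k).
  apply: (@line_cont _ (fun k => Num.sqrt (f k))).
  move=> k'; apply: continuous_comp; [exact: smooth_cont | exact: sqrt_continuous].
have m : (- ((g k * g (k + h *: dir j)) / (Num.sqrt (f k) + Num.sqrt (f (k + h *: dir j)))))
    @[h --> (0 : R)^'] --> - (1 / 2) * (g k * g k * g k).
  have -> : - (1 / 2) * (g k * g k * g k) = - ((g k * g k) / (Num.sqrt (f k) + Num.sqrt (f k))).
    rewrite /g; move: (Num.sqrt (f k)) (s0 k) => a a0.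
    have -> : a + a = 2 * a by ring.
    by field; rewrite gt_eqF.
  apply: cvgN; apply: cvgM; first by apply: cvgM => //; exact: cvg_cst.
  apply: cvgV; first by rewrite gt_eqF // addr_gt0.
  by apply: cvgD => //; exact: cvg_cst.
have H : (fun h : R =>
    - ((g k * g (k + h *: dir j)) / (Num.sqrt (f k) + Num.sqrt (f (k + h *: dir j)))) *
    (h^-1 * (f (k + h *: dir j) - f k))) @ (0 : R)^' --> - (1 / 2) * (g k * g k * g k) * f' k.
  exact: (cvgM m (pf k)).
apply: cvg_eq H => h.
have key (a b c : R) : 0 < a -> 0 < b ->
    c * (b^-1 - a^-1) = - ((a^-1 * b^-1) / (a + b)) * (c * (b ^+ 2 - a ^+ 2)).
  by move=> a0 b0; field; rewrite !gt_eqF // addr_gt0.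
have := key _ _ h^-1 (s0 k) (s0 (k + h *: dir j)).
by rewrite !sqr_sqrtr ?(ltW (fpos _)).
Qed.

(** The algebra generated by the smooth functions and [g = f^{-1/2}]; it is stable under derivation
    because the derivative of [g] is [- 1/2 g^3 f']. *)
Inductive isqS : (E -> R) -> Prop :=
| isq_smooth a : smooth a -> isqS a
| isq_g : isqS g
| isq_add a b : isqS a -> isqS b -> isqS (fun k => a k + b k)
| isq_mul a b : isqS a -> isqS b -> isqS (fun k => a k * b k).

Lemma smooth_isqrt : smooth (fun k => (Num.sqrt (f k))^-1).
Proof.
have Sc a : isqS a -> continuous a.
  elim=> [a0 /smooth_cont //|//|a0 b0 _ ca _ cb k|a0 b0 _ ca _ cb k].
    exact: (cvgD (ca k) (cb k)).
  exact: (cvgM (ca k) (cb k)).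
apply: (@smooth_class _ isqS) => //; first exact: isq_g.
move=> a j; elim=> [a0 sa||a0 b0 _ [a1 A1 p1] _ [b1 B1 q1]|a0 b0 A0 [a1 A1 p1] B0 [b1 B1 q1]].
- by have [a1 s1 p1] := smooth_pd j sa; exists a1 => //; exact: isq_smooth.
- have [f1 s1 p1] := smooth_pd j sf; eexists; last exact: pd_g p1.
  apply: isq_mul; last exact: isq_smooth.
  apply: isq_mul; first exact/isq_smooth/smooth_cst.
  by do 2?apply: isq_mul; exact: isq_g.
- by exists (fun k => a1 k + b1 k); [exact: isq_add | exact: pdD].
- exists (fun k => a1 k * b0 k + a0 k * b1 k).
    by apply: isq_add; exact: isq_mul.
  apply: (@pd_bil _ _ _ (fun a b : R => a * b) 1) => //; try exact: Sc.
  + by move=> *; rewrite mulrDl.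
  + by move=> *; rewrite mulrDr.
  + by move=> *; rewrite -mulrA.
  + by move=> c u v; rewrite mulrCA.
  + by move=> *; rewrite normrM mul1r.
Qed.

End InverseSqrt.

End Smooth.

(** * The flat function [exp (- 1/t)] and smooth bumps *)

Section Bump.
Variable R : realType.

(* The powers of [t^-1] make the family stable under derivation. *)
Definition ebump (n : nat) (t : R) : R := if 0 < t then t^-1 ^+ n * expR (- t^-1) else 0.

Lemma ebump_le0 n t : t <= 0 -> ebump n t = 0.
Proof. by move=> t0; rewrite /ebump ltNge t0. Qed.

Lemma ebump_gt0 n t : 0 < t -> 0 < ebump n t.
Proof. by move=> t0; rewrite /ebump t0 mulr_gt0 ?expR_gt0 // exprn_gt0 // invr_gt0. Qed.

Lemma ebump_ge0 n t : 0 <= ebump n t.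
Proof. by case: (leP t 0) => [/ebump_le0 ->|/(ebump_gt0 n)/ltW]. Qed.

(** The term of order [n + 1] in the exponential series at [1/t] gives
    [t^{-(n+1)} <= (n+1)! exp (1/t)]. *)
Lemma ebump_bound n (t : R) : 0 <= t -> `|ebump n t| <= n.+1`!%:R * t.
Proof.
rewrite le_eqVlt => /orP[/eqP <-|t0]; first by rewrite ebump_le0 // normr0 mulr0.
rewrite ger0_norm ?ebump_ge0 // /ebump t0.
have s0 : 0 < t^-1 by rewrite invr_gt0.
have f0 : 0 < n.+1`!%:R :> R by rewrite ltr0n fact_gt0.
have h : t^-1 ^+ n.+1 <= n.+1`!%:R * expR t^-1.
  have := expR_ge1Dxn n (ltW s0); move=> h.
  by rewrite mulrC -ler_pdivrMr //; apply: le_trans h; rewrite lerDr.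
rewrite expRN ler_pdivrMr ?expR_gt0 // -mulrA [t * _]mulrC mulrA.
by rewrite -ler_pdivrMr // -exprSr.
Qed.

Lemma ebump_derive n (t : R) :
  is_derive t 1 (ebump n) (ebump n.+2 t - n%:R * ebump n.+1 t).
Proof.
case: (ltgtP t 0) => t0.
- rewrite !ebump_le0 ?(ltW t0) // mulr0 subr0.
  apply: (@near_eq_is_derive _ _ _ (cst 0)).
  near=> x; rewrite ebump_le0 //=; apply: ltW; near: x; exact: lt_nbhsl.
- have tn : t != 0 by rewrite gt_eqF.
  have d1 : is_derive t 1 (fun x : R => x^-1) (- t ^- 2).
    by have := @is_deriveV _ id t 1 1 tn (is_derive_id _ _); rewrite /GRing.scale /= mulr1.
  have d2 : is_derive t 1 (fun x : R => - x^-1) (t ^- 2).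
    by have := is_deriveN d1; rewrite opprK.
  have d3 : is_derive t 1 (fun x : R => expR (- x^-1)) (expR (- t^-1) * t ^- 2).
    exact: (@is_derive1_comp _ expR (fun x : R => - x^-1)).
  have d4 := is_deriveM (is_deriveX n d1) d3.
  have d5 : is_derive t 1 ((fun x : R => x^-1) ^+ n * (fun x : R => expR (- x^-1)))
      (ebump n.+2 t - n%:R * ebump n.+1 t).
    apply: is_derive_eq d4 _; rewrite /ebump t0 /GRing.scale /= !exprfctE.
    case: n => [|n] /=.
      by rewrite !expr0 !mul0r mulr0 addr0 subr0 mul1r mulrC exprVn.
    by rewrite !exprS expr0 -natr1; field.
  apply: (near_eq_is_derive _ d5).
  near=> x; rewrite /ebump ifT; last by near: x; exact: lt_nbhsr.
  by rewrite /GRing.mul /= exprfctE.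
- rewrite t0 !ebump_le0 // mulr0 subr0.
  (* The difference quotient of [ebump n] at 0 is [ebump n.+1], which tends to 0 by
     [ebump_bound]. *)
  apply/is_derive1_caratheodory; exists (ebump n.+1); split; last by rewrite ebump_le0.
    move=> z; rewrite (@ebump_le0 n 0) // !subr0; case: (leP z 0) => z0.
      by rewrite !ebump_le0 // mul0r.
    by rewrite /ebump z0 exprSr -!mulrA mulrCA mulrA [_ * z]mulrC; field; rewrite gt_eqF.
  apply/cvgrPdist_le => e e0; rewrite ebump_le0 //.
  have f0 : 0 < n.+2`!%:R :> R by rewrite ltr0n fact_gt0.
  near=> x; rewrite sub0r normrN; case: (leP x 0) => x0; first by rewrite ebump_le0 // normr0 ltW.
  apply: le_trans (ebump_bound _ (ltW x0)) _.
  rewrite mulrC -ler_pdivlMr //; apply: le_trans (ler_norm _) _.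
  near: x; apply/nbhs_ballP; exists (e / n.+2`!%:R) => /=; first by rewrite divr_gt0.
  by move=> x; rewrite /ball /= sub0r normrN => /ltW.
Unshelve. all: by end_near. Qed.

Lemma ebump_cont n : continuous (ebump n).
Proof.
move=> t; apply: differentiable_continuous; apply/derivable1_diffP.
by have [] := ebump_derive n t.
Qed.

End Bump.

Section SmoothBump.
Variables (R : realType) (E : normedModType R) (d : nat) (dir : 'I_d -> E).
Variables (l : E -> R) (a : 'I_d -> R).
Hypothesis lc : continuous l.
Hypothesis ldir : forall k (h : R) j, l (k + h *: dir j) = l k + h * a j.

Lemma pd_ebump n j : pd dir (fun k => ebump n (l k)) j
  (fun k => a j * (ebump n.+2 (l k) - n%:R * ebump n.+1 (l k))).
Proof.
move=> k; pose G (h : R) := ebump n (l k + h * a j).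
have d1 : is_derive (0 : R) 1 (fun h : R => l k + h * a j) (a j).
  apply/is_derive1_caratheodory; exists (cst (a j)); split=> //.
    by move=> z; rewrite /= mul0r addr0 subr0 addrC addKr mulrC.
  exact: cst_continuous.
have dG : is_derive (0 : R) 1 G ((ebump n.+2 (l k) - n%:R * ebump n.+1 (l k)) * a j).
  apply: (@is_derive1_comp _ (ebump n) (fun h : R => l k + h * a j)) => //.
  by rewrite mul0r addr0; exact: ebump_derive.
rewrite mulrC; have [/cvg_ex[/= L HL] <-] := dG.
have -> : 'D_1 G 0 = L by apply: (cvg_lim _ HL).
apply: cvg_eq HL => h; rewrite /G /= ldir mul0r !addr0 [h *: 1]mulr1 //.
Qed.

Inductive bumpS : (E -> R) -> Prop :=
| bump_e n : bumpS (fun k => ebump n (l k))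
| bump_add f g : bumpS f -> bumpS g -> bumpS (fun k => f k + g k)
| bump_scl (b : R) f : bumpS f -> bumpS (fun k => b * f k).

Lemma smooth_ebump n : smooth dir (fun k => ebump n (l k)).
Proof.
apply: (@smooth_class _ _ _ _ _ bumpS); first exact: bump_e.
  move=> f; elim=> [m|f0 g0 _ c1 _ c2 k|b f0 _ c1 k].
  - by move=> k; apply: continuous_comp; [exact: lc | exact: ebump_cont].
  - exact: (cvgD (c1 k) (c2 k)).
  - exact: (cvgM (cvg_cst b) (c1 k)).
move=> f j; elim=> [m|f0 g0 _ [f1 S1 p1] _ [g1 S2 p2]|b f0 _ [f1 S1 p1]].
- eexists; last exact: pd_ebump.
  under eq_fun do rewrite mulrBr mulrA -mulNr.
  by apply: bump_add; apply: bump_scl; exact: bump_e.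
- by exists (fun k => f1 k + g1 k); [exact: bump_add | exact: pdD].
- exists (fun k => b * f1 k); first exact: bump_scl.
  move=> k; apply: cvg_eq (cvgM (cvg_cst b) (p1 k)) => h.
  by rewrite /= /GRing.scale /= -mulrBr mulrCA.
Qed.

End SmoothBump.

Lemma continuousP_norm (R : realType) (E V : normedModType R) (f : E -> V) :
  continuous f <-> forall k (eps : R), 0 < eps -> exists2 delta : R, 0 < delta &
    forall k', `|k' - k| < delta -> `|f k' - f k| <= eps.
Proof.
split=> H k.
  move=> eps e0; have /cvgrPdist_le/(_ _ e0)/nbhs_ballP[de de0 Hd] := H k.
  exists de => // k' hk; rewrite distrC; apply: Hd.
  by rewrite -ball_normE /ball_ /= distrC.
apply/cvgrPdist_le => eps e0; have [de de0 Hd] := H k eps e0.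
apply/nbhs_ballP; exists de => // k'; rewrite -ball_normE /ball_ /= => hk.
by rewrite distrC; apply: Hd; rewrite distrC.
Qed.

(** * From continuous derivatives to global Lipschitz bounds *)

Section C1Lip.
Variables (R : realType) (V : normedModType R) (rip : V -> V -> R) (J : V -> V).
Hypothesis C : cplx rip J.

Lemma rip_is_derive (w : V) (phi : R -> V) (t : R) (l : V) :
  (h^-1 *: (phi (t + h) - phi t)) @[h --> (0 : R)^'] --> l ->
  is_derive t 1 (fun s => rip w (phi s)) (rip w l).
Proof.
move=> H.
have H2 : (fun h : R => rip w (h^-1 *: (phi (t + h) - phi t))) @ (0 : R)^' --> rip w l.
  apply: (@cvg_bil _ _ _ _ rip 1) => //.
  - by move=> *; rewrite (ripDl C).
  - by move=> *; rewrite (ripDr C).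
  - by move=> *; rewrite (ripZl C).
  - by move=> *; rewrite (ripZr C).
  - by move=> *; rewrite mul1r (rip_le C).
  - exact: cvg_cst.
have H3 : (fun h : R => h^-1 *: (((fun s => rip w (phi s)) \o shift t) (h *: 1) - rip w (phi t)))
    @ (0 : R)^' --> rip w l.
  apply: cvg_eq H2 => h /=; by rewrite (ripZr C) (ripBr C) [h *: 1]mulr1 [h + t]addrC.
by apply: DeriveDef; [apply/cvg_ex; exists (rip w l) | exact: cvg_lim H3].
Qed.

(** Pairing with [w = phi a - phi b] reduces the vector-valued statement to the real mean value
    theorem; one factor [|w|] then cancels. *)
Lemma norm_le_of_deriv (phi dphi : R -> V) (a b M : R) :
  (forall t, (h^-1 *: (phi (t + h) - phi t)) @[h --> (0 : R)^'] --> dphi t) ->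
  (forall t, Num.min a b <= t <= Num.max a b -> `|dphi t| <= M) ->
  `|phi a - phi b| <= M * `|a - b|.
Proof.
move=> H HM; set w := phi a - phi b.
have [w0|w0] := eqVneq w 0.
  have M0 : 0 <= M.
    by apply: le_trans (normr_ge0 (dphi a)) (HM a _); rewrite ge_min le_max lexx.
  by rewrite w0 normr0 mulr_ge0.
have wp : 0 < `|w| by rewrite normr_gt0.
have := @MVT_Lip R (fun s => rip w (phi s)) (fun s => rip w (dphi s))
   (Num.min a b) (Num.max a b) (`|w| * M) _ _ a b.
have -> : rip w (phi a) - rip w (phi b) = `|w| * `|w| by rewrite -(ripBr C) (rip_norm C) expr2.
rewrite normrM !normr_id -mulrA ler_pM2l //; apply.
- by move=> x _; exact: rip_is_derive.
- by move=> x hx; apply: le_trans (rip_le C _ _) _; rewrite ler_pM2l // HM.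
- by rewrite ge_min le_max lexx.
- by rewrite ge_min le_max lexx !orbT.
Qed.

Variable d : nat.
Let dir (j : 'I_d) : 'rV[R]_d := delta_mx 0 j.

(** Coordinates are changed from [k] to [k'] one at a time. The intermediate points stay in the ball
    because it is a cube, and each of the [d] moves costs at most [M |k - k'|]. *)
Lemma box_Lip (f : 'rV[R]_d -> V) (g : 'I_d -> 'rV[R]_d -> V) (k0 : 'rV[R]_d) (del M : R) :
  0 < del -> (forall j, pd dir f j (g j)) ->
  (forall j k, `|k - k0| < del -> `|g j k| <= M) ->
  forall k k', `|k - k0| < del -> `|k' - k0| < del -> `|f k - f k'| <= d%:R * M * `|k - k'|.
Proof.
move=> del0 Hpd HM k k' hk hk'.
pose p (i : nat) : 'rV[R]_d := \row_j (if (j < i)%N then k' 0 j else k 0 j).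
have p0 : p 0%N = k by apply/rowP => j; rewrite mxE.
have pd' : p d = k' by apply/rowP => j; rewrite mxE ltn_ord.
suff H n : (n <= d)%N -> `|f k - f (p n)| <= n%:R * M * `|k - k'|.
  by have := H d (leqnn d); rewrite pd'.
elim: n => [|n IH] nd; first by rewrite p0 subrr normr0 !mul0r.
pose i : 'I_d := Ordinal nd; pose T := k' 0 i - k 0 i.
have pS (t : R) (j : 'I_d) : (p n + t *: dir i) 0 j =
   if (j < n)%N then k' 0 j else if j == i then k 0 j + t else k 0 j.
  rewrite !mxE eqxx /=; case: ltnP => jn.
    have -> : (j == i) = false by apply/eqP => e; move: jn; rewrite e ltnn.
    by rewrite mulr0 addr0.
  by case: (j == i); rewrite ?mulr1 ?mulr0 ?addr0.
have pE : p n.+1 = p n + T *: dir i.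
  apply/rowP => j; rewrite pS mxE ltnS leq_eqVlt; case: ltnP => jn; first by rewrite orbT.
  rewrite orbF -val_eqE /=; case: ifP => // /eqP ji.
  have -> : j = i by apply/val_inj.
  by rewrite /T addrC subrK.
rewrite -natr1 mulrDl mul1r mulrDl.
have -> : f k - f (p n.+1) = (f k - f (p n)) + (f (p n) - f (p n.+1)) by rewrite addrA subrK.
apply: le_trans (ler_normD _ _) _; apply: lerD; first exact/IH/ltnW.
have -> : p n = p n + 0 *: dir i by rewrite scale0r addr0.
rewrite [p n.+1]pE.
have h := @norm_le_of_deriv (fun t => f (p n + t *: dir i)) (fun t => g i (p n + t *: dir i)) 0 T M.
apply: le_trans (h _ _) _.
- move=> t; apply: cvg_eq (Hpd i (p n + t *: dir i)) => h'.
  by rewrite scalerDl addrA.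
- move=> t ht; apply: HM; apply/norm_ltP => // j; rewrite mxE pS mxE.
  have := le_lt_trans (coord_le _ j) hk; have := le_lt_trans (coord_le _ j) hk'.
  rewrite !mxE => h1 h2; case: ifP => // _; case: eqP => // ji.
  rewrite ji in h1 h2 *; have eT : T = k' 0 i - k 0 i by [].
  move: h1 h2; rewrite !ltr_norml => /andP[a1 a2] /andP[a3 a4].
  case/andP: ht; rewrite ge_min le_max => /orP ht1 /orP ht2.
  by apply/andP; split; case: ht1 => ?; case: ht2 => ?; lra.
- have M0 : 0 <= M by apply: le_trans (normr_ge0 (g i k)) (HM i k hk).
  rewrite ler_wpM2l // sub0r normrN distrC.
  by have := coord_le (k - k') i; rewrite !mxE.
Qed.

End C1Lip.

Section Uniform.
Variables (R : realType) (d : nat) (Q : R -> 'rV[R]_d -> 'rV[R]_d -> Prop).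
Hypothesis Qmono : forall c c' x y, c <= c' -> Q c x y -> Q c' x y.
Hypothesis Qinv : forall c x y z, Q c x y -> Q c (x + zr R z) (y + zr R z).
Variable cb : R.
Hypothesis cb0 : 0 <= cb.
Hypothesis Qbd : forall x y, Q cb x y.
Hypothesis Qloc : forall x0, exists2 del : R, 0 < del & exists2 M : R, 0 <= M &
  forall x y, `|x - x0| < del -> `|y - x0| < del -> Q (M * `|x - y|) x y.

(** [Q c x y] abstracts a bound by [c] on the change between [x] and [y]. Keeping it a relation
    allows a bound that holds simultaneously for a whole family of maps, such as [P k v] for all
    [v]. *)
Lemma uniform_Lip : exists2 L : R, 0 <= L & forall x y, Q (L * `|x - y|) x y.
Proof.
pose K := [set v : 'rV[R]_d | forall i, `[(-1 : R), 1]%classic (v ord0 i)].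
have Kc : compact K.
  by apply: (@rV_compact R^o _ (fun=> `[(-1 : R), 1]%classic)) => _; exact: segment_compact.
(* One index governs both the radius [1/(n+1)] and the slope [n+1], so compactness of the cube
   yields a single [N] for both. *)
pose Pn (n : nat) (x : 'rV[R]_d) := forall y, `|x - y| < n.+1%:R^-1 -> Q (n.+1%:R * `|x - y|) x y.
have /compact_near_coveringP/(_ nat \oo Pn _) := Kc.
move=> H.
have /H [N _ HN] : forall x, K x -> \forall x' \near x & i \near \oo, Pn i x'.
  move=> x0 _; have [del del0 [M M0 HM]] := Qloc x0.
  have [N hN] := nat_above (2 / del + M).
  exists ([set x | `|x - x0| < del / 2], [set n | (N <= n)%N]) => /=.
    split; last by exists N.
    apply/nbhs_ballP; exists (del / 2) => /=; first by rewrite divr_gt0.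
    by move=> y; rewrite mx_norm_ball /ball_ /= distrC.
  move=> [x n] /= [hx hn] y xy.
  have n0 : 0 < n.+1%:R :> R by rewrite ltr0n.
  have Nn : N.+1%:R <= n.+1%:R :> R by rewrite ler_nat ltnS.
  have d2 : 0 < 2 / del by rewrite divr_gt0.
  have h1 : n.+1%:R^-1 <= del / 2.
    rewrite -[del / 2]invrK lef_pV2 ?posrE ?invr_gt0 ?divr_gt0 // invf_div; lra.
  apply: (@Qmono (M * `|x - y|)); first by rewrite ler_wpM2r //; lra.
  apply: HM; first by apply: lt_trans hx _; lra.
  have -> : y - x0 = (x - x0) - (x - y) by rewrite opprB [RHS]addrC addrA subrK.
  apply: le_lt_trans (ler_normB _ _) _.
  by apply: lt_le_trans (ltrD hx (lt_le_trans xy h1)) _; lra.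
have HK x : K x -> Pn N x by move=> Kx; exact: (HN N (leqnn N) x Kx).
have n0 : 0 < N.+1%:R :> R by rewrite ltr0n.
(* The factor [cb + 1] serves the distant pairs: when [|x - y| >= 1/(N+1)] the right-hand side
   exceeds the trivial bound [cb]. *)
exists (N.+1%:R * (cb + 1)); first by rewrite mulr_ge0 ?addr_ge0 // ltW.
move=> x y.
have [xy|xy] := ltP `|x - y| N.+1%:R^-1.
  rewrite -[x](subrK (zr R (rdv x))) -[y](subrK (zr R (rdv x))).
  have -> : x - zr R (rdv x) + zr R (rdv x) - (y - zr R (rdv x) + zr R (rdv x)) = x - y.
    by rewrite !subrK.
  apply: Qinv.
  have e : x - zr R (rdv x) - (y - zr R (rdv x)) = x - y by rewrite opprB addrA subrK.
  have := HK (x - zr R (rdv x)) _ (y - zr R (rdv x)); rewrite e => H'.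
  apply: Qmono (H' _ xy); first by rewrite ler_wpM2r // ler_peMr ?(ltW n0) //; have := cb0; lra.
  move=> i; have := le_trans (coord_le _ i) (rdv_le x) => h /=; rewrite in_itv /= -ler_norml.
  by apply: le_trans h _; lra.
apply: Qmono (Qbd x y).
have h : 1 <= N.+1%:R * `|x - y|.
  by have := ler_wpM2l (ltW n0) xy; rewrite divff ?gt_eqF.
have h' := cb0; have c1 : 0 <= cb + 1 by lra.
by rewrite mulrAC [leRHS]mulrC; have := ler_peMr c1 h; lra.
Qed.

End Uniform.

(** * Averaging a section over a grid with smooth weights *)

Section Weight.
Variables (R : realType) (d N : nat).
Hypothesis N0 : (0 < N)%N.
Implicit Types y : 'rV[R]_d.

Definition weight y : R :=
  \prod_i (ebump 0 (1 + N%:R * y 0 i) * ebump 0 (1 - N%:R * y 0 i)).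

Let NR : 0 < N%:R :> R. Proof. by rewrite ltr0n. Qed.

Lemma weight_ge0 y : 0 <= weight y.
Proof. by apply: prodr_ge0 => i _; rewrite mulr_ge0 ?ebump_ge0. Qed.

Lemma weight_gt0 y : `|y| < N%:R^-1 -> 0 < weight y.
Proof.
move=> yN; apply: prodr_gt0 => i _.
have := le_lt_trans (coord_le y i) yN; rewrite -[X in _ < X]mul1r ltr_pdivlMr // => h.
have : `|N%:R * y 0 i| < 1 by rewrite normrM mulrC (gtr0_norm NR).
by rewrite ltr_norml => /andP[h1 h2]; rewrite mulr_gt0 // ebump_gt0; lra.
Qed.

Lemma weight_eq0 y : N%:R^-1 <= `|y| -> weight y = 0.
Proof.
move=> yN; have i0 : 0 < N%:R^-1 :> R by rewrite invr_gt0.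
have [i hi] : exists i, N%:R^-1 <= `|y 0 i|.
  apply: contrapT => H; move: yN; rewrite leNgt => /negP; apply.
  by apply/norm_ltP => // i; rewrite ltNge; apply/negP => h; apply: H; exists i.
rewrite /weight (bigD1 i) //=.
have : 1 <= `|N%:R * y 0 i|.
  by rewrite normrM (gtr0_norm NR); have := ler_wpM2l (ltW NR) hi; rewrite divff ?gt_eqF.
case: (leP 0 (N%:R * y 0 i)) => h; [rewrite (ger0_norm h) | rewrite (ltr0_norm h)] => h1.
  by rewrite (@ebump_le0 _ 0 (1 - N%:R * y 0 i)) ?mulr0 ?mul0r //; lra.
by rewrite (@ebump_le0 _ 0 (1 + N%:R * y 0 i)) ?mul0r //; lra.
Qed.

End Weight.

Section CoordSmooth.
Variables (R : realType) (d : nat) (Bi : 'M[R]_d).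

Lemma mulmx_Lip : Lip (fun k : 'rV[R]_d => k *m Bi).
Proof.
exists (\sum_i \sum_j `|Bi j i|); first by apply: sumr_ge0 => i _; apply: sumr_ge0.
move=> k k'; rewrite -mulmxBl; apply/norm_leP => [|i].
  by rewrite mulr_ge0 // sumr_ge0 // => i _; apply: sumr_ge0.
apply: (@le_trans _ _ ((\sum_j `|Bi j i|) * `|k - k'|)); last first.
  apply: ler_wpM2r => //; rewrite [leRHS](bigD1 i) //= lerDl.
  by apply: sumr_ge0 => i' _; apply: sumr_ge0.
rewrite mxE; apply: le_trans (ler_norm_sum _ _ _) _; rewrite mulr_suml; apply: ler_sum => j _.
by rewrite normrM mulrC ler_wpM2l // coord_le.
Qed.

Lemma coord_cont (i : 'I_d) : continuous (fun k : 'rV[R]_d => (k *m Bi) 0 i).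
Proof.
apply/continuousP_norm => k eps e0; pose s := \sum_j `|Bi j i|.
have s0 : 0 <= s by apply: sumr_ge0.
have s1 : 0 < s + 1 by lra.
exists (eps / (s + 1)); first by rewrite divr_gt0.
move=> k' hk.
have -> : (k' *m Bi) 0 i - (k *m Bi) 0 i = ((k' - k) *m Bi) 0 i by rewrite mulmxBl !mxE.
rewrite mxE; apply: le_trans (ler_norm_sum _ _ _) _.
apply: (@le_trans _ _ (`|k' - k| * s)).
  rewrite /s mulr_sumr; apply: ler_sum => j _; rewrite normrM ler_wpM2r //.
  exact: coord_le.
have := ltW hk; rewrite ler_pdivlMr // => h.
by apply: le_trans h; rewrite ler_wpM2l // lerDl.
Qed.

Lemma smooth_ebump_coord (a0 a1 : R) (i : 'I_d) :
  smooth (@e_dir R d) (fun k => ebump 0 (a0 + a1 * (k *m Bi) 0 i)).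
Proof.
apply: (smooth_ebump (l := fun k => a0 + a1 * (k *m Bi) 0 i) (a := fun j => a1 * Bi j i)).
  by move=> k; exact: (cvgD (cvg_cst a0) (cvgM (cvg_cst a1) (@coord_cont i k))).
by move=> k h j; rewrite mulmxDl -scalemxAl /e_dir -rowE !mxE; ring.
Qed.

Lemma smooth_weight N (sgn : R) (c : 'rV[R]_d) :
  smooth (@e_dir R d) (fun k => weight N (sgn *: (k *m Bi) - c)).
Proof.
have cE (k : 'rV[R]_d) i : (sgn *: (k *m Bi) - c) 0 i = sgn * (k *m Bi) 0 i - c 0 i.
  by rewrite !mxE.
apply: smooth_prod => i; apply: smoothM.
- have -> : (fun k : 'rV[R]_d => ebump 0 (1 + N%:R * (sgn *: (k *m Bi) - c) 0 i)) =
      (fun k => ebump 0 ((1 - N%:R * c 0 i) + (N%:R * sgn) * (k *m Bi) 0 i)).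
    by apply/funext => k; rewrite cE; congr ebump; ring.
  exact: smooth_ebump_coord.
- have -> : (fun k : 'rV[R]_d => ebump 0 (1 - N%:R * (sgn *: (k *m Bi) - c) 0 i)) =
      (fun k => ebump 0 ((1 + N%:R * c 0 i) + (- (N%:R * sgn)) * (k *m Bi) 0 i)).
    by apply/funext => k; rewrite cE; congr ebump; ring.
  exact: smooth_ebump_coord.
Qed.

End CoordSmooth.

Section Smoothing.
Variables (R : realType) (V : normedModType R) (rip : V -> V -> R) (J : V -> V).
Hypothesis C : cplx rip J.
Variables (d : nat) (B : 'M[R]_d).
Hypothesis Bu : B \in unitmx.
Variables (P : 'rV[R]_d -> V -> V) (tau : 'rV[int]_d -> V -> V) (Th : V -> V).
Hypothesis S : bsys J (fun x => P (x *m B)) tau Th.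
Hypothesis sP : forall v, smooth (@e_dir R d) (fun k => P k v).
Variable u : 'rV[R]_d -> V.
Hypothesis us : bsection (fun x => P (x *m B)) tau Th u.
Variable c : R.
Hypothesis c0 : 0 < c.
Hypothesis uc : forall x, c <= `|u x|.

Let Bi := invmx B.
Let xB (k : 'rV[R]_d) : (k *m Bi) *m B = k. Proof. by rewrite mulmxKV. Qed.

Section Grid.
Variable N : nat.
Hypothesis N4 : (4 <= N)%N.
Let N0 : (0 < N)%N. Proof. exact: leq_trans N4. Qed.
Let NR : 0 < N%:R :> R. Proof. by rewrite ltr0n. Qed.
Let Ni4 : N%:R^-1 <= 1 / 4 :> R.
Proof. by rewrite div1r lef_pV2 ?posrE // ler_nat. Qed.

(** The value at the grid point [g], carried to the copy of [g] near [x] and weighted by a bump of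
    radius [1/N]. *)
Let W1 (g x : 'rV[R]_d) : V :=
  weight N (x - g - zr R (rdv (x - g))) *: tau (rdv (x - g)) (u g).

Let W1_tau g x z : W1 g (x + zr R z) = tau z (W1 g x).
Proof.
rewrite /W1 (_ : x + zr R z - g = (x - g) + zr R z); last by rewrite addrAC.
rewrite rdvD zrD opprD addrACA subrr addr0.
by rewrite [rdv _ + z]addrC (tauD S) (rlinZ (isomL (taui S _))).
Qed.

(** Around [x0] the rounding may be frozen: as [1/N <= 1/4] and [1/4 + 1/8 < 1/2], a point near [x0]
    with another nearest lattice point has weight zero with either rounding. *)
Let W1_local g x0 x : `|x - x0| <= 1 / 8 ->
  W1 g x = weight N (x - (g + zr R (rdv (x0 - g)))) *: tau (rdv (x0 - g)) (u g).
Proof.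
move=> xx; rewrite opprD addrA; have hN := Ni4.
have [e|ne] := eqVneq (rdv (x - g)) (rdv (x0 - g)); first by rewrite /W1 e.
have far (a b : 'rV[R]_d) : `|a - b| <= 1 / 8 -> rdv (a - g) != rdv (b - g) ->
    weight N (a - g - zr R (rdv (b - g))) = 0 /\ weight N (b - g - zr R (rdv (b - g))) = 0.
  move=> ab nab; split; apply: weight_eq0 => //; rewrite leNgt; apply/negP => lt;
    move/eqP: nab; apply.
    by apply: rdv_small; apply: lt_trans lt _; lra.
  apply: rdv_small.
  have -> : a - g - zr R (rdv (b - g)) = (b - g - zr R (rdv (b - g))) + (a - b).
    by apply/rowP => i; rewrite !mxE; ring.
  apply: le_lt_trans (ler_normD _ _) _; apply: lt_le_trans (ltr_leD lt ab) _; lra.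
have [-> _] := far x x0 xx ne.
have h1 : `|x0 - x| <= 1 / 8 by rewrite distrC.
have h2 : rdv (x0 - g) != rdv (x - g) by rewrite eq_sym.
rewrite /W1; have [_ ->] := far _ _ h1 h2.
by rewrite !scale0r.
Qed.

Variable L : R.
Hypothesis L0 : 0 <= L.
Hypothesis uL : forall x y, `|u x - u y| <= L * `|x - y|.

Let wt (g x : 'rV[R]_d) : R := weight N (x - g - zr R (rdv (x - g))).

Let W1_near g x : `|W1 g x - wt g x *: u x| <= wt g x * (L / N%:R).
Proof.
rewrite /W1 -/(wt g x) -(sectau us) -scalerBr normrZ (ger0_norm (weight_ge0 _ _)).
have [yN|yN] := leP N%:R^-1 `|x - g - zr R (rdv (x - g))|.
  by rewrite /wt (weight_eq0 N0 yN) !mul0r.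
apply: ler_wpM2l; first exact: weight_ge0.
apply: le_trans (uL _ _) _; apply: ler_wpM2l => //.
have -> : g + zr R (rdv (x - g)) - x = - (x - g - zr R (rdv (x - g))).
  by apply/rowP => i; rewrite !mxE; ring.
by rewrite normrN ltW.
Qed.

Let G (f : {ffun 'I_d -> 'I_N}) : 'rV[R]_d := \row_i ((f i)%:R / N%:R).
(** The sum is not divided by the total weight [Sw], since the section is normalised at the end
    anyway. *)
Let W x := \sum_f W1 (G f) x.
Let Sw x := \sum_f wt (G f) x.

Let W_tau x z : W (x + zr R z) = tau z (W x).
Proof.
rewrite /W; have TL := isomL (taui S z).
elim/big_ind2: _ => [|a b a' b' -> ->|f _]; first by rewrite (rlin0 TL).
  by rewrite (rlinD TL).
exact: W1_tau.
Qed.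

Let W_near x : `|W x - Sw x *: u x| <= Sw x * (L / N%:R).
Proof.
rewrite /W /Sw scaler_suml -sumrB mulr_suml; apply: le_trans (ler_norm_sum _ _ _) _.
by apply: ler_sum => f _; exact: W1_near.
Qed.

(** Rounding [N x] to an integer vector and dividing it by [N] with remainder gives a lattice
    translate of a grid point within [1 / (2 N)] of [x], where the weight is positive. *)
Let Sw_gt0 x : 0 < Sw x.
Proof.
have [n hn] : exists n, `|N%:R *: x - zr R n| <= 1 / 2.
  by exists (rdv (N%:R *: x)); exact: rdv_le.
have fN (i : 'I_d) : (absz (modz (n 0%R i) N) < N)%N.
  have Nz : N%:Z != 0 by rewrite -lt0n.
  by have := modz_ge0 (n 0 i) Nz; have := ltz_pmod (n 0 i) (d := N%:Z); lia.
pose f : {ffun 'I_d -> 'I_N} := [ffun i => Ordinal (fN i)].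
pose q : 'rV[int]_d := \row_i (divz (n 0 i) N).
have e : x - G f - zr R q = N%:R^-1 *: (N%:R *: x - zr R n).
  apply/rowP => i; rewrite !mxE ffunE /=.
  have Nz : N%:Z != 0 by rewrite -lt0n.
  have -> : (absz (modz (n 0 i) N))%:R = (modz (n 0 i) N)%:~R :> R.
    by rewrite -[in RHS](gez0_abs (modz_ge0 _ Nz)).
  have -> : (n 0 i)%:~R = (divz (n 0 i) N)%:~R * N%:R + (modz (n 0 i) N)%:~R :> R.
    by rewrite {1}(divz_eq (n 0 i) N) rmorphD rmorphM /=.
  by field; rewrite gt_eqF.
have h : `|x - G f - zr R q| <= N%:R^-1 * (1 / 2).
  rewrite e normrZ ger0_norm ?invr_ge0 ?ler0n //; by apply: ler_wpM2l.
have i0 : 0 < N%:R^-1 :> R by rewrite invr_gt0.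
have hN := Ni4.
have qE : rdv (x - G f) = q by apply: rdv_small; apply: le_lt_trans h _; lra.
rewrite /Sw (bigD1 f) //=; apply: ltr_pwDl; last first.
  by apply: sumr_ge0 => f' _; exact: weight_ge0.
by rewrite /wt qE; apply: weight_gt0 => //; apply: le_lt_trans h _; lra.
Qed.

Let phi (k : 'rV[R]_d) := P k (W (k *m Bi) + Th (W (- (k *m Bi)))).

Let Pl k : rlin (P k). Proof. by have := Plin S (k *m Bi); rewrite xB. Qed.

(** Only finitely many constant vectors [u (G f)] occur, so [u] itself is never differentiated:
    locally each term is a smooth weight times [P k] applied to a fixed vector. *)
Let phi_smooth : smooth (@e_dir R d) phi.
Proof.
have -> : phi = (fun k => \sum_f (P k (W1 (G f) (k *m Bi)) + P k (Th (W1 (G f) (- (k *m Bi)))))).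
  apply/funext => k; rewrite /phi (rlinD (Pl k)) big_split /=; have ThL := isomL (Thi S).
  rewrite /W; congr (_ + _).
    by elim/big_ind2: _ => [|a b a' b' <- <-|//]; rewrite ?(rlin0 (Pl k)) // (rlinD (Pl k)).
  elim/big_ind2: _ => [|a b a' b' <- <-|//]; first by rewrite (rlin0 ThL) (rlin0 (Pl k)).
  by rewrite (rlinD ThL) (rlinD (Pl k)).
have near_x (k0 : 'rV[R]_d) : \forall k \near k0, `|k *m Bi - k0 *m Bi| <= 1 / 8.
  have [M M0 HM] := mulmx_Lip Bi; have M1 : 0 < M + 1 by lra.
  apply/nbhs_ballP; exists (1 / 8 / (M + 1)) => /=; first by rewrite !divr_gt0.
  move=> k; rewrite mx_norm_ball /ball_ /= distrC ltr_pdivlMr // => h.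
  apply: le_trans (HM _ _) _; apply: le_trans (ltW h); rewrite mulrC ler_wpM2l // lerDl //.
apply: smooth_sum => f; apply: smoothD; apply: smooth_local => k0.
- exists (fun k => weight N (1 *: (k *m Bi) - (G f + zr R (rdv (k0 *m Bi - G f)))) *:
      P k (tau (rdv (k0 *m Bi - G f)) (u (G f)))).
    by apply: smooth_scale => //; exact: smooth_weight.
  have := near_x k0; apply: filterS => k hk.
  by rewrite (W1_local _ hk) (rlinZ (Pl k)) scale1r.
- exists (fun k => weight N ((-1) *: (k *m Bi) - (G f + zr R (rdv (- (k0 *m Bi) - G f)))) *:
      P k (Th (tau (rdv (- (k0 *m Bi) - G f)) (u (G f))))).
    by apply: smooth_scale => //; exact: smooth_weight.
  have := near_x k0; apply: filterS => k hk.
  rewrite (@W1_local _ (- (k0 *m Bi))); last by rewrite -opprD normrN.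
  by rewrite (rlinZ (isomL (Thi S))) (rlinZ (Pl k)) scaleN1r.
Qed.

(** Symmetry of [u] makes both halves of the average close to multiples of [u x], so [phi k] differs
    from [s u x] by at most [s L / N], while [s u x] has norm at least [s c]. *)
Let phi_near k : L / N%:R < c -> phi k != 0.
Proof.
move=> hL; set x := k *m Bi; set s := Sw x + Sw (- x).
have s0 : 0 < s by rewrite addr_gt0.
have Pu : P k (u x) = u x by have := secP us x; rewrite /x xB.
have h : `|phi k - s *: u x| <= s * (L / N%:R).
  have -> : phi k - s *: u x = P k ((W x - Sw x *: u x) + Th (W (- x) - Sw (- x) *: u (- x))).
    rewrite /phi -/x (rlinB (isomL (Thi S))) (rlinZ (isomL (Thi S))) (secTh us) (ThTh S).
    by rewrite addrACA -opprD -scalerDl (rlinB (Pl k)) (rlinZ (Pl k)) Pu.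
  have Pn : forall v, `|P k v| <= `|v| by move=> v; have := Pnorm S x v; rewrite /x xB.
  apply: le_trans (Pn _) _; apply: le_trans (ler_normD _ _) _.
  rewrite (isomN (Thi S)) /s mulrDl; apply: lerD; exact: W_near.
apply/eqP => p0; move: h; rewrite p0 sub0r normrN normrZ (gtr0_norm s0) ler_pM2l // => h.
by have := le_lt_trans (le_trans (uc x) h) hL; rewrite ltxx.
Qed.

Let phi_props : [/\ forall k, P k (phi k) = phi k,
   forall k z, phi (k + zr R z *m B) = tau z (phi k) & forall k, phi (- k) = Th (phi k)].
Proof.
split.
- by move=> k; have := PP S (k *m Bi); rewrite xB => H; rewrite /phi H.
- move=> k z; rewrite /phi mulmxDl mulmxK // opprD -zrN !W_tau (Thtau S) opprK.
  rewrite -(rlinD (isomL (taui S _))).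
  by have := Ptau S (k *m Bi) z; rewrite mulmxDl xB => H; rewrite H.
- move=> k; rewrite /phi mulNmx opprK.
  have := PTh S (k *m Bi); rewrite mulNmx xB => H; rewrite -H (rlinD (isomL (Thi S))) (ThTh S).
  by congr (P _ _); rewrite addrC.
Qed.

Lemma grid_section : L / N%:R < c -> exists phi : 'rV[R]_d -> V,
  [/\ smooth (@e_dir R d) phi, forall k, phi k != 0, forall k, P k (phi k) = phi k,
   forall k z, phi (k + zr R z *m B) = tau z (phi k) & forall k, phi (- k) = Th (phi k)].
Proof.
move=> hL; exists phi; have [h1 h2 h3] := phi_props; split=> // k; exact: phi_near.
Qed.

End Grid.

Lemma smooth_unit_section : exists phi : 'rV[R]_d -> V,
  [/\ smooth (@e_dir R d) phi, forall k, `|phi k| = 1, forall k, P k (phi k) = phi k,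
   forall k z, phi (k + zr R z *m B) = tau z (phi k) & forall k, phi (- k) = Th (phi k)].
Proof.
(* The two terms yield [4 <= N] and [L / N < c] for [N = M + 1]. *)
have [L L0 HL] := secL us; have [M hM] := nat_above (4 + L / c).
have hc := c0; have Lc : 0 <= L / c by rewrite divr_ge0 // ltW.
have M4 : (4 <= M.+1)%N.
  by rewrite -(ler_nat R); apply: ltW; apply: le_lt_trans hM; lra.
have M0 : 0 < M.+1%:R :> R by rewrite ltr0n.
have hL : L / M.+1%:R < c.
  by rewrite ltr_pdivrMr // mulrC -ltr_pdivrMr //; lra.
have [phi [h1 h2 h3 h4 h5]] := grid_section M4 L0 HL hL.
have rp k : 0 < rip (phi k) (phi k) by rewrite (rip_norm C) exprn_gt0 // normr_gt0.
have nE k : nrm (phi k) = (Num.sqrt (rip (phi k) (phi k)))^-1 *: phi k.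
  by rewrite /nrm (rip_norm C) sqrtr_sqr normr_id.
exists (fun k => nrm (phi k)); split.
- have -> : (fun k => nrm (phi k)) = (fun k => (Num.sqrt (rip (phi k) (phi k)))^-1 *: phi k).
    by apply/funext => k; rewrite nE.
  apply: smooth_scale => //; apply: smooth_isqrt => //.
  apply: (@smooth_bil _ _ _ _ _ _ _ rip 1) => //.
  + by move=> *; rewrite (ripDl C).
  + by move=> *; rewrite (ripDr C).
  + by move=> *; rewrite (ripZl C).
  + by move=> *; rewrite (ripZr C).
  + by move=> *; rewrite mul1r (rip_le C).
- by move=> k; rewrite norm_nrm.
- by move=> k; have := Plin S (k *m Bi); rewrite xB => Pl; rewrite /nrm (rlinZ Pl) h3.
- by move=> k z; rewrite /nrm h4 (isomN (taui S _)) (rlinZ (isomL (taui S _))).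
- by move=> k; rewrite /nrm h5 (isomN (Thi S)) (rlinZ (isomL (Thi S))).
Qed.

End Smoothing.

Lemma common_radius (R : realType) (d : nat) (Pr : 'I_d -> R -> Prop) :
  (forall j (t t' : R), 0 < t' -> t' <= t -> Pr j t -> Pr j t') ->
  (forall j, exists2 t : R, 0 < t & Pr j t) -> exists2 t : R, 0 < t & forall j, Pr j t.
Proof.
move=> mono ex.
suff H (s : seq 'I_d) : exists2 t : R, 0 < t & forall j, j \in s -> Pr j t.
  by have [t t0 Ht] := H (enum 'I_d); exists t => // j; apply: Ht; rewrite mem_enum.
elim: s => [|j s [t t0 IH]]; first by exists 1.
have [t' t'0 Ht'] := ex j; exists (Num.min t t'); first by rewrite lt_min t0.
move=> i; rewrite inE => /orP[/eqP ->|/IH Hi].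
  by apply: mono Ht'; rewrite ?lt_min ?t0 // ge_min lexx orbT.
by apply: mono Hi; rewrite ?lt_min ?t0 // ge_min lexx.
Qed.

Section Family.
Variables (R : realType) (V : normedModType R) (rip : V -> V -> R) (J : V -> V).
Hypothesis C : cplx rip J.
Variables (d : nat) (B : 'M[R]_d) (I : Type) (F : I -> 'rV[R]_d -> V).
Variables (g : 'I_d -> I -> 'rV[R]_d -> V) (w : I -> R).
Hypothesis w0 : forall i, 0 <= w i.
Hypothesis Fpd : forall i j, pd (@e_dir R d) (F i) j (g j i).
Hypothesis gloc : forall k0 j, exists2 t : R, 0 < t &
  forall k, `|k - k0| < t -> forall i, `|g j i k| <= t^-1 * w i.
Hypothesis Finv : forall (c : R) x y z,
  (forall i, `|F i (x *m B) - F i (y *m B)| <= c * w i) ->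
  forall i, `|F i ((x + zr R z) *m B) - F i ((y + zr R z) *m B)| <= c * w i.
Hypothesis Fbd : forall i k, `|F i k| <= w i.

(** Used with one index for a single section, and with the vectors [v] as indices and [w v = |v|]
    for operator-norm bounds. In [gloc] the same number is a radius and the inverse of a bound, so
    that several directions are combined by a minimum. *)
Lemma family_Lip : exists2 L : R, 0 <= L &
  forall x y i, `|F i (x *m B) - F i (y *m B)| <= L * `|x - y| * w i.
Proof.
apply: (@uniform_Lip R d (fun c x y => forall i, `|F i (x *m B) - F i (y *m B)| <= c * w i)
   _ _ 2) => //.
- by move=> c c' x y cc H i; apply: le_trans (H i) _; apply: ler_wpM2r.
- move=> x y i; apply: le_trans (ler_normB _ _) _.
  by have := lerD (Fbd i (x *m B)) (Fbd i (y *m B)); rewrite mulrDl mul1r.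
move=> x0; have [M M0 HM] := mulmx_Lip B.
have [t t0 Ht] : exists2 t : R, 0 < t & forall j k, `|k - x0 *m B| < t ->
    forall i, `|g j i k| <= t^-1 * w i.
  apply: common_radius; last by move=> j; exact: gloc.
  move=> j t t' t'0 tt H k kt i; have kt' := lt_le_trans kt tt.
  apply: le_trans (H k kt' i) _; apply: ler_wpM2r => //.
  by rewrite lef_pV2 // posrE // (lt_le_trans t'0).
have M1 : 0 < M + 1 by lra.
exists (t / (M + 1)); first by rewrite divr_gt0.
exists (d%:R * t^-1 * M); first by rewrite !mulr_ge0 // invr_ge0 ltW.
have small x : `|x - x0| < t / (M + 1) -> `|x *m B - x0 *m B| < t.
  rewrite ltr_pdivlMr // => h; apply: le_lt_trans h; apply: le_trans (HM _ _) _.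
  by rewrite mulrC ler_wpM2l // lerDl.
move=> x y /small hx /small hy i.
have := box_Lip C t0 (@Fpd i) (fun j k kt => Ht j k kt i) hx hy.
move=> h; apply: le_trans h _.
rewrite [leLHS](_ : _ = d%:R * t^-1 * w i * `|x *m B - y *m B|); last by ring.
rewrite [leRHS](_ : _ = d%:R * t^-1 * w i * (M * `|x - y|)); last by ring.
by apply: ler_wpM2l => //; rewrite !mulr_ge0 // invr_ge0 ltW.
Qed.

End Family.

(** * Bloch frames *)

Local Open Scope complex_scope.

(** A copy of [H] indexed by the proof [Hip], to which the real normed structure coming from [ip]
    can be attached canonically. *)
Definition hilb (R : realType) (H : lmodType R[i]) (ip : H -> H -> R[i])
  (Hip : is_inner_product ip) : Type := H.

Section Hilbert.
Variables (R : realType) (H : lmodType R[i]) (ip : H -> H -> R[i]).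
Hypothesis Hip : is_inner_product ip.

Lemma ipDr x y z : ip x (y + z) = ip x y + ip x z.
Proof. by have [h _ _ _] := Hip; rewrite -[y]scale1r h mul1r scale1r. Qed.
Lemma ip0r x : ip x 0 = 0.
Proof. by apply: (addrI (ip x 0)); rewrite -ipDr !addr0. Qed.
Lemma ipZr a x y : ip x (a *: y) = a * ip x y.
Proof. by have [h _ _ _] := Hip; rewrite -[a *: y]addr0 h ip0r addr0. Qed.
Lemma ip_conj x y : ip y x = conjc (ip x y).
Proof. by have [_ h _ _] := Hip; exact: h. Qed.
Lemma ipDl x y z : ip (x + y) z = ip x z + ip y z.
Proof. by rewrite ip_conj ipDr rmorphD /= -!ip_conj. Qed.
Lemma ipZl a x y : ip (a *: x) y = conjc a * ip x y.
Proof. by rewrite ip_conj ipZr rmorphM /= -ip_conj. Qed.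
Lemma ip0l x : ip 0 x = 0.
Proof. by rewrite ip_conj ip0r conjc0. Qed.
Lemma ipNr x y : ip x (- y) = - ip x y.
Proof. by rewrite -scaleN1r ipZr mulN1r. Qed.
Lemma ipNl x y : ip (- x) y = - ip x y.
Proof. by rewrite ip_conj ipNr rmorphN /= -ip_conj. Qed.
Lemma ipBr x y z : ip x (y - z) = ip x y - ip x z.
Proof. by rewrite ipDr ipNr. Qed.
Lemma ipBl x y z : ip (x - y) z = ip x z - ip y z.
Proof. by rewrite ipDl ipNl. Qed.

Definition rip (x y : H) : R := complex.Re (ip x y).

Lemma Re_mulc (a b : R[i]) : complex.Re (a * b) =
  complex.Re a * complex.Re b - complex.Im a * complex.Im b.
Proof. by case: a b => [? ?] [? ?]. Qed.
Lemma ReD (a b : R[i]) : complex.Re (a + b) = complex.Re a + complex.Re b.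
Proof. by case: a b => [? ?] [? ?]. Qed.

Let ripDl' u v w : rip (u + v) w = rip u w + rip v w.
Proof. by rewrite /rip ipDl ReD. Qed.
Let ripC' u v : rip u v = rip v u.
Proof. by rewrite /rip ip_conj; case: (ip v u). Qed.
Let ripZl' (a : R) u v : rip (a%:C *: u) v = a * rip u v.
Proof. by rewrite /rip ipZl conjc_real Re_mulc /= mul0r subr0. Qed.
Let ripDr' u v w : rip w (u + v) = rip w u + rip w v.
Proof. by rewrite !(ripC' w) ripDl'. Qed.
Let ripZr' (a : R) u v : rip v (a%:C *: u) = a * rip v u.
Proof. by rewrite !(ripC' v) ripZl'. Qed.
Let rip_ge0' v : 0 <= rip v v.
Proof. by have [_ _ h _] := Hip; have [] := h v. Qed.
Let rip_eq0' v : rip v v = 0 -> v = 0.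
Proof.
have [_ _ h1 h2] := Hip => h; apply: h2; have [i _] := h1 v.
by move: h i; rewrite /rip; case: (ip v v) => a b /= -> ->.
Qed.
Let hnorm_sqr v : hnorm ip v ^+ 2 = rip v v.
Proof. by rewrite /hnorm sqr_sqrtr //; exact: rip_ge0'. Qed.
Let hnorm_ge0 v : 0 <= hnorm ip v. Proof. exact: sqrtr_ge0. Qed.

Let CS x y : rip x y <= hnorm ip x * hnorm ip y.
Proof.
have [x0|x0] := eqVneq (hnorm ip x) 0.
  have -> : x = 0 by apply: rip_eq0'; rewrite -hnorm_sqr x0 expr0n.
  by rewrite /rip ip0l mulr_ge0.
have [y0|y0] := eqVneq (hnorm ip y) 0.
  have -> : y = 0 by apply: rip_eq0'; rewrite -hnorm_sqr y0 expr0n.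
  by rewrite /rip ip0r mulr_ge0.
have p : 0 < hnorm ip x * hnorm ip y by rewrite mulr_gt0 // lt_def ?x0 ?y0 hnorm_ge0.
have := rip_ge0' ((hnorm ip y)%:C *: x + (- hnorm ip x)%:C *: y).
rewrite !(ripDl', ripDr', ripZl', ripZr') -!hnorm_sqr (ripC' y x).
move: (hnorm ip x) (hnorm ip y) (rip x y) p => a b r p h.
have : 0 <= (a * b) * (a * b - r) by nra.
by rewrite pmulr_rge0 // subr_ge0.
Qed.

Local Notation V := (hilb Hip).

HB.instance Definition _ := GRing.Zmodule.copy V H.

Let hscale (a : R) (v : V) : V := (a%:C *: (v : H)).

Let hscaleA a b (v : V) : hscale a (hscale b v) = hscale (a * b) v.
Proof. by rewrite /hscale scalerA rmorphM. Qed.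
Let hscale1 : left_id 1 hscale. Proof. by move=> v; rewrite /hscale scale1r. Qed.
Let hscaleDr : right_distributive hscale +%R.
Proof. by move=> a u v; rewrite /hscale; exact: (scalerDr (a%:C) (u : H) (v : H)). Qed.
Let hscaleDl (v : V) : {morph hscale^~ v : a b / a + b}.
Proof. by move=> a b; rewrite /hscale rmorphD; exact: (scalerDl (v : H) (a%:C) (b%:C)). Qed.

HB.instance Definition _ := GRing.Zmodule_isLmodule.Build R V hscaleA hscale1 hscaleDr hscaleDl.

Let hnormD (x y : V) : hnorm ip ((x + y : V) : H) <= hnorm ip x + hnorm ip y.
Proof.
rewrite -[leLHS]ger0_norm // -[leRHS]ger0_norm ?addr_ge0 // -ler_sqr ?nnegrE //.
rewrite !real_normK ?num_real // sqrrD !hnorm_sqr.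
have -> : rip (x + y : V) (x + y : V) = rip x x + rip x y *+ 2 + rip y y.
  by rewrite ripDl' !ripDr' (ripC' y x) mulr2n; lra.
by rewrite lerD2r lerD2l lerMn2r CS.
Qed.
Let hnormZ (a : R) (x : V) : hnorm ip ((a *: x : V) : H) = `|a| * hnorm ip x.
Proof.
rewrite /hnorm; have -> : complex.Re (ip (a *: x : V) (a *: x : V)) = a ^+ 2 * rip x x.
  by rewrite -/(rip _ _) ripZl' ripZr' mulrA -expr2.
by rewrite sqrtrM ?sqr_ge0 // sqrtr_sqr.
Qed.
Let hnorm0 (x : V) : hnorm ip x = 0 -> x = 0.
Proof. by move=> h; apply: rip_eq0'; rewrite -hnorm_sqr h expr0n. Qed.

HB.instance Definition _ := Lmodule_isNormed.Build R V hnormD hnormZ hnorm0.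

Definition hJ (v : V) : V := 'i *: (v : H).

Lemma hilb_normE (v : V) : `|v| = hnorm ip v. Proof. by []. Qed.
Lemma hilb_scaleE (a : R) (v : V) : a *: v = a%:C *: (v : H) :> H. Proof. by []. Qed.

Lemma hilb_cplx : cplx (V := V) (rip : V -> V -> R) hJ.
Proof.
split.
- exact: ripDl'.
- exact: ripZl'.
- exact: ripC'.
- by move=> v; rewrite hilb_normE hnorm_sqr.
- by move=> u v; exact: (scalerDr 'i (u : H) (v : H)).
- by move=> a u; rewrite /hJ !hilb_scaleE !scalerA mulrC.
- by move=> v; rewrite /hJ scalerA -expr2 sqr_i; exact: (scaleN1r (v : H)).
- move=> u v; rewrite /rip /hJ ipZl ipZr !Re_mulc /=; ring.
Qed.

End Hilbert.

(** * Orthogonal projectors and deflation of their rank *)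

Section Rank.
Variables (R : realType) (H : lmodType R[i]) (ip : H -> H -> R[i]).
Hypothesis Hip : is_inner_product ip.
Implicit Types (A : H -> H) (v w phi : H).

Lemma opD A : is_linear_op A -> forall x y, A (x + y) = A x + A y.
Proof. by move=> h x y; have := h 1 x y; rewrite !scale1r. Qed.
Lemma op0 A : is_linear_op A -> A 0 = 0.
Proof. by move=> h; apply: (addrI (A 0)); rewrite -opD // !addr0. Qed.
Lemma opZ A : is_linear_op A -> forall a x, A (a *: x) = a *: A x.
Proof. by move=> h a x; have := h a x 0; rewrite (op0 h) !addr0. Qed.
Lemma opN A : is_linear_op A -> forall x, A (- x) = - A x.
Proof. by move=> h x; rewrite -scaleN1r opZ // scaleN1r. Qed.
Lemma op_sum A (n : nat) (c : 'I_n -> R[i]) (b : 'I_n -> H) : is_linear_op A ->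
  A (\sum_i c i *: b i) = \sum_i c i *: A (b i).
Proof.
move=> h; elim/big_ind2: _ => [|x y x' y' <- <-|i _]; first exact: op0.
  exact: opD.
exact: opZ.
Qed.

Lemma proj_norm A v : is_linear_op A -> (forall x, A (A x) = A x) ->
  (forall x y, ip (A x) y = ip x (A y)) -> hnorm ip (A v) <= hnorm ip v.
Proof.
move=> Al AA As; pose V := hilb Hip.
have [e|e] := eqVneq (hnorm ip (A v)) 0; first by rewrite e sqrtr_ge0.
have p : 0 < hnorm ip (A v) by rewrite lt_def e sqrtr_ge0.
have := rip_le (hilb_cplx Hip) (v : V) (A v : V); rewrite !hilb_normE => h.
have h2 := le_trans (ler_norm _) h.
have h3 := rip_norm (hilb_cplx Hip) (A v : V); rewrite hilb_normE in h3.
have h4 : rip ip v (A v) = rip ip (A v) (A v) by rewrite /rip As AA.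
by move: h2; rewrite h4 h3 expr2 ler_pM2r.
Qed.

Lemma in_ranP A v : (forall x, A (A x) = A x) -> in_ran A v <-> A v = v.
Proof. by move=> AA; split=> [[w ->]|e]; [exact: AA | exists v]. Qed.

Definition deflate A phi : H -> H := fun v => A v - ip phi v *: phi.

Section Deflate.
Variables (A : H -> H) (phi : H).
Hypothesis Ap : orth_projector ip A.
Hypothesis Aphi : A phi = phi.
Hypothesis phi1 : ip phi phi = 1.

Let Al : is_linear_op A. Proof. by case: Ap => -[]. Qed.
Let AA : forall x, A (A x) = A x. Proof. by case: Ap. Qed.
Let As : forall x y, ip (A x) y = ip x (A y). Proof. by case: Ap. Qed.

Let ipA v : ip phi (A v) = ip phi v. Proof. by rewrite -As Aphi. Qed.

Lemma deflate_lin : is_linear_op (deflate A phi).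
Proof.
move=> a x y; rewrite /deflate Al (ipDr Hip) (ipZr Hip) scalerDl opprD addrACA.
by rewrite scalerBr scalerA.
Qed.

Lemma deflate_phi v : ip phi (deflate A phi v) = 0.
Proof. by rewrite /deflate (ipBr Hip) (ipZr Hip) phi1 ipA mulr1 subrr. Qed.

Lemma deflate_A v : A (deflate A phi v) = deflate A phi v.
Proof. by rewrite /deflate opD // opN // opZ // AA Aphi. Qed.

Lemma deflate_idem v : deflate A phi (deflate A phi v) = deflate A phi v.
Proof. by rewrite {1}/deflate deflate_A deflate_phi scale0r subr0. Qed.

Lemma deflate_proj : orth_projector ip (deflate A phi).
Proof.
have sy x y : ip (deflate A phi x) y = ip x (deflate A phi y).
  rewrite /deflate (ipBl Hip) (ipBr Hip) As (ipZl Hip) (ipZr Hip) mulrC -(ip_conj Hip).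
  by rewrite mulrC [ip x phi * _]mulrC.
split=> //; last exact: deflate_idem.
split; first exact: deflate_lin.
by exists 1 => x; rewrite mul1r; apply: proj_norm; [exact: deflate_lin | exact: deflate_idem | ].
Qed.

(** Exchange argument: [phi] has a nonzero coefficient on some [b i0], and deflation kills [phi], so
    the image of [b i0] is a combination of the images of the other basis vectors, which form the
    new basis. *)
Lemma deflate_rank m : has_rank A m.+1 -> has_rank (deflate A phi) m.
Proof.
move=> [b [bfree bspan]].
have Ab i : A (b i) = b i.
  apply/in_ranP => //; apply/bspan; exists (fun j => (j == i)%:R).
  rewrite (bigD1 i) //= eqxx scale1r big1 ?addr0 // => j /negbTE ->.
  by rewrite scale0r.
have [c phiE] : exists c : 'I_m.+1 -> R[i], phi = \sum_i c i *: b i.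
  by apply/bspan/in_ranP.
have [i0 ci0] : exists i0, c i0 != 0.
  apply: contrapT => H0.
  have p0 : phi = 0.
    rewrite phiE big1 // => i _; have [->|ne] := eqVneq (c i) 0; first by rewrite scale0r.
    by case: H0; exists i.
  by move: phi1; rewrite p0 (ip0r Hip) => /eqP; rewrite eq_sym oner_eq0.
have D0 : deflate A phi phi = 0 by rewrite /deflate Aphi phi1 scale1r subrr.
have Dl := deflate_lin.
exists (fun i => deflate A phi (b (lift i0 i))); split.
  (* If the deflation of [w] vanishes then [w = kap phi]. Since [w] does not involve [b i0] while
     [phi] does, freeness forces [kap = 0], and then all coefficients vanish. *)
  move=> a; rewrite -op_sum // => Da.
  set w := \sum_i a i *: b (lift i0 i) in Da.
  have Aw : A w = w by rewrite /w op_sum //; apply: eq_bigr => i _; rewrite Ab.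
  pose kap := ip phi w.
  have wE : w = kap *: phi.
    by move/eqP: Da; rewrite /deflate Aw subr_eq0 => /eqP.
  pose a' j := (if unlift i0 j is Some i then a i else 0) - kap * c j.
  have s0 : \sum_j a' j *: b j = 0.
    have -> : \sum_j a' j *: b j = w - kap *: phi.
      rewrite phiE scaler_sumr; under eq_bigr do rewrite scalerBl -scalerA.
      rewrite sumrB; congr (_ - _); rewrite (bigD1_ord i0) //= unlift_none scale0r add0r.
      by apply: eq_bigr => i _; rewrite liftK.
    by rewrite -wE subrr.
  have z := bfree a' s0.
  have kap0 : kap = 0.
    have := z i0; rewrite /a' unlift_none sub0r => /eqP; rewrite oppr_eq0 mulf_eq0 (negbTE ci0) orbF.
    by move/eqP.
  by move=> i; have := z (lift i0 i); rewrite /a' liftK kap0 mul0r subr0.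
move=> v; split; last first.
  move=> [a ->]; exists (\sum_i a i *: b (lift i0 i)); rewrite op_sum //.
move=> /(in_ranP _ deflate_idem) Dv.
have Av : A v = v by rewrite -Dv deflate_A.
have [a vE] : exists a : 'I_m.+1 -> R[i], v = \sum_i a i *: b i by apply/bspan/in_ranP.
have Db0 : deflate A phi (b i0) = - \sum_i (c (lift i0 i) / c i0) *: deflate A phi (b (lift i0 i)).
  have E : c i0 *: deflate A phi (b i0) =
      - \sum_i c (lift i0 i) *: deflate A phi (b (lift i0 i)).
    have : \sum_i c i *: deflate A phi (b i) = 0 by rewrite -op_sum // -phiE.
    by rewrite (bigD1_ord i0) //= => /eqP; rewrite addr_eq0 => /eqP.
  rewrite -[LHS]scale1r -(mulVf ci0) -scalerA E scalerN scaler_sumr; congr (- _).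
  by apply: eq_bigr => i _; rewrite scalerA mulrC.
exists (fun i => a (lift i0 i) - a i0 * (c (lift i0 i) / c i0)).
rewrite -Dv {1}vE op_sum // (bigD1_ord i0) //= Db0 scalerN scaler_sumr.
under [in RHS]eq_bigr do rewrite scalerBl.
rewrite sumrB addrC; congr (_ - _); apply: eq_bigr => i _; by rewrite scalerA.
Qed.

End Deflate.

Lemma rank_unit A m : orth_projector ip A -> has_rank A m.+1 ->
  exists2 phi, A phi = phi & ip phi phi = 1.
Proof.
move=> [[Al _] AA _] [b [bfree bspan]].
have b0 : b ord0 != 0.
  apply/eqP => b0.
  have sum0 : \sum_(j < m.+1) (j == ord0)%:R *: b j = 0.
    rewrite (bigD1 ord0) //= b0 scaler0 add0r big1 // => j /negbTE ->.
    by rewrite scale0r.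
  by have := bfree _ sum0 ord0; rewrite eqxx => /eqP; rewrite oner_eq0.
have Ab : A (b ord0) = b ord0.
  apply/in_ranP => //; apply/bspan; exists (fun j => (j == ord0)%:R).
  rewrite (bigD1 ord0) //= scale1r big1 ?addr0 // => j /negbTE ->.
  by rewrite scale0r.
have [_ _ pos def] := Hip; have [im re] := pos (b ord0).
set r := complex.Re (ip (b ord0) (b ord0)) in re.
have ipE : ip (b ord0) (b ord0) = r%:C.
  by move: im; rewrite /r; case: (ip _ _) => x y /= ->.
have r0 : 0 < r.
  rewrite lt_def re andbT; apply/eqP => e; move/eqP: b0; apply; apply: def.
  by rewrite ipE e.
exists (((Num.sqrt r)^-1)%:C *: b ord0); first by rewrite opZ // Ab.
rewrite (ipZl Hip) (ipZr Hip) conjc_real ipE -!rmorphM /= mulrA -expr2 exprVn sqr_sqrtr //.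
by rewrite mulVf // gt_eqF.
Qed.

(** Deflating a projector of rank one leaves rank zero. *)
Lemma rank1_decomp A phi v : orth_projector ip A -> has_rank A 1 -> A phi = phi ->
  ip phi phi = 1 -> A v = v -> v = ip phi v *: phi.
Proof.
move=> Ap Ar Aphi phi1 Av; have [b [_ h]] := deflate_rank Ap Aphi phi1 Ar.
have /h[c] : in_ran (deflate A phi) (deflate A phi v) by exists v.
by rewrite big_ord0 /deflate Av => /eqP; rewrite subr_eq0 => /eqP.
Qed.

Lemma rank0 A v : has_rank A 0 -> A v = 0.
Proof.
by move=> [b [_ h]]; have /h[c ->] : in_ran A (A v); [exists v | rewrite big_ord0].
Qed.

End Rank.

Lemma rmul_decomp (R : realType) (H : lmodType R[i]) (ip : H -> H -> R[i])
    (Hip : is_inner_product ip) (phi v : hilb Hip) :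
  ip phi v *: (phi : H) = rip ip phi v *: phi + rip ip (hJ phi) v *: hJ phi.
Proof.
have -> : rip ip (hJ phi) v = complex.Im (ip phi v).
  by rewrite /rip /hJ (ipZl Hip) Re_mulc /=; ring.
rewrite /hJ; change (ip phi v *: (phi : H) =
  (complex.Re (ip phi v))%:C *: (phi : H) + (complex.Im (ip phi v))%:C *: ('i *: (phi : H))).
by rewrite scalerA -scalerDl {1}(complexE (ip phi v)) mulrC.
Qed.

(** * Induction on the rank and the passage to operator-norm smoothness *)

Section Frame.
Variables (R : realType) (H : lmodType R[i]) (ip : H -> H -> R[i]) (d : nat) (B : 'M[R]_d).
Hypothesis d3 : (d <= 3)%N.
Hypothesis Hip : is_inner_product ip.
Hypothesis Bu : B \in unitmx.
Local Notation V := (hilb Hip).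
Local Notation C := (hilb_cplx Hip).
Variables (tau : 'rV[R]_d -> H -> H) (Th : H -> H).
Hypothesis tauR : unitary_rep ip B tau.
Hypothesis Thu : antiunitary ip Th.
Hypothesis ThTh : forall v, Th (Th v) = v.
Hypothesis Thtau : forall l, in_lattice B l -> forall v, tau l (Th (tau l v)) = Th v.

Let lat (z : 'rV[int]_d) : in_lattice B (zr R z *m B). Proof. by exists z. Qed.
Let tz (z : 'rV[int]_d) : V -> V := tau (zr R z *m B).

Let norm_ip (x y : V) : ip x x = ip y y -> `|x| = `|y|.
Proof. by rewrite !hilb_normE /hnorm => ->. Qed.

Let tz_lin z : is_linear_op (tz z : H -> H).
Proof. by have [h _ _] := tauR; have [] := h _ (lat z). Qed.
Let tz_isom z : isom (tz z).
Proof.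
have [h _ _] := tauR; have [l _ i] := h _ (lat z).
split; last by move=> v; apply: norm_ip; exact: i.
by split=> [u v|a u]; [exact: (opD l) | exact: (opZ l)].
Qed.
Let tzJ z v : tz z (hJ v) = hJ (tz z v).
Proof. exact: (opZ (@tz_lin z)). Qed.
Let tz0 v : tz 0 v = v.
Proof. by rewrite /tz zr0 mul0mx; have [_ h _] := tauR; exact: h. Qed.
Let tzD z z' v : tz (z + z') v = tz z (tz z' v).
Proof. by rewrite /tz zrD mulmxDl; have [_ _ h] := tauR; exact: h. Qed.

Let Thr : rlin (Th : V -> V).
Proof.
have [l _ _] := Thu.
have D (u v : V) : Th (u + v) = Th u + Th v.
  by have := l 1 u v; rewrite conjc1 !scale1r.
have T0 : Th 0 = 0 by apply: (addrI (Th 0)); rewrite -D !addr0.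
by split=> // a u; have := l (a%:C) u 0; rewrite conjc_real T0 !addr0.
Qed.
Let Thi : isom (Th : V -> V).
Proof. by split; [exact: Thr | have [_ _ i] := Thu => v; apply: norm_ip; exact: i]. Qed.
Let ThJ (v : V) : Th (hJ v) = - hJ (Th v : V).
Proof.
have [l _ _] := Thu; have T0 : Th 0 = 0 by exact: (rlin0 Thr).
have := l 'i v 0; rewrite T0 !addr0 /hJ => ->.
have -> : conjc ('i : R[i]) = - 'i by rewrite /conjc; apply/eqP; rewrite eq_complex /= oppr0 !eqxx.
exact: scaleNr.
Qed.
Let Thtz z (v : V) : Th (tz z v) = tz (- z) (Th v).
Proof.
rewrite -(Thtau (lat z) v) -/(tz z _) -/(tz z _) -[RHS](@tzD (- z) z) addNr tz0 //.
Qed.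

(* Of the smoothness in operator norm only [bp_smooth] and [bp_lip] are kept:
   this is all that [deflate] has to preserve. *)
Record blochP (P : 'rV[R]_d -> H -> H) (m : nat) : Prop := BlochP {
  bp_proj : forall k, orth_projector ip (P k);
  bp_rank : forall k, has_rank (P k) m;
  bp_smooth : forall v : V, smooth (@e_dir R d) (fun k => (P k v : V));
  bp_lip : OpLip (fun x : 'rV[R]_d => (P (x *m B) : V -> V));
  bp_tau : forall k l, in_lattice B l -> forall v, P (k + l) (tau l v) = tau l (P k v);
  bp_Th : forall k v, P (- k) (Th v) = Th (P k v) }.

Let bsys_of P m : blochP P m -> bsys (hJ (Hip := Hip)) (fun x => P (x *m B) : V -> V) tz (Th : V -> V).
Proof.
move=> [Pp _ _ PL Pt PT]; have Pl k : is_linear_op (P k) by case: (Pp k) => -[].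
split=> //.
- by move=> x; split=> [u v|a u]; [exact: (opD (Pl _)) | exact: (opZ (Pl _))].
- by move=> x v; exact: (opZ (Pl _)).
- by move=> x v; case: (Pp (x *m B)) => -[l _] i s; exact: (proj_norm Hip).
- by move=> x v; case: (Pp (x *m B)).
- by move=> x z v; rewrite mulmxDl; exact: Pt.
- by move=> x v; rewrite mulNmx; exact: PT.
Qed.

Lemma ip1_norm (v : V) : ip v v = 1 <-> `|v| = 1.
Proof.
have [_ _ pos _] := Hip; have [im re] := pos v; rewrite hilb_normE /hnorm.
split=> [->|h]; first by rewrite /= sqrtr1.
have : complex.Re (ip v v) = 1 by rewrite -[LHS]sqr_sqrtr // h expr1n.
by move: im; case: (ip v v) => a b /= -> ->.
Qed.

Lemma unit_bloch_section P m : blochP P m.+1 -> exists phi : 'rV[R]_d -> V,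
  [/\ smooth (@e_dir R d) phi, forall k, `|phi k| = 1, forall k, P k (phi k) = phi k,
   forall k z, phi (k + zr R z *m B) = tz z (phi k) & forall k, phi (- k) = Th (phi k)].
Proof.
move=> bp; have S := bsys_of bp; have [Pp Pr Ps _ _ _] := bp.
have [u us [c c0 uc]] : exists2 u, bsection (fun x => P (x *m B) : V -> V) tz (Th : V -> V) u &
    exists2 c : R, 0 < c & forall x, c <= `|u x|.
  case: m bp Pr => [|m] bp Pr.
    have [||u us u1] := line_section C S.
    - move=> x phi v p1 Pphi Pv; rewrite -rmul_decomp.
      exact: (rank1_decomp Hip (Pp _) (Pr _) Pphi ((ip1_norm _).2 p1) Pv).
    - rewrite mul0mx; have [phi Pphi phi1] := rank_unit Hip (Pp 0) (Pr 0); exists phi => //.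
      by rewrite -normr_eq0 ((ip1_norm _).1 phi1) oner_eq0.
    by exists u => //; exists 1 => // x; rewrite u1.
  apply: (generic_section C d3 S) => x.
  (* A unit vector of the deflated projector is a second vector of the fibre, orthogonal over the
     complex numbers to the first. *)
  have [e1 Pe1 e11] := rank_unit Hip (Pp (x *m B)) (Pr (x *m B)).
  have Dp := deflate_proj Hip (Pp (x *m B)) Pe1 e11.
  have Dr := deflate_rank Hip (Pp (x *m B)) Pe1 e11 (Pr (x *m B)).
  have [e2 De2 e21] := rank_unit Hip Dp Dr.
  have o : ip e1 e2 = 0 by rewrite -De2 (deflate_phi Hip (Pp (x *m B))).
  exists e1, e2; split=> //; try exact/ip1_norm.
    by rewrite -De2 (deflate_A (Pp (x *m B)) Pe1).
  rewrite /rip /hJ (ipZl Hip) o mulr0 //.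
exact: (smooth_unit_section C Bu S Ps us c0 uc).
Qed.

Lemma unit_section_Lip (phi : 'rV[R]_d -> V) :
  smooth (@e_dir R d) phi -> (forall k, `|phi k| = 1) ->
  (forall k z, phi (k + zr R z *m B) = tz z (phi k)) ->
  Lip (fun x : 'rV[R]_d => phi (x *m B)).
Proof.
move=> sphi p1 pt.
have ex j : exists g, smooth (@e_dir R d) g /\ pd (@e_dir R d) phi j g.
  by have [g h1 h2] := smooth_pd j sphi; exists g.
have [g Hg] := choice ex.
have [|||||L L0 HL] := @family_Lip R V _ _ C d B unit (fun _ => phi) (fun j _ => g j) (fun _ => 1) _ _ _ _ _.
- by [].
- by move=> i j; exact: (Hg j).2.
- move=> k0 j; have /continuousP_norm/(_ k0 1 ltr01)[del del0 Hdel] := smooth_cont (Hg j).1.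
  pose t := Num.min del (`|g j k0| + 1)^-1.
  have g1 : 0 < `|g j k0| + 1 by rewrite addrC ltr_pwDl.
  have t0 : 0 < t by rewrite lt_min del0 invr_gt0.
  exists t => // k kt _; rewrite mulr1.
  have h1 : `|g j k| <= `|g j k0| + 1.
    have h : `|k - k0| < del by apply: lt_le_trans kt _; rewrite ge_min lexx.
    have := ler_normD (g j k - g j k0) (g j k0); rewrite subrK => h2.
    by apply: le_trans h2 _; rewrite addrC lerD2l Hdel.
  apply: le_trans h1 _; rewrite -[leLHS]invrK lef_pV2 ?posrE ?invr_gt0 //.
  by rewrite ge_min lexx orbT.
- move=> c x y z h i; rewrite !mulmxDl !pt -(rlinB (isomL (tz_isom z))) (isomN (tz_isom z)).
  exact: h.
- by move=> i k; rewrite p1.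
by exists L => // x y; have := HL x y tt; rewrite mulr1.
Qed.

Lemma deflate_bloch P m (phi : 'rV[R]_d -> V) : blochP P m.+1 ->
  smooth (@e_dir R d) phi -> (forall k, `|phi k| = 1) -> (forall k, P k (phi k) = phi k) ->
  (forall k z, phi (k + zr R z *m B) = tz z (phi k)) -> (forall k, phi (- k) = Th (phi k)) ->
  blochP (fun k => deflate ip (P k) (phi k)) m.
Proof.
move=> bp sphi p1 Pphi pt pT; have [Pp Pr Ps PL Pt PT] := bp.
have dE k (v : V) : deflate ip (P k) (phi k) v =
    P k v - (rip ip (phi k) v *: phi k + rip ip (hJ (phi k)) v *: hJ (phi k)) :> V.
  by rewrite -rmul_decomp.
have i1 k : ip (phi k) (phi k) = 1 by exact/ip1_norm.
have Lphi := unit_section_Lip sphi p1 pt.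
split.
- by move=> k; exact: (deflate_proj Hip (Pp k) (Pphi k) (i1 k)).
- by move=> k; exact: (deflate_rank Hip (Pp k) (Pphi k) (i1 k) (Pr k)).
- move=> v; have bil : forall (f g : 'rV[R]_d -> V), smooth (@e_dir R d) f -> smooth (@e_dir R d) g ->
      smooth (@e_dir R d) (fun k => rip ip (f k) v *: g k).
    move=> f g sf sg.
    apply: (@smooth_bil R _ d (@e_dir R d) V V V (fun a b => rip ip a v *: b) `|v|) => //.
    + by move=> a a' b; rewrite (ripDl C) scalerDl.
    + by move=> a b b'; rewrite scalerDr.
    + by move=> c a b; rewrite (ripZl C) scalerA.
    + by move=> c a b; rewrite !scalerA mulrC.
    + by move=> a b; rewrite normrZ; apply: ler_wpM2r => //; rewrite mulrC; exact: (rip_le C).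
  have sJ : smooth (@e_dir R d) (fun k => hJ (phi k)).
    have s1 : smooth (@e_dir R d) (fun k => 1 *: hJ (phi k)).
      apply: (@smooth_bil R _ d (@e_dir R d) R V V (fun a b => a *: hJ b) 1 _ _ _ _ _ _ (fun=> 1) phi) => //.
      + by move=> a a' b; rewrite scalerDl.
      + by move=> a b b'; rewrite (JD C) scalerDr.
      + by move=> c a b; rewrite scalerA.
      + by move=> c a b; rewrite (JZ C) !scalerA mulrC.
      + by move=> a b; rewrite normrZ (norm_J C) mul1r.
      + exact: smooth_cst.
    by congr (smooth _ _): s1; apply/funext => k; rewrite scale1r.
  have s1 := smoothD (Ps v) (smooth_scale (smooth_cst _ (-1 : R))
    (smoothD (bil _ _ sphi sphi) (bil _ _ sJ sJ))).
  by congr (smooth _ _): s1; apply/funext => k; rewrite dE scaleN1r.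
- have [L L0 HL] := PL; have [M M0 HM] := Lphi.
  (* Over the reals the projection onto the line of [phi] is a sum of two rank-one terms, along
     [phi] and [hJ phi]; each is a product of two factors that vary by [M]. *)
  exists (L + (2 * M + 2 * M)); first by rewrite !addr_ge0 ?mulr_ge0.
  move=> x y v; rewrite !dE.
  set p := phi (x *m B); set q := phi (y *m B).
  have pq : `|p - q| <= M * `|x - y| by exact: HM.
  have one (a b : V) : `|a| = 1 -> `|b| = 1 -> `|a - b| <= M * `|x - y| ->
      `|rip ip a v *: a - rip ip b v *: b| <= 2 * (M * `|x - y| * `|v|).
    move=> a1 b1 ab.
    have -> : rip ip a v *: a - rip ip b v *: b = rip ip (a - b) v *: a + rip ip b v *: (a - b).
      by rewrite (ripBl C) scalerBl scalerBr addrA subrK.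
    apply: le_trans (ler_normD _ _) _; rewrite !normrZ a1 mulr1 mulrDl mul1r.
    apply: lerD.
      by apply: le_trans (rip_le C _ _) _; apply: ler_wpM2r.
    rewrite [leRHS]mulrC; apply: ler_pM => //.
    by have := rip_le C b v; rewrite b1 mul1r.
  have h1 := one _ _ (p1 (x *m B)) (p1 (y *m B)) pq.
  have Jn k : `|hJ (phi k)| = 1 by rewrite (norm_J C).
  have h2 : `|rip ip (hJ p) v *: hJ p - rip ip (hJ q) v *: hJ q| <= 2 * (M * `|x - y| * `|v|).
    by apply: (one _ _ (Jn _) (Jn _)); rewrite -(rlinB (rlinJ C)) (norm_J C).
  have h0 := HL x y v.
  have E (a b c e f g : V) : a - (c + e) - (b - (f + g)) = (a - b) - ((c - f) + (e - g)).
    rewrite [c - f + _]addrACA -opprD; move: (c + e) (f + g) => X Y.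
    by rewrite !opprB addrACA [in RHS]addrACA [- X - b]addrC.
  rewrite E.
  apply: le_trans (ler_normB _ _) _; apply: le_trans (lerD h0 (ler_normD _ _)) _.
  apply: le_trans (lerD (lexx _) (lerD h1 h2)) _; lra.
- move=> k l [z ->] v; rewrite -/(zr R z) /deflate pt Pt // -/(tz z v) -/(tz z (P k v)).
  have [h _ _] := tauR; have [tl _ i] := h _ (lat z).
  by rewrite [ip (tz _ _) _]i (opD tl) (opN tl) (opZ tl).
- move=> k v; rewrite /deflate pT PT; have [l _ i] := Thu.
  rewrite (rlinB Thr : forall u v : H, Th (u - v) = Th u - Th v); congr (_ - _).
  have := l (ip (phi k) v) (phi k) 0; rewrite (rlin0 Thr : Th (0 : H) = 0) !addr0 => ->.
  by rewrite i (ip_conj Hip).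
Qed.

Lemma bloch_frame m : forall P, blochP P m -> exists phi : 'I_m -> 'rV[R]_d -> V,
  [/\ forall k, onb_of_ran ip (fun a => phi a k) (P k), forall a, smooth (@e_dir R d) (phi a),
   forall a k z, phi a (k + zr R z *m B) = tz z (phi a k) & forall a k, phi a (- k) = Th (phi a k)].
Proof.
elim: m => [|m IH] P bp.
  exists (fun _ _ => 0); split=> [k|[]|[]|[]] //; split=> [[]|[]|v [w ->]] //.
  exists (fun _ => 0); rewrite big_ord0; exact: (rank0 _ (bp_rank bp k)).
have [phi [sphi p1 Pphi pt pT]] := unit_bloch_section bp.
have [psi [ponb spsi psit psiT]] := IH _ (deflate_bloch bp sphi p1 Pphi pt pT).
have i1 k : ip (phi k) (phi k) = 1 by exact/ip1_norm.
exists (fun a => if unlift ord0 a is Some b then psi b else phi); split; first last.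
- by move=> a k; case: unliftP => [b|] _.
- by move=> a k z; case: unliftP => [b|] _.
- by move=> a; case: unliftP => [b|] _.
move=> k; have [Pp _ _ _ _ _] := bp.
have [o1 o2 o3] := ponb k.
have Dpsi b : deflate ip (P k) (phi k) (psi b k) = psi b k.
  by apply/in_ranP => //; exact: (deflate_idem Hip (Pp k) (Pphi k) (i1 k)).
have op b : ip (phi k) (psi b k) = 0 by rewrite -Dpsi (deflate_phi Hip (Pp k) (Pphi k) (i1 k)).
have Pk v : P k (P k v) = P k v by case: (Pp k).
split.
- move=> a b; case: unliftP => [a'|] ->; case: unliftP => [b'|] ->.
  + by rewrite o1 (inj_eq lift_inj).
  + by rewrite (ip_conj Hip) op conjc0.
  + by rewrite op.
  + by rewrite i1 eqxx.
- move=> a; case: unliftP => [a'|] _; apply/in_ranP => //.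
  by rewrite -Dpsi (deflate_A (Pp k) (Pphi k)).
move=> v /(in_ranP v Pk) Pv.
have [c cE] : exists c : 'I_m -> R[i], deflate ip (P k) (phi k) v = \sum_a c a *: psi a k.
  by apply: o3; exists v.
exists (fun a => if unlift ord0 a is Some b then c b else ip (phi k) v).
rewrite big_ord_recl /= unlift_none.
under eq_bigr do rewrite liftK.
by rewrite -cE /deflate Pv addrC subrK.
Qed.

Lemma op_smooth_bloch P m : (forall k, orth_projector ip (P k) /\ has_rank (P k) m) ->
  op_smooth ip P ->
  (forall k l, in_lattice B l -> forall v, P (k + l) (tau l v) = tau l (P k v)) ->
  (forall k v, P (- k) (Th v) = Th (P k v)) -> blochP P m.
Proof.
move=> Ppr [D [D0 Db Dd Dc]] Pt PT.
have Dpd s j (v : V) : pd (@e_dir R d) (fun k => D s k v : V) j (fun k => D (j :: s) k v).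
  apply/pdP => k eps e0.
  have v1 : 0 < `|v| + 1 by rewrite addrC ltr_pwDl.
  have [del del0 Hd] := Dd s j k (eps / (`|v| + 1)) (divr_gt0 e0 v1).
  exists del => // h h0 hd; apply: le_trans (Hd h h0 hd v) _.
  by rewrite -hilb_normE mulrAC ler_pdivrMr // ler_pM2l // lerDl.
split.
- by move=> k; exact: (Ppr k).1.
- by move=> k; exact: (Ppr k).2.
- move=> v; exists (fun s k => D s k v); split=> [|s j|s].
  + by rewrite D0.
  + exact: Dpd.
  apply/continuousP_norm => k eps e0.
  have v1 : 0 < `|v| + 1 by rewrite addrC ltr_pwDl.
  have [del del0 Hd] := Dc s k (eps / (`|v| + 1)) (divr_gt0 e0 v1).
  exists del => // k' hk; have nk : near_pt del k k'.
    by move=> i; have := coord_le (k' - k) i; rewrite !mxE => h; exact: le_lt_trans h hk.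
  apply: le_trans (Hd k' nk v) _.
  by rewrite -hilb_normE mulrAC ler_pdivrMr // ler_pM2l // lerDl.
- have [|||||L L0 HL] := @family_Lip R V _ _ C d B V (fun v k => P k v)
    (fun j v k => D [:: j] k v) (fun v => `|v|) _ _ _ _ _.
  + by [].
  + by move=> v j; have := @Dpd [::] j v; rewrite D0.
  + move=> k0 j; have [del del0 Hd] := Dc [:: j] k0 1 ltr01.
    have [_ [M HM]] := Db [:: j] k0.
    pose t := Num.min del (`|M| + 1)^-1.
    have M1 : 0 < `|M| + 1 by rewrite addrC ltr_pwDl.
    have t0 : 0 < t by rewrite lt_min del0 invr_gt0.
    exists t => // k kt v.
    have nk : near_pt del k0 k.
      move=> i; have := coord_le (k - k0) i; rewrite !mxE => h; apply: (le_lt_trans h).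
      by apply: lt_le_trans kt _; rewrite ge_min lexx.
    have h1 := Hd k nk v; rewrite mul1r in h1.
    have h2 := HM v.
    have h3 : `|(D [:: j] k v : V)| <= (`|M| + 1) * `|v|.
      have := ler_normD (D [:: j] k v - D [:: j] k0 v : V) (D [:: j] k0 v : V); rewrite subrK => h4.
      apply: le_trans h4 _; rewrite addrC mulrDl mul1r; apply: lerD => //.
      by apply: (le_trans h2); apply: ler_wpM2r; [exact: (normr_ge0 v) | exact: ler_norm].
    apply: (le_trans h3); apply: ler_wpM2r => //.
    rewrite -[leLHS]invrK lef_pV2 ?posrE ?invr_gt0 //.
    by rewrite ge_min lexx orbT.
  (* A lattice translation turns the index [v] into [tz (- z) v], which has the same norm: the bound
     has to be invariant for all vectors at once, not for each one separately. *)
  + move=> c x y z h v.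
    have vE : v = tz z (tz (- z) v) by rewrite -tzD subrr tz0.
    have Pz w : P ((w + zr R z) *m B) v = tz z (P (w *m B) (tz (- z) v)).
      by rewrite {1}vE mulmxDl; exact: Pt.
    rewrite !Pz -(rlinB (isomL (tz_isom z))) (isomN (tz_isom z)).
    by apply: le_trans (h _) _; rewrite (isomN (tz_isom (- z))).
  + by move=> v k; case: (Ppr k) => -[[l _] i s] _; exact: (proj_norm Hip).
  by exists L => // x y v; exact: HL.
- exact: Pt.
- exact: PT.
Qed.

Lemma smooth_vec_smooth (f : 'rV[R]_d -> V) : smooth (@e_dir R d) f -> vec_smooth ip f.
Proof.
move=> [D [D0 Dd Dc]]; exists D; split=> // [s j|s].
  by have /pdP := Dd s j.
move=> k eps e0; have /continuousP_norm/(_ k eps e0)[del del0 Hd] := Dc s.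
exists del => // k' nk; apply: Hd; apply/norm_ltP => // i; rewrite !mxE; exact: nk.
Qed.

Lemma symmetric_bloch_frame P m : (forall k, orth_projector ip (P k) /\ has_rank (P k) m) ->
  op_smooth ip P ->
  (forall k l, in_lattice B l -> forall v, P (k + l) (tau l v) = tau l (P k v)) ->
  (forall k v, P (- k) (Th v) = Th (P k v)) ->
  exists phi : 'I_m -> 'rV[R]_d -> H,
    [/\ (forall k, onb_of_ran ip (fun a => phi a k) (P k)),
        (forall a, vec_smooth ip (phi a)),
        (forall a k l, in_lattice B l -> phi a (k + l) = tau l (phi a k))
      & (forall a k, phi a (- k) = Th (phi a k))].
Proof.
move=> Pp Ps Pt PT; have [phi [h1 h2 h3 h4]] := bloch_frame (op_smooth_bloch Pp Ps Pt PT).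
exists phi; split=> //; first by move=> a; exact: smooth_vec_smooth.
by move=> a k l [z ->]; exact: h3.
Qed.

End Frame.

Theorem mainTheorem1 (R : realType) (H : lmodType R[i]) (ip : H -> H -> R[i])
  (d m : nat) (B : 'M[R]_d) (P : 'rV[R]_d -> H -> H)
  (tau : 'rV[R]_d -> H -> H) (Theta : H -> H) :
  (d <= 3)%N ->
  separable_hilbert ip ->
  B \in unitmx ->
  (forall k, orth_projector ip (P k) /\ has_rank (P k) m) ->
  (* (P1) *)
  op_smooth ip P ->
  (* (P2) *)
  unitary_rep ip B tau ->
  (forall k l, in_lattice B l -> forall v, P (k + l) (tau l v) = tau l (P k v)) ->
  (* (P3) *)
  antiunitary ip Theta ->
  (forall k v, P (- k) (Theta v) = Theta (P k v)) ->
  (forall v, Theta (Theta v) = v) ->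
  (* (P4) *)
  (forall l, in_lattice B l -> forall v, tau l (Theta (tau l v)) = Theta v) ->
  exists phi : 'I_m -> 'rV[R]_d -> H,
    [/\ (forall k, onb_of_ran ip (fun a => phi a k) (P k)),
        (forall a, vec_smooth ip (phi a)),
        (forall a k l, in_lattice B l -> phi a (k + l) = tau l (phi a k))
      & (forall a k, phi a (- k) = Theta (phi a k))].
Proof.
move=> d3 [Hip _ _] Bu Pp Ps tauR Pt Thu PT ThTh Thtau.
exact: (symmetric_bloch_frame d3 Hip Bu tauR Thu ThTh Thtau Pp Ps Pt PT).
Qed.
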